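(* Let $0<q<1$. 1. If $f\in C(D)$ is holomorphic inside $D$, then the Toeplitz operator $T(f)\in C(D_q)$ is weakly holomorphic. 2. If $a\in C(D_q)$ is weakly holomorphic, then there exists $f\in C(D)$ which is holomorphic inside $D$ such that $a=T(f)$. 3. (Maximum principle) If $a\in \mathrm{Hol}(D_q)$, then $\|a\|=\|\sigma(a)\|_{\partial D}$, where $\|a\|$ is the norm of $a$ in $C(D_q)$ and $\|\cdot\|_{\partial D}$ is the supremum norm on $C(\partial D)$. 4. The space $\mathrm{Hol}(D_q)\subset C(D_q)$ is a Banach subalgebra isomorphic to the algebra $\mathrm{Hol}(D)\subset C(D)$ of continuous functions on $D$ which are holomorphic inside $D$. 5. The statements 1–4 are also true when the word ''holomorphic'' is replaced by ''antiholomorphic'' throughout: if $f\in C(D)$ is antiholomorphic inside $D$ then $T(f)$ is weakly antiholomorphic; if $a\in C(D_q)$ is weakly antiholomorphic then $a=T(f)$ for some $f\in C(D)$ antiholomorphic inside $D$; if $a\in C(D_q)$ is weakly antiholomorphic then $\|a\|=\|\sigma(a)\|_{\partial D}$; and the weakly antiholomorphic elements form a Banach subalgebra of $C(D_q)$ isomorphic to the algebra of continuous functions on $D$ which are antiholomorphic inside $D$. 6. If $a\in C(D_q)$, then $a$ is strongly antiholomorphic if and only if $a$ is weakly antiholomorphic.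
   Context: Setting. $0<q<1$ and $D=\{\zeta\in\mathbb{C}:|\zeta|\le 1\}$; ''inside $D$'' means on the open unit disk. Let $\mu$ be the probability measure $d\mu(\zeta)=\prod_{i\ge 0}(1-|\zeta|^2q^{i+1})\sum_{m\ge 0}q^m\,\delta_{|\zeta|^2=q^m}(\zeta)$ on $D$, where $\delta_{|\zeta|^2=r^2}$ is the normalized Lebesgue measure on the circle $|\zeta|^2=r^2$. Let $H=H^2(D,d\mu)\subset L^2(D,d\mu)$ be the closed subspace of holomorphic functions (the closed span of the mutually orthogonal monomials $\zeta^n$, $n\ge 0$), with orthonormal basis $e_n=\zeta^n/\sqrt{\prod_{i=0}^{n-1}(1-q^{i+1})}$, and let $P$ be the orthogonal projection of $L^2(D,d\mu)$ onto $H$. The inner product $(\cdot,\cdot)$ is conjugate-linear in the first variable. For $f\in C(D)$ the Toeplitz operator is $T(f)=PM(f)P:H\to H$, $M(f)$ being multiplication by $f$. Put $z=T(\zeta)$, $\bar z=T(\bar\zeta)=z^*$, so $ze_n=\sqrt{1-q^{n+1}}\,e_{n+1}$. $C(D_q)$ is the $C^*$-algebra of operators on $H$ generated by all $T(f)$, $f\in C(D)$; equivalently by $z$. It satisfies $\bar zz=qz\bar z+(1-q)$. The symbol map $\sigma:C(D_q)\to C(\partial D)$ is the surjective $*$-homomorphism whose kernel is the ideal of compact operators and which sends $z$ to the coordinate function $\zeta$ on the unit circle $\partial D$. Scaling. $j:H\to H$ is $j\phi(\zeta)=\phi(q\zeta)$, i.e. $je_n=q^ne_n$, and $\mathcal{D}=\{\phi\in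 H:\phi(\zeta/q)\in H\}=\mathrm{Ran}\,j$. An element $a\in C(D_q)$ is scalable if $J(a):=j^{-1}aj$ is a bounded operator on all of $H$ (equivalently, $a$ maps $\mathcal{D}$ to $\mathcal{D}$). Derivatives. On the domain $\mathcal{D}$ let $\bar\delta=(q-1)^{-1}j^{-1}z$ and $\delta=(1-q)^{-1}j^{-1}\bar z$. For scalable $a$, $\bar\partial a=\bar\delta a-J(a)\bar\delta$ and $\partial a=\delta a-J(a)\delta$ as operators on $\mathcal{D}$. For arbitrary $a\in C(D_q)$ and $\phi\in\mathcal{D}$, $Q_{\partial a}(\phi)=(1-q)^{-1}(j^{-1}\phi,[\bar z,a]\phi)$ and $Q_{\bar\partial a}(\phi)=(q-1)^{-1}(j^{-1}\phi,[z,a]\phi)$. Definitions. $a\in C(D_q)$ is weakly holomorphic if $Q_{\bar\partial a}(\phi)=0$ for all $\phi\in\mathcal{D}$; $\mathrm{Hol}(D_q)$ denotes the set of weakly holomorphic elements. $a$ is weakly antiholomorphic if $Q_{\partial a}(\phi)=0$ for all $\phi\in\mathcal{D}$, and strongly antiholomorphic if $a$ is scalable and $\partial a=0$. *)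

(* Defs.v *)
From HB Require Import structures.
From mathcomp Require Import all_boot all_order all_algebra.
From mathcomp Require Import complex.
From mathcomp Require Import all_classical all_reals all_analysis measurable_realfun.
Set Implicit Arguments. Unset Strict Implicit. Unset Printing Implicit Defensive.
Import Order.TTheory GRing.Theory Num.Theory.
Import numFieldNormedType.Exports.
Local Notation cabs := ComplexField.Normc.normc.
Local Notation Re := complex.Re.
Local Notation Im := complex.Im.
Local Open Scope classical_set_scope.
Local Open Scope complex_scope.
Local Open Scope ring_scope.

Set Warnings "-redundant-canonical-projection".

(* The complex plane R[i] as a normed space over itself, with its Borel sets;
   hence [derivable f z 1] below means complex differentiability. *)
HB.instance Definition _ (R : realType) :=
  NormedModule.copy R[i] (R[i] : numFieldType)^o.
HB.instance Definition _ (R : realType) :=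
  Measurable.copy R[i] (g_sigma_algebraType (@open R[i])).

(* The complex space L^2(mu): square-integrable functions modulo equality
   mu-almost everywhere. *)
Section L2.
Context d (T : measurableType d) (R : realType).
Variable mu : {measure set T -> \bar R}.
Implicit Types f g : T -> R[i].

Definition cnorm2 f := 'N[mu]_2%:E [EFin \o (@cabs R \o f)]%E.

Definition sqint f : Prop :=
  [/\ measurable_fun setT (@Re R \o f), measurable_fun setT (@Im R \o f)
    & (cnorm2 f < +oo)%E].

Definition L2fun : {pred T -> R[i]} := [pred f | `[< sqint f >]].

Lemma measurable_normc f : measurable_fun setT (@Re R \o f) ->
  measurable_fun setT (@Im R \o f) -> measurable_fun setT (@cabs R \o f).
Proof.
move=> mr mi.
rewrite (_ : @cabs R \o f = Num.sqrt \o (fun x => Re (f x) ^+ 2 + Im (f x) ^+ 2)).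
  apply: (@measurableT_comp _ _ _ _ _ _ (@Num.sqrt R)).
    exact: continuous_measurable_fun (@sqrt_continuous R).
  by apply: measurable_funD; exact: measurable_funX.
by apply/funext => x /=; case: (f x).
Qed.

Lemma cnorm2_le f (g : T -> R) : measurable_fun setT (@Re R \o f) ->
  measurable_fun setT (@Im R \o f) -> measurable_fun setT g ->
  (forall x, cabs (f x) <= g x) -> (cnorm2 f <= 'N[mu]_2%:E [EFin \o g])%E.
Proof.
move=> mr mi mg fg; rewrite /cnorm2 unlock.
have mf := measurable_normc mr mi.
have n0 x : 0 <= cabs (f x) by case: (f x) => a b; exact: sqrtr_ge0.
apply: gt0_ler_poweR => //; rewrite ?in_itv/= ?leey ?andbT ?integral_ge0//.
apply: ge0_le_integral => //.
- apply/measurable_EFinP/(measurableT_comp (measurable_powR _)) => //.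
  exact: measurableT_comp.
- apply/measurable_EFinP/(measurableT_comp (measurable_powR _)) => //.
  exact: measurableT_comp.
move=> x _ /=; rewrite lee_fin ge0_ler_powR ?nnegrE//.
by rewrite !ger0_norm// (le_trans _ (fg x)).
Qed.

Lemma cnorm2D f g : measurable_fun setT (@Re R \o f) ->
  measurable_fun setT (@Im R \o f) -> measurable_fun setT (@Re R \o g) ->
  measurable_fun setT (@Im R \o g) -> (cnorm2 (f + g)%R <= cnorm2 f + cnorm2 g)%E.
Proof.
move=> rf jf rg jg.
have mf := measurable_normc rf jf; have mg := measurable_normc rg jg.
have p1 : (1 <= 2 :> R)%R by rewrite ler1n.
apply: (le_trans _ (minkowski_EFin mu mf mg p1)).
apply: cnorm2_le.
- rewrite (_ : _ \o _ = (Re (R:=R) \o f) \+ (Re (R:=R) \o g)); first exact: measurable_funD.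
  by apply/funext => x; rewrite /= [(f + g) x]/(f x + g x); case: (f x) (g x) => [? ?] [].
- rewrite (_ : _ \o _ = (Im (R:=R) \o f) \+ (Im (R:=R) \o g)); first exact: measurable_funD.
  by apply/funext => x; rewrite /= [(f + g) x]/(f x + g x); case: (f x) (g x) => [? ?] [].
- exact: measurable_funD.
by move=> x; exact: le_normcD.
Qed.

Lemma cnorm2Z (a : R[i]) f : measurable_fun setT (@Re R \o f) ->
  measurable_fun setT (@Im R \o f) ->
  cnorm2 (a *: f) = ((cabs a)%:E * cnorm2 f)%E.
Proof.
move=> rf jf; have mf := measurable_normc rf jf.
have a0 : (0 <= cabs a)%R by case: a => ? ?; exact: sqrtr_ge0.
rewrite /cnorm2.
have -> : EFin \o (cabs (R:=R) \o (a *: f)) = (fun x => (cabs a)%:E * (EFin \o (cabs (R:=R) \o f)) x)%E.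
  by apply/funext => x /=; rewrite ComplexField.Normc.normcM EFinM.
rewrite unlock; under eq_integral.
  move=> x _; rewrite abseM poweRM; [|by []|by []]; over.
have i0 : (0 <= \int[mu]_x `|(EFin \o (cabs (R:=R) \o f)) x| `^ 2)%E.
  by apply: integral_ge0 => x _; exact: poweR_ge0.
rewrite ge0_integralZl//; last 3 first.
- apply: (@measurableT_comp _ _ _ _ _ _ (fun x => x `^ 2)%E); first exact: measurable_poweR.
  by apply: measurableT_comp => //; exact/measurable_EFinP.
- by move=> x _; exact: poweR_ge0.
- exact: poweR_ge0.
rewrite (poweRM _ _ i0); last exact: poweR_ge0.
by rewrite -poweRrM mulfV ?pnatr_eq0// poweRe1// gee0_abs// lee_fin.
Qed.

Lemma L2funP f : reflect (sqint f) (f \in L2fun).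
Proof. exact: asboolP. Qed.

Lemma L2fun_submod : subsemimod_closed L2fun.
Proof.
split; [split|].
- apply/L2funP; split; [exact: measurable_cst|exact: measurable_cst|].
  rewrite /cnorm2 (_ : EFin \o _ = cst 0%E); first by rewrite Lnorm0 ?ltry.
  by apply/funext => x; congr EFin; exact: (@ComplexField.Normc.normc0 R).
- move=> f g /L2funP[rf jf nf] /L2funP[rg jg ng]; apply/L2funP; split.
  + rewrite (_ : _ \o _ = (Re (R:=R) \o f) \+ (Re (R:=R) \o g)); first exact: measurable_funD.
    by apply/funext => x; rewrite /= [(f + g) x]/(f x + g x); case: (f x) (g x) => [? ?] [].
  + rewrite (_ : _ \o _ = (Im (R:=R) \o f) \+ (Im (R:=R) \o g)); first exact: measurable_funD.
    by apply/funext => x; rewrite /= [(f + g) x]/(f x + g x); case: (f x) (g x) => [? ?] [].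
  + by apply: le_lt_trans (cnorm2D rf jf rg jg) _; rewrite lte_add_pinfty.
- move=> a f /L2funP[rf jf nf]; apply/L2funP; split.
  + rewrite (_ : _ \o _ = (fun x => Re a * Re (f x) - Im a * Im (f x))).
      by apply: measurable_funB; apply: measurable_funM.
    by apply/funext => x; rewrite /= [(a *: f) x]/(a * f x); case: a (f x) => [? ?] [].
  + rewrite (_ : _ \o _ = (fun x => Re a * Im (f x) + Im a * Re (f x))).
      by apply: measurable_funD; apply: measurable_funM.
    by apply/funext => x; rewrite /= [(a *: f) x]/(a * f x); case: a (f x) => [? ?] [].
  + rewrite cnorm2Z// lte_mul_pinfty// lee_fin.
    by case: (a) => ? ?; exact: sqrtr_ge0.
Qed.
HB.instance Definition _ := GRing.isSubSemiModClosed.Build _ _ L2fun L2fun_submod.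

Record preL2 := PreL2 { preL2val :> T -> R[i]; _ : preL2val \in L2fun }.
HB.instance Definition _ := [isSub for preL2val].
HB.instance Definition _ := [Choice of preL2 by <:].
HB.instance Definition _ := [SubChoice_isSubLmodule of preL2 by <:].

Definition L2null : {pred preL2} := [pred f : preL2 | `[< (f : T -> R[i]) = 0 %[ae mu] >]].

Lemma L2null_zmod_closed : zmod_closed L2null.
Proof.
split; first by apply/asboolP; exact: ae_eq_refl.
move=> f g /asboolP f0 /asboolP g0; apply/asboolP.
by move: f0 g0; apply: filterS2 => x /= /(_ I) fx /(_ I) gx _; rewrite -[LHS]/(f x - g x) fx gx subr0.
Qed.
HB.instance Definition _ := GRing.isZmodClosed.Build preL2 L2null L2null_zmod_closed.

Definition L2 := Quotient.quot L2null.
HB.instance Definition _ := GRing.Zmodule.on L2.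
HB.instance Definition _ := Quotient.on L2.

Local Open Scope quotient_scope.

Definition L2scale (a : R[i]) (x : L2) : L2 := \pi_L2 (a *: repr x).

Lemma L2null_scale a (f : preL2) : f \in L2null -> a *: f \in L2null.
Proof.
move=> /asboolP f0; apply/asboolP.
by apply: filterS f0 => x /= /(_ I) fx _; rewrite -[LHS]/(a *: f x) fx scaler0.
Qed.

Lemma pi_scale a (f : preL2) : \pi_L2 (a *: f) = L2scale a (\pi_L2 f).
Proof.
apply/eqP; rewrite -Quotient.idealrBE -scalerBr; apply: L2null_scale.
by rewrite Quotient.idealrBE reprK.
Qed.

Lemma L2scaleA a b x : L2scale a (L2scale b x) = L2scale (a * b) x.
Proof.
by elim/quotW: x => f; rewrite -(pi_scale b f) -pi_scale -(pi_scale _ f) scalerA.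
Qed.

Lemma L2scale1 : left_id 1 L2scale.
Proof. by move=> x; elim/quotW: x => f; rewrite -(pi_scale _ f) scale1r. Qed.

Lemma L2scaleDr : right_distributive L2scale +%R.
Proof.
move=> a x y; elim/quotW: x => f; elim/quotW: y => g.
rewrite -(pi_scale _ f) -(pi_scale _ g) -[_ f + _ g]raddfD/=.
by rewrite -(pi_scale _ (f + g)) scalerDr raddfD.
Qed.

Lemma L2scaleDl x : {morph L2scale^~ x : a b / a + b}.
Proof.
move=> a b /=; elim/quotW: x => f.
by rewrite -!(pi_scale _ f) scalerDl raddfD.
Qed.
HB.instance Definition _ := GRing.Zmodule_isLmodule.Build R[i] L2
  L2scaleA L2scale1 L2scaleDr L2scaleDl.

Lemma cnorm2_ae f g : sqint f -> sqint g -> f = g %[ae mu] -> cnorm2 f = cnorm2 g.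
Proof.
move=> [rf jf _] [rg jg _] fg; rewrite /cnorm2 unlock; congr (_ `^ _)%E.
have mf := measurable_normc rf jf; have mg := measurable_normc rg jg.
apply: ae_eq_integral => //.
- apply: (@measurableT_comp _ _ _ _ _ _ (fun x => x `^ 2)%E); first exact: measurable_poweR.
  by apply: measurableT_comp => //; exact/measurable_EFinP.
- apply: (@measurableT_comp _ _ _ _ _ _ (fun x => x `^ 2)%E); first exact: measurable_poweR.
  by apply: measurableT_comp => //; exact/measurable_EFinP.
- by apply: filterS fg => x /= /(_ I) ->.
Qed.

Lemma cnorm2_fin (f : preL2) : cnorm2 f \is a fin_num.
Proof.
case: f => f /= /L2funP[_ _ fy].
by rewrite fin_numElt fy (lt_le_trans ltNy0)// Lnorm_ge0.
Qed.

Definition L2norm (x : L2) : R := fine (cnorm2 (repr x)).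

Lemma L2norm_pi (f : preL2) : (L2norm (\pi_L2 f))%:E = cnorm2 f.
Proof.
rewrite fineK ?cnorm2_fin//; apply: cnorm2_ae; [exact/L2funP/valP|exact/L2funP/valP|].
have /asboolP : repr (\pi_L2 f) - f \in L2null by rewrite Quotient.idealrBE reprK.
by apply: filterS => x /= /(_ I) /subr0_eq.
Qed.

Lemma L2norm_ge0 x : 0 <= L2norm x.
Proof. by rewrite fine_ge0// Lnorm_ge0. Qed.

Lemma L2normD x y : (L2norm (x + y))%:C <= (L2norm x)%:C + (L2norm y)%:C.
Proof.
elim/quotW: x => f; elim/quotW: y => g; rewrite -[_ f + _ g]raddfD/=.
rewrite -[X in _ <= X]raddfD/= lecR -lee_fin EFinD (L2norm_pi f) (L2norm_pi g).
rewrite (L2norm_pi (f + g)).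
by case: f g => [f /= /L2funP[? ? _]] [g /= /L2funP[? ? _]]; exact: cnorm2D.
Qed.

Lemma L2normZ (a : R[i]) x : (L2norm (a *: x))%:C = `|a| * (L2norm x)%:C.
Proof.
elim/quotW: x => f.
have -> : `|a| = (cabs a)%:C by [].
rewrite -rmorphM; congr _%:C; apply: EFin_inj.
rewrite -[_ *: _]/(L2scale _ _) -(pi_scale _ f) (L2norm_pi (a *: f)) EFinM.
by rewrite (L2norm_pi f); case: f => [f /= /L2funP[? ? _]]; exact: cnorm2Z.
Qed.

Lemma L2norm_eq0 x : (L2norm x)%:C = 0 -> x = 0.
Proof.
elim/quotW: x => f [] fN0; apply/eqP.
rewrite -[0](raddf0 \pi_L2) -Quotient.idealrBE subr0; apply/asboolP.
have := L2norm_pi f; rewrite fN0 => /esym; case: f {fN0} => f /= /L2funP[rf jf _].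
have mf : measurable_fun setT (EFin \o (@cabs R \o f)).
  exact/measurable_EFinP/measurable_normc.
move=> /(Lnorm_eq0_eq0 mf) => /(_ (ltr0n _ 2)).
by apply: filterS => x /= /(_ I) [] /ComplexField.Normc.eq0_normc.
Qed.

HB.instance Definition _ := @Lmodule_isNormed.Build R[i] L2
  (fun x => (L2norm x)%:C) L2normD L2normZ L2norm_eq0.

(* The class of f; junk (the class of 0) when f is not square-integrable. *)
Definition L2class f : L2 := \pi_L2 (insubd 0 f).

(* Conjugate-linear in the first argument. *)
Definition L2dot (x y : L2) : R[i] :=
  (\int[mu]_t Re ((repr x t)^*%C * repr y t))
  +i* (\int[mu]_t Im ((repr x t)^*%C * repr y t)).

End L2.

(* The closed linear span of a sequence of vectors. *)
Section closed_span.
Context (K : numFieldType) (V : normedModType K) (e : nat -> V).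

Definition finspan : set V :=
  [set x | exists n (c : nat -> K), x = \sum_(i < n) c i *: e i].

Definition cspan : {pred V} := [pred x | `[< closure finspan x >]].

Lemma finspan_linear a x y : finspan x -> finspan y -> finspan (a *: x + y).
Proof.
move=> [n [c ->]] [m [d ->]].
exists (n + m)%N, (fun i => a * (if (i < n)%N then c i else 0) +
                             (if (i < m)%N then d i else 0)).
under [RHS]eq_bigr do rewrite scalerDl -scalerA.
rewrite big_split/= -scaler_sumr; congr (a *: _ + _).
- rewrite big_split_ord/= [X in _ + X]big1 ?addr0.
    by apply: eq_bigr => i _; rewrite ltn_ord.
  by move=> i _; rewrite ltnNge leq_addr/= scale0r.
- rewrite addnC big_split_ord/= [X in _ + X]big1 ?addr0.
    by apply: eq_bigr => i _; rewrite ltn_ord.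
  by move=> i _; rewrite ltnNge leq_addr/= scale0r.
Qed.

Lemma cspan_submod : submod_closed cspan.
Proof.
split.
  apply/asboolP/subset_closure; exists 0%N, (fun=> 0); by rewrite big_ord0.
move=> a x y /asboolP cx /asboolP cy; apply/asboolP => B nB.
have cv : (fun z : V * V => a *: z.1 + z.2) @ (x, y) --> a *: x + y.
  by apply: cvgD; [apply: cvgZr; exact: cvg_fst|exact: cvg_snd].
have [[U W] [nU nW] UW] : filter_prod (nbhs x) (nbhs y)
    ((fun z : V * V => a *: z.1 + z.2) @^-1` B) by exact: cv.
rewrite /= in nU nW.
have [u [su Uu]] := cx U nU.
have [w [sw Ww]] := cy W nW.
exists (a *: u + w); split; first exact: finspan_linear.
by apply: (UW (u, w)).
Qed.
HB.instance Definition _ := GRing.isSubmodClosed.Build _ _ cspan cspan_submod.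

End closed_span.

Section measure_on_disk.
Context (R : realType).
Implicit Types (q r t : R) (m : nat).

Definition circle_map r : measurableTypeR R -> R[i] :=
  fun t : R => (r * cos t) +i* (r * sin t).

Lemma real_complex_continuous : continuous (fun x : R => x%:C : R[i]).
Proof.
move=> x; apply/cvgrPdist_lt => e e0.
have [e' ee] : exists e' : R, e = e'%:C.
  by exists (Re e); rewrite RRe_real// ger0_real// ltW.
rewrite ee ltcR in e0 *; near=> y.
rewrite -rmorphB normc_def/= expr0n/= addr0 sqrtr_sqr ltcR.
near: y; exact: (@cvgr_dist_lt _ _ _ _ _ id x cvg_id).
Unshelve. all: by end_near. Qed.

Lemma circle_map_measurable r : measurable_fun setT (circle_map r).
Proof.
have cc : continuous (circle_map r : R -> R[i]).
  rewrite (_ : (circle_map r : R -> R[i]) =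
      fun t : R => (r * cos t)%:C + 'i%C * (r * sin t)%:C); last first.
    by apply/funext => t; rewrite /circle_map [LHS]complexE.
  move=> t; apply: cvgD; last apply: cvgMr.
  - apply: continuous_comp; last exact: real_complex_continuous.
    by apply: cvgMr; exact: continuous_cos.
  - apply: continuous_comp; last exact: real_complex_continuous.
    by apply: cvgMr; exact: continuous_sin.
apply: (measurability (@open R[i])) => // _ [U oU <-].
rewrite setTI; apply: open_measurable.
by move/continuousP : cc; exact.
Qed.
HB.instance Definition _ r :=
  @isMeasurableFun.Build _ _ (measurableTypeR R) R[i] (circle_map r)
    (circle_map_measurable r).

Lemma twopi_gt0 : 0 < 2 * pi :> R.
Proof. by rewrite mulr_gt0// pi_gt0. Qed.

(* The normalized Lebesgue measure on the circle of radius r. *)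
Definition circle_prob r := 
  distribution (uniform_prob twopi_gt0) (circle_map r).

(* The mass q^m prod_i (1 - |z|^2 q^(i+1)) of the circle |z|^2 = q^m. *)
Definition qweight q m : R :=
  q ^+ m * limn (fun n => \prod_(i < n) (1 - q ^+ m * q ^+ i.+1)).

(* A measure on the whole plane, carried by the closed unit disk. The absolute
   value only serves to build an element of {nonneg R}: for 0 < q < 1 the
   weights are nonnegative. *)
Definition disk_measure q := mseries
  (fun m => mscale (`|qweight q m|%:nng) (circle_prob (Num.sqrt (q ^+ m)))) 0.

End measure_on_disk.

Section quantum_disk.
Context (R : realType) (q : R).
Local Notation C := R[i].

(* C(D) and C(circle) are handled as functions on the plane whose restriction to
   the set is continuous; their values elsewhere are irrelevant. *)
Definition disk : set C := [set z | `|z| <= 1].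
Definition circle : set C := [set z | `|z| = 1].

Local Notation L2mu := (L2 (disk_measure q)).

Definition monomial (n : nat) : L2mu :=
  L2class (disk_measure q) (fun z => z ^+ n).

Record hardy := Hardy { hardyval :> L2mu; _ : hardyval \in cspan monomial }.
HB.instance Definition _ := [isSub for hardyval].
HB.instance Definition _ := [Choice of hardy by <:].
HB.instance Definition _ := [SubChoice_isSubLmodule of hardy by <:].

Definition hardy_norm (phi : hardy) : C := `|val phi|.

Lemma hardy_normD phi psi :
  hardy_norm (phi + psi) <= hardy_norm phi + hardy_norm psi.
Proof. by rewrite /hardy_norm raddfD ler_normD. Qed.

Lemma hardy_normZ (a : C) phi : hardy_norm (a *: phi) = `|a| * hardy_norm phi.
Proof. by rewrite /hardy_norm linearZ normrZ. Qed.

Lemma hardy_norm_eq0 phi : hardy_norm phi = 0 -> phi = 0.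
Proof. by move=> /normr0_eq0 h; apply: val_inj; rewrite h raddf0. Qed.

HB.instance Definition _ := @Lmodule_isNormed.Build C hardy
  hardy_norm hardy_normD hardy_normZ hardy_norm_eq0.

Definition hdot (phi psi : hardy) : C := L2dot (val phi) (val psi).

(* The orthogonal projection of L^2 onto the Hardy space. *)
Definition proj (x : L2mu) : hardy :=
  xget 0 [set h | forall k : hardy, L2dot (val k) (x - val h) = 0].

Definition mulop (f : C -> C) (x : L2mu) : L2mu :=
  L2class (disk_measure q) (fun z => patch (fun=> 0) disk f z * val (repr x) z).

Definition toeplitz (f : C -> C) (phi : hardy) : hardy :=
  proj (mulop f (val phi)).

Definition zop : hardy -> hardy := toeplitz id.
Definition zbar : hardy -> hardy := toeplitz (fun z => z^*%C).

Implicit Types a b : hardy -> hardy.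

Definition bounded_op a : Prop :=
  linear a /\ exists M : R, forall phi, `|a phi| <= M%:C * `|phi|.

Definition opnorm a : R := sup [set Re `|a phi| | phi in [set phi | `|phi| <= 1]].

Definition compact_op a : Prop :=
  linear a /\ compact (closure (a @` [set phi | `|phi| <= 1])).

Definition adjoint_op a b : Prop :=
  forall phi psi, hdot (a phi) psi = hdot phi (b psi).

Record cstar_algebra (S : set (hardy -> hardy)) : Prop := CstarAlgebra {
  cstar_bounded : forall a, S a -> bounded_op a;
  cstarD : forall a b, S a -> S b -> S (a \+ b);
  cstarZ : forall (c : C) a, S a -> S (c \*: a);
  cstar_comp : forall a b, S a -> S b -> S (a \o b);
  cstar_adjoint : forall a, S a -> exists2 b, S b & adjoint_op a b;
  cstar_closed : forall a, bounded_op a ->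
    (forall e : R, 0 < e -> exists2 b, S b & opnorm (a \- b) < e) -> S a }.

Definition CDq : set (hardy -> hardy) :=
  [set a | forall S, cstar_algebra S ->
    (forall f, {within disk, continuous f} -> S (toeplitz f)) -> S a].

(* Operators outside C(D_q) and points off the unit circle are unconstrained. *)
Record symbol_map (sigma : (hardy -> hardy) -> C -> C) : Prop := SymbolMap {
  symbol_cont : forall a, CDq a -> {within circle, continuous (sigma a)};
  symbolD : forall a b, CDq a -> CDq b ->
    forall z, circle z -> sigma (a \+ b) z = sigma a z + sigma b z;
  symbolZ : forall (c : C) a, CDq a ->
    forall z, circle z -> sigma (c \*: a) z = c * sigma a z;
  symbolM : forall a b, CDq a -> CDq b ->
    forall z, circle z -> sigma (a \o b) z = sigma a z * sigma b z;
  symbol_adjoint : forall a b, CDq a -> CDq b -> adjoint_op a b ->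
    forall z, circle z -> sigma b z = (sigma a z)^*%C;
  symbol_surj : forall g : C -> C, {within circle, continuous g} ->
    exists2 a, CDq a & forall z, circle z -> sigma a z = g z;
  symbol_ker : forall a,
    compact_op a <-> CDq a /\ forall z, circle z -> sigma a z = 0;
  symbol_z : forall z, circle z -> sigma zop z = z }.

Definition supnorm (A : set C) (f : C -> C) : R := sup [set Re `|f z| | z in A].

(* jop phi is phi(q z). As every circle |z|^2 = q^m is sent by z |-> q z to the
   charged circle |z|^2 = q^(m+2), this does not depend on the representative
   of phi. *)
Definition jop (phi : hardy) : hardy := xget 0 [set psi : hardy |
  val (repr (val psi)) =
  (fun z => val (repr (val phi)) (q%:C * z)) %[ae disk_measure q]].

Definition jdom : set hardy := range jop.

(* The inverse of the injection jop, meaningful on jdom only. *)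
Definition jinv (psi : hardy) : hardy := xget 0 [set phi | jop phi = psi].

Definition J a : hardy -> hardy := jinv \o a \o jop.

Definition scalable_op a : Prop :=
  (forall phi, jdom (a (jop phi))) /\ bounded_op (J a).

Definition delta (phi : hardy) : hardy := (1 - q)^-1%:C *: jinv (zbar phi).

Definition del a (phi : hardy) : hardy := delta (a phi) - J a (delta phi).

Definition Qdel a (phi : hardy) : C :=
  (1 - q)^-1%:C * hdot (jinv phi) (zbar (a phi) - a (zbar phi)).

Definition Qdelbar a (phi : hardy) : C :=
  (q - 1)^-1%:C * hdot (jinv phi) (zop (a phi) - a (zop phi)).

Definition weakly_hol : set (hardy -> hardy) :=
  [set a | CDq a /\ forall phi, jdom phi -> Qdelbar a phi = 0].

Definition weakly_antihol : set (hardy -> hardy) :=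
  [set a | CDq a /\ forall phi, jdom phi -> Qdel a phi = 0].

Definition strongly_antihol : set (hardy -> hardy) :=
  [set a | [/\ CDq a, scalable_op a & forall phi, jdom phi -> del a phi = 0]].

Definition HolD : set (C -> C) :=
  [set f | {within disk, continuous f} /\ forall z, `|z| < 1 -> derivable f z 1].

Definition AntiHolD : set (C -> C) :=
  [set f | {within disk, continuous f} /\
    forall z, `|z| < 1 -> derivable (fun w => (f w)^*%C) z 1].

(* A closed unital subalgebra of the Banach algebra C(D_q). *)
Record banach_subalgebra (S : set (hardy -> hardy)) : Prop := BanachSubalgebra {
  subalg_CDq : S `<=` CDq;
  subalg1 : S id;
  subalgD : forall a b, S a -> S b -> S (a \+ b);
  subalgZ : forall (c : C) a, S a -> S (c \*: a);
  subalgM : forall a b, S a -> S b -> S (a \o b);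
  subalg_closed : forall a, CDq a ->
    (forall e : R, 0 < e -> exists2 b, S b & opnorm (a \- b) < e) -> S a }.

(* iso_inj: elements of A are identified when they agree on the disk. *)
Record isometric_alg_iso (A : set (C -> C)) (S : set (hardy -> hardy))
    (Phi : (C -> C) -> hardy -> hardy) : Prop := IsometricAlgIso {
  iso_in : forall f, A f -> S (Phi f);
  iso_surj : forall a, S a -> exists2 f, A f & Phi f = a;
  iso_inj : forall f g, A f -> A g -> Phi f = Phi g <-> {in disk, f =1 g};
  iso1 : Phi (fun=> 1) = id;
  isoD : forall f g, A f -> A g -> Phi (f \+ g) = Phi f \+ Phi g;
  isoZ : forall (c : C) f, A f -> Phi (c \*: f) = c \*: Phi f;
  isoM : forall f g, A f -> A g -> Phi (f \* g) = Phi f \o Phi g;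
  iso_norm : forall f, A f -> opnorm (Phi f) = supnorm disk f }.

End quantum_disk.

(* Main.v *)
Require Import Defs.
From HB Require Import structures.
From mathcomp Require Import all_boot all_order all_algebra.
From mathcomp Require Import complex ring lra cyclic separable cyclotomic.
From mathcomp Require Import all_classical all_reals all_analysis measurable_realfun.
Set Implicit Arguments. Unset Strict Implicit. Unset Printing Implicit Defensive.
Import Order.TTheory GRing.Theory Num.Theory.
Import numFieldNormedType.Exports.
Local Open Scope classical_set_scope.
Local Open Scope complex_scope.
Local Open Scope ring_scope.

(* By polarization, a is weakly holomorphic exactly when it commutes with z (the
   range of j is dense), and weakly antiholomorphic exactly when its adjoint is
   weakly holomorphic. If f is holomorphic, mean values over the charged circles
   give the matrix of T(f) in the monomials, and it commutes with z. Conversely let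
   a in C(D_q) commute with z. On unit vectors v = n^(-1/2) sum_(k<n) conj(w)^k e_k,
   |w| = 1, the operator z is almost multiplication by w, so T(f) is almost
   multiplication by f(w); hence every a in C(D_q) has a symbol g with
   a v - g(w) v -> 0 uniformly in w. For a commuting with z the numbers (v, a v)
   are values at w of polynomials p_n, which converge to g uniformly on the circle,
   so by the maximum principle uniformly on the disk; the limit F is continuous,
   holomorphic inside, and a = T(F) as both have the same Taylor coefficients. The
   same polynomials give |F| <= ||a|| on the disk. An abstract symbol map sigma
   agrees with g on T(f) because it is bounded by sup |f| on the disk algebra.
   Finally j T(f) = T(f(q .)) j for f holomorphic, and j is self-adjoint, so that
   J(T(f)) = T(f(q .)) for f antiholomorphic. *)

(** [HolD] gives a derivative at each point of the open disk and continuity up to the boundary, but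
    no continuity of the derivative; hence Cauchy's theorem is reached through Goursat's bisection.
    The unit circle carries mass while f need not be differentiable there, so the coefficients on it
    are limits from inside. The converse direction runs on polynomials alone: differentiability of a
    uniform limit comes from the maximum principle applied to difference quotients. The measure
    enters through two facts: its weights are comparable with q^m, and the norms [rho n] of the
    monomials are nonincreasing and bounded below by a positive constant. The second makes the
    defects rho n - rho n.+1 summable, so that z is a summable perturbation of an isometric shift.
    As [CDq] is an intersection over all C*-algebras containing the T(f), a property of its elements
    is proved by showing that the operators having it form such an algebra; this forces the symbol
    of the adjoint to be carried along with that of the operator. *)

(** * Integrals of continuous real functions over segments *)

Section segment_integral.
Context (R : realType).
Implicit Types (f g : R -> R) (a b : R).
Local Notation mu := (@lebesgue_measure R).

Definition segint f a b : R := \int[mu]_(x in `[a, b]) f x.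

Lemma cts_integrable f a b : {within `[a, b], continuous f} ->
  mu.-integrable `[a, b] (EFin \o f).
Proof. by move=> cf; apply: continuous_compact_integrable => //; exact: segment_compact. Qed.

Lemma segint_cst k a b : a <= b -> segint (fun=> k) a b = k * (b - a).
Proof.
move=> ab; rewrite /segint Rintegral_cst//; congr (_ * _).
by rewrite /fine/= lebesgue_measure_itv/= lte_fin; case: ltgtP ab => // -> _; rewrite subrr.
Qed.

Lemma segintB f g a b : {within `[a, b], continuous f} ->
  {within `[a, b], continuous g} ->
  segint (fun x => f x - g x) a b = segint f a b - segint g a b.
Proof. by move=> cf cg; apply: RintegralB => //; exact: cts_integrable. Qed.

Lemma segint_le f g a b : {within `[a, b], continuous f} ->
  {within `[a, b], continuous g} -> (forall x, a <= x <= b -> f x <= g x) ->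
  segint f a b <= segint g a b.
Proof.
move=> cf cg fg; apply: le_Rintegral; [by []|exact: cts_integrable|exact: cts_integrable|].
by move=> x /=; rewrite in_itv/=; exact: fg.
Qed.

Lemma segint_near f k e a b : a <= b -> {within `[a, b], continuous f} ->
  (forall x, a <= x <= b -> `|f x - k| <= e) ->
  `|segint f a b - k * (b - a)| <= e * (b - a).
Proof.
move=> ab cf fke.
have cc c : {within `[a, b], continuous (fun=> c : R)} by apply: continuous_subspaceT => x; exact: cvg_cst.
have h1 : segint f a b <= segint (fun=> k + e) a b.
  by apply: segint_le => // x /fke; rewrite ler_norml => /andP[_]; lra.
have h2 : segint (fun=> k - e) a b <= segint f a b.
  by apply: segint_le => // x /fke; rewrite ler_norml => /andP[]; lra.
move: h1 h2; rewrite !segint_cst// ler_norml => h1 h2; apply/andP; split; lra.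
Qed.

Lemma segint_split f a m b : a <= m -> m <= b -> {within `[a, b], continuous f} ->
  segint f a b = segint f a m + segint f m b.
Proof.
move=> am mb cf; rewrite /segint.
have fi := cts_integrable cf.
have := @Rintegral_itvB _ f (BLeft a) (BRight b) m fi.
rewrite !bnd_simp => /(_ am mb) h.
rewrite Rintegral_itv_obnd_cbnd in h; first by rewrite -h; ring.
apply: integrableS fi => //; move=> x /=; rewrite !in_itv/= => /andP[mx ->].
by rewrite (le_trans am (ltW mx)).
Qed.

End segment_integral.

(* Goursat's lemma for a closed 1-form P dx + Q dy, the partial derivatives of P
   and Q being neither continuous nor integrable. *)
Section goursat.
Context (R : realType) (P Q : R -> R -> R) (D : set R).

(** The Jacobian matrix of (P, Q) is symmetric: the shared coefficient [be] states that dP/dy =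
    dQ/dx, i.e. that the form is closed. Only x is restricted to D, since y will be an angle. *)
Hypothesis closedPQ : forall x0 y0, D x0 -> exists al be ga : R,
  forall e : R, 0 < e -> exists2 d : R, 0 < d & forall x y,
    `|x - x0| < d -> `|y - y0| < d ->
    `|P x y - P x0 y0 - al * (x - x0) - be * (y - y0)| <= e * (`|x - x0| + `|y - y0|) /\
    `|Q x y - Q x0 y0 - be * (x - x0) - ga * (y - y0)| <= e * (`|x - x0| + `|y - y0|).

Local Lemma lin_cvg (f : R -> R) x0 k : (forall e : R, 0 < e -> exists2 d : R, 0 < d & forall x,
    `|x - x0| < d -> `|f x - f x0 - k * (x - x0)| <= e * `|x - x0|) -> {for x0, continuous f}.
Proof.
move=> h; apply/cvgrPdist_le => e e0.
have [d d0 hd] := h _ ltr01.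
have K0 : 0 < `|k| + 1 by rewrite ltr_wpDl.
near=> x.
have xd : `|x - x0| < d.
  by rewrite distrC; near: x; exact: (@cvgr_dist_lt _ _ _ _ _ id x0 cvg_id).
have xe : `|x - x0| < e / (`|k| + 1).
  by rewrite distrC; near: x; apply: (@cvgr_dist_lt _ _ _ _ _ id x0 cvg_id); rewrite divr_gt0.
rewrite distrC -[f x - f x0](subrK (k * (x - x0))).
apply: le_trans (ler_normD _ _) _; apply: le_trans (lerD (hd _ xd) (lexx _)) _.
by rewrite normrM -mulrDl addrC -ler_pdivlMl// mulrC ltW.
Unshelve. all: by end_near. Qed.

Lemma closed_cts1 y0 a b : `[a, b] `<=` D ->
  {within `[a, b], continuous (P^~ y0)}.
Proof.
move=> abD; apply: continuous_in_subspaceT => x /set_mem/abD Dx.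
have [al [be [ga h]]] := closedPQ y0 Dx; apply: (lin_cvg (k := al)) => e /h[d d0 hd].
exists d => // x1 x1d; have [+ _] := hd x1 y0 x1d ltac:(by rewrite subrr normr0).
by rewrite subrr normr0 mulr0 subr0 addr0.
Qed.

Lemma closed_cts2 x0 a b : D x0 -> {within `[a, b], continuous (Q x0)}.
Proof.
move=> Dx; apply: continuous_in_subspaceT => y _.
have [al [be [ga h]]] := closedPQ y Dx; apply: (lin_cvg (k := ga)) => e /h[d d0 hd].
exists d => // y1 y1d; have [_] := hd x0 y1 ltac:(by rewrite subrr normr0) y1d.
by rewrite subrr normr0 mulr0 subr0 add0r.
Qed.

(** The circulation of P dx + Q dy around the rectangle, counterclockwise; opposite sides share one
    integral, so that differences of P and of Q are estimated directly. *)
Local Definition rect_int a b c d : R := segint (fun x => P x c - P x d) a b +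
  segint (fun y => Q b y - Q a y) c d.

Local Lemma cts1B c d a b : `[a, b] `<=` D -> {within `[a, b], continuous (fun x => P x c - P x d)}.
Proof. by move=> abD; move=> x; apply: cvgB; exact: closed_cts1. Qed.

Local Lemma cts2B c d a b : D a -> D b -> {within `[c, d], continuous (fun y => Q b y - Q a y)}.
Proof. by move=> aD bD; move=> x; apply: cvgB; exact: closed_cts2. Qed.

Local Lemma Iver a b c m d : `[a, b] `<=` D -> a <= b -> c <= m -> m <= d ->
  rect_int a b c d = rect_int a b c m + rect_int a b m d.
Proof.
move=> abD ab cm md; rewrite /rect_int.
have Da : D a by apply: abD => /=; rewrite in_itv/= lexx.
have Db : D b by apply: abD => /=; rewrite in_itv/= lexx ab.
rewrite (segint_split cm md); last exact: cts2B.
have E u v : segint (fun x => P x u - P x v) a b = segint (P^~ u) a b - segint (P^~ v) a b.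
  by rewrite segintB//; exact: closed_cts1.
by rewrite !E; ring.
Qed.

Local Lemma Ihor a b c m d : `[a, b] `<=` D -> a <= m -> m <= b -> c <= d ->
  rect_int a b c d = rect_int a m c d + rect_int m b c d.
Proof.
move=> abD am mb cd; rewrite /rect_int.
have ab := le_trans am mb.
have Da : D a by apply: abD => /=; rewrite in_itv/= lexx.
have Dm : D m by apply: abD => /=; rewrite in_itv/= am.
have Db : D b by apply: abD => /=; rewrite in_itv/= lexx ab.
rewrite (segint_split am mb); last exact: cts1B.
have E u v : D u -> D v ->
    segint (fun y => Q u y - Q v y) c d = segint (Q u) c d - segint (Q v) c d.
  by move=> *; rewrite segintB//; exact: closed_cts2.
by rewrite !E//; ring.
Qed.

Local Definition rect := (R * R * (R * R))%type.
Local Definition quarter (r r' : rect) : Prop :=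
  [/\ r.1.1 <= r'.1.1, r'.1.2 <= r.1.2, r.2.1 <= r'.2.1 & r'.2.2 <= r.2.2] /\
  [/\ r'.1.2 - r'.1.1 = (r.1.2 - r.1.1) / 2, r'.2.2 - r'.2.1 = (r.2.2 - r.2.1) / 2 &
  `|rect_int r.1.1 r.1.2 r.2.1 r.2.2| <= 4 * `|rect_int r'.1.1 r'.1.2 r'.2.1 r'.2.2| ].

Local Lemma subsegment (a b c d : R) : a <= c -> d <= b -> `[c, d] `<=` `[a, b].
Proof.
by move=> ac db x /=; rewrite !in_itv/= => /andP[cx xd]; rewrite (le_trans ac)//= (le_trans _ db).
Qed.

(** The circulation is the sum of those of the four quarters, so one of them has at least a quarter
    of it. The hypotheses stand under the existential so that [choice] returns a total function,
    which can be iterated. *)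
Local Lemma quarter_ex r : exists r', `[r.1.1, r.1.2] `<=` D -> r.1.1 <= r.1.2 ->
  r.2.1 <= r.2.2 -> quarter r r'.
Proof.
move: r => [[a b] [c d]]/=.
have [abD|] := pselect (`[a, b] `<=` D); last by exists ((0,0),(0,0)).
have [ab|] := pselect (a <= b); last by exists ((0,0),(0,0)).
have [cd|] := pselect (c <= d); last by exists ((0,0),(0,0)).
pose m := (a + b) / 2; pose n := (c + d) / 2.
have am : a <= m by rewrite /m; lra.
have mb : m <= b by rewrite /m; lra.
have cn : c <= n by rewrite /n; lra.
have nd : n <= d by rewrite /n; lra.
have amD : `[a, m] `<=` D.
  by apply: subset_trans abD; exact: subsegment.
have mbD : `[m, b] `<=` D.
  by apply: subset_trans abD; exact: subsegment.
have E : rect_int a b c d = rect_int a m c n + rect_int a m n d + rect_int m b c n + rect_int m b n d.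
  by rewrite (Ihor abD am mb cd) (Iver amD am cn nd) (Iver mbD mb cn nd) addrA.
have B : `|rect_int a b c d| <= `|rect_int a m c n| + `|rect_int a m n d| + `|rect_int m b c n| + `|rect_int m b n d|.
  rewrite E; apply: le_trans (ler_normD _ _) _; rewrite lerD2r.
  by apply: le_trans (ler_normD _ _) _; rewrite lerD2r; exact: ler_normD.
have [h|h1] := leP `|rect_int a b c d| (4 * `|rect_int a m c n|).
  by exists ((a, m), (c, n)) => *; split; split => //=; rewrite /m/n; clear -closedPQ ab cd; lra.
have [h|h2] := leP `|rect_int a b c d| (4 * `|rect_int a m n d|).
  by exists ((a, m), (n, d)) => *; split; split => //=; rewrite /m/n; clear -closedPQ ab cd; lra.
have [h|h3] := leP `|rect_int a b c d| (4 * `|rect_int m b c n|).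
  by exists ((m, b), (c, n)) => *; split; split => //=; rewrite /m/n; clear -closedPQ ab cd; lra.
exists ((m, b), (n, d)) => *; split; split => //=; first [by rewrite /m/n; clear -closedPQ ab cd; lra|clear -closedPQ B h1 h2 h3; lra].
Qed.

(** Bisection: n steps lose at most a factor 4^n of the circulation and shrink the semiperimeter to
    S / 2^n. Near the common point of the nested rectangles the linear part of the form has no
    circulation, and the remainder is at most a small multiple of the squared semiperimeter, which
    compensates the factor 4^n. *)
Lemma goursat a b c d : `[a, b] `<=` D -> a <= b -> c <= d -> rect_int a b c d = 0.
Proof.
move=> abD ab cd.
have [next hn] := choice quarter_ex.
pose r n := iter n next ((a, b), (c, d)).
pose S := (b - a) + (d - c).
have inv n : [/\ (r n).1.1 <= (r n).1.2, (r n).2.1 <= (r n).2.2,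
    a <= (r n).1.1, (r n).1.2 <= b & [/\ c <= (r n).2.1, (r n).2.2 <= d,
    (r n).1.2 - (r n).1.1 = (b - a) / 2 ^+ n,
    (r n).2.2 - (r n).2.1 = (d - c) / 2 ^+ n & `|rect_int a b c d| <=
      4 ^+ n * `|rect_int (r n).1.1 (r n).1.2 (r n).2.1 (r n).2.2| ]].
  elim: n => [|n [h1 h2 h3 h4 [h5 h6 h7 h8 h9]]].
    by rewrite /= !expr0 !divr1 mul1r; split => //; split.
  have sD : `[(r n).1.1, (r n).1.2] `<=` D.
    by apply: subset_trans abD; exact: subsegment.
  have [[q1 q2 q3 q4] [q5 q6 q7]] := hn (r n) sD h1 h2.
  rewrite -[next _]/(r n.+1) in q1 q2 q3 q4 q5 q6 q7.
  have e1 : (r n.+1).1.2 - (r n.+1).1.1 = (b - a) / 2 ^+ n.+1.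
    by rewrite q5 h7 exprS invfM; ring.
  have e2 : (r n.+1).2.2 - (r n.+1).2.1 = (d - c) / 2 ^+ n.+1.
    by rewrite q6 h8 exprS invfM; ring.
  have p : 0 < (2 ^+ n.+1)^-1 :> R by rewrite invr_gt0 exprn_gt0.
  have w1 : (r n.+1).1.1 <= (r n.+1).1.2.
    by rewrite -subr_ge0 e1 mulr_ge0 ?subr_ge0// ltW.
  have w2 : (r n.+1).2.1 <= (r n.+1).2.2.
    by rewrite -subr_ge0 e2 mulr_ge0 ?subr_ge0// ltW.
  have w3 : `|rect_int a b c d| <= 4 ^+ n.+1 *
      `|rect_int (r n.+1).1.1 (r n.+1).1.2 (r n.+1).2.1 (r n.+1).2.2|.
    by apply: le_trans h9 _; rewrite exprS [4 * _]mulrC -mulrA ler_wpM2l// exprn_ge0.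
  by split=> //; [exact: le_trans q1|exact: le_trans h4|split=> //;
    [exact: le_trans q3|exact: le_trans h6]].
have mono (i j : nat) : (i <= j)%N -> (r i).1.1 <= (r j).1.1 /\ (r j).1.2 <= (r i).1.2 /\
    (r i).2.1 <= (r j).2.1 /\ (r j).2.2 <= (r i).2.2.
  elim: j => [|j IH]; first by rewrite leqn0 => /eqP ->.
  rewrite leq_eqVlt => /predU1P[->//|]; rewrite ltnS => /IH[i1 [i2 [i3 i4]]].
  have [h1 h2 h3 h4 [h5 h6 h7 h8 h9]] := inv j.
  have sD : `[(r j).1.1, (r j).1.2] `<=` D.
    by apply: subset_trans abD; exact: subsegment.
  have [[q1 q2 q3 q4] _] := hn (r j) sD h1 h2.
  rewrite -[next _]/(r j.+1) in q1 q2 q3 q4.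
  by split; [exact: le_trans q1|split; [exact: le_trans i2|split; [exact: le_trans q3|exact: le_trans i4]]].
have nest (u v : nat -> R) : (forall i j, (i <= j)%N -> u i <= u j /\ v j <= v i) ->
    (forall i, u i <= v i) -> exists x, forall n, u n <= x <= v n.
  move=> uv ule; exists (sup (range u)) => n.
  have ub m : ubound (range u) (v m).
    move=> _ [k _ <-]; have [km|mk] := leqP k m.
      by apply: le_trans (ule m); have [] := uv _ _ km.
    by apply: le_trans (ule k) _; have [] := uv _ _ (ltnW mk).
  apply/andP; split; first by apply: ub_le_sup; [exists (v n); exact: ub|exists n].
  by apply: ge_sup; [exists (u 0); exists 0|exact: ub].
have [x0 hx0] : exists x, forall n, (r n).1.1 <= x <= (r n).1.2.
  by apply: nest => [i j /mono[? []]|n]; [|have [] := inv n].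
have [y0 hy0] : exists x, forall n, (r n).2.1 <= x <= (r n).2.2.
  by apply: nest => [i j /mono[? [? []]]|n]; [|have [] := inv n].
have Dx0 : D x0 by apply: abD; exact: (hx0 0).
have S0 : 0 <= S by rewrite /S; lra.
have [al [be [ga hcl]]] := closedPQ y0 Dx0.
apply/eqP; rewrite -normr_le0; apply/ler_addgt0Pl => e e0; rewrite addr0.
(* The final bound is [2 * e' * S * S]; K exceeds [2 * (S * S)] and is positive even if S = 0. *)
pose K := 4 * (S * S) + 1.
have K0 : 0 < K by rewrite /K ltr_wpDl// mulr_ge0// mulr_ge0.
pose e' := e / K.
have e'0 : 0 < e' by rewrite divr_gt0.
have [de de0 hde] := hcl _ e'0.
have [n Hn] : exists n, S / 2 ^+ n < de.
  have /cvgrPdist_lt/(_ _ de0)[n _ hn'] : (fun n => S * (2^-1) ^+ n) @ \oo --> (0 : R).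
    rewrite -[X in _ --> X](mulr0 S); apply: cvgMl_tmp; apply: cvg_expr.
    by rewrite ger0_norm ?invr_ge0// invf_lt1// ltr1n.
  exists n; have := hn' n (leqnn _); rewrite sub0r normrN exprVn; exact: le_lt_trans (ler_norm _).
have [h1 h2 h3 h4 [h5 h6 h7 h8 h9]] := inv n.
set a1 := (r n).1.1 in h1 h3 h7 h9 *; set b1 := (r n).1.2 in h1 h4 h7 h9 *.
set c1 := (r n).2.1 in h2 h5 h8 h9 *; set d1 := (r n).2.2 in h2 h6 h8 h9 *.
have /andP[xa xb] := hx0 n; have /andP[yc yd] := hy0 n.
rewrite -/a1 -/b1 -/c1 -/d1 in xa xb yc yd.
pose s := S / 2 ^+ n.
have sE : s = (b1 - a1) + (d1 - c1) by rewrite h7 h8 /s /S mulrDl.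
have near x y : a1 <= x <= b1 -> c1 <= y <= d1 -> 
   `|x - x0| < de /\ `|y - y0| < de /\ `|x - x0| + `|y - y0| <= s.
  move=> /andP[xa1 xb1] /andP[yc1 yd1].
  have H1 : `|x - x0| <= b1 - a1 by rewrite ler_norml; apply/andP; clear -closedPQ xa1 xb1 xa xb; split; lra.
  have H2 : `|y - y0| <= d1 - c1 by rewrite ler_norml; apply/andP; clear -closedPQ yc1 yd1 yc yd; split; lra.
  rewrite -/s sE in Hn *; move: (normr_ge0 (x - x0)) (normr_ge0 (y - y0)) H1 H2 Hn.
  by clear -closedPQ; split; [|split]; lra.
have sD : `[a1, b1] `<=` D.
  by apply: subset_trans abD; exact: subsegment.
have Da : D a1 by apply: sD => /=; rewrite in_itv/= lexx.
have Db : D b1 by apply: sD => /=; rewrite in_itv/= lexx h1.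
have est x y : a1 <= x <= b1 -> c1 <= y <= d1 ->
    `|P x y - P x0 y0 - al * (x - x0) - be * (y - y0)| <= e' * s /\
    `|Q x y - Q x0 y0 - be * (x - x0) - ga * (y - y0)| <= e' * s.
  move=> /near /[apply] -[n1 [n2 n3]]; have [E1 E2] := hde _ _ n1 n2.
  by split; [apply: le_trans E1 _|apply: le_trans E2 _]; rewrite ler_pM2l.
have cc : c1 <= c1 <= d1 by rewrite lexx.
have dd : c1 <= d1 <= d1 by rewrite lexx andbT.
have aa : a1 <= a1 <= b1 by rewrite lexx.
have bb : a1 <= b1 <= b1 by rewrite lexx andbT.
have B1 : `|segint (fun x => P x c1 - P x d1) a1 b1 - (be * (c1 - d1)) * (b1 - a1)|
    <= (e' * s + e' * s) * (b1 - a1).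
  apply: segint_near => //; first exact: cts1B.
  move=> x hx; have [E1 _] := est _ _ hx cc; have [E2 _] := est _ _ hx dd.
  move: E1 E2; rewrite !ler_norml; clear -closedPQ => /andP[? ?] /andP[? ?]; apply/andP; split; lra.
have B2 : `|segint (fun y => Q b1 y - Q a1 y) c1 d1 - (be * (b1 - a1)) * (d1 - c1)|
    <= (e' * s + e' * s) * (d1 - c1).
  apply: segint_near => //; first exact: cts2B.
  move=> y hy; have [_ E1] := est _ _ bb hy; have [_ E2] := est _ _ aa hy.
  move: E1 E2; rewrite !ler_norml; clear -closedPQ => /andP[? ?] /andP[? ?]; apply/andP; split; lra.
(* The linear terms [be * (c1 - d1) * (b1 - a1)] and [be * (b1 - a1) * (d1 - c1)] cancel: this is
   where closedness acts. *)
have B : `|rect_int a1 b1 c1 d1| <= 2 * e' * s * s.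
  rewrite [X in _ * X]sE; move: B1 B2; rewrite /rect_int !ler_norml; clear -closedPQ => /andP[? ?] /andP[? ?].
  by apply/andP; split; lra.
apply: le_trans h9 _; apply: (@le_trans _ _ (4 ^+ n * (2 * e' * s * s))).
  by rewrite ler_wpM2l// exprn_ge0.
have -> : 4 ^+ n * (2 * e' * s * s) = 2 * e' * S * S.
  rewrite /s (_ : (4 : R) = 2 * 2); last by ring.
  rewrite exprMn; field; by rewrite expf_neq0.
apply: (@le_trans _ _ (e' * K)); last by rewrite /e' mulfVK// gt_eqF.
rewrite [X in X <= _](_ : _ = e' * (2 * (S * S))); last by ring.
rewrite ler_pM2l// /K; move: (mulr_ge0 S0 S0); clear -closedPQ; move: (S * S) => T; lra.
Qed.

(** Periodicity in y cancels the two horizontal sides, and only the vertical ones are left. *)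
Lemma goursat_periodic a b c d : `[a, b] `<=` D -> a <= b -> c <= d ->
  (forall x, D x -> P x c = P x d) -> segint (Q a) c d = segint (Q b) c d.
Proof.
move=> abD ab cd per.
have Da : D a by apply: abD => /=; rewrite in_itv/= lexx.
have Db : D b by apply: abD => /=; rewrite in_itv/= lexx ab.
have := goursat abD ab cd; rewrite /rect_int.
rewrite (segintB (f := P^~ c)); [|exact: closed_cts1..].
rewrite (segintB (f := Q b)); [|exact: closed_cts2..].
have -> : segint (P^~ c) a b = segint (P^~ d) a b.
  by apply: eq_Rintegral => x /set_mem/abD; exact: per.
lra.
Qed.

End goursat.

(** * The real-valued modulus and complex derivatives *)

Section complex_modulus.
Context (R : realType).
Local Notation C := R[i].
Local Notation cabs := (@ComplexField.Normc.normc R).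
Implicit Types (x y z w : C) (a b : R).

Lemma cnormE z : `|z| = (cabs z)%:C. Proof. by []. Qed.

Lemma cabs_ge0 z : 0 <= cabs z.
Proof. by case: z => a b; exact: sqrtr_ge0. Qed.

Lemma cabsM x y : cabs (x * y) = cabs x * cabs y.
Proof. exact: ComplexField.Normc.normcM. Qed.

Lemma cabsD x y : cabs (x + y) <= cabs x + cabs y.
Proof. exact: le_normcD. Qed.

Lemma cabsN x : cabs (- x) = cabs x.
Proof. exact: normcN. Qed.

Lemma cabsBC x y : cabs (x - y) = cabs (y - x).
Proof. by rewrite -cabsN opprB. Qed.

Lemma cabsB x y : cabs (x - y) <= cabs x + cabs y.
Proof. by rewrite -(cabsN y) cabsD. Qed.

Lemma cabs_dist x y z : cabs (x - y) <= cabs (x - z) + cabs (z - y).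
Proof. by apply: le_trans (cabsD _ _); rewrite addrA subrK. Qed.

Lemma cabs0 : cabs 0 = 0. Proof. exact: ComplexField.Normc.normc0. Qed.
Lemma cabs1 : cabs 1 = 1. Proof. exact: ComplexField.Normc.normc1. Qed.

Lemma cabs_eq0 z : (cabs z == 0) = (z == 0).
Proof.
by apply/eqP/eqP => [/ComplexField.Normc.eq0_normc//|->]; rewrite cabs0.
Qed.

Lemma cabs_gt0 z : (0 < cabs z) = (z != 0).
Proof. by rewrite lt_def cabs_ge0 andbT cabs_eq0. Qed.

Lemma cabsX z n : cabs (z ^+ n) = cabs z ^+ n.
Proof. by elim: n => [|n IH]; rewrite ?expr0 ?cabs1// !exprS cabsM IH. Qed.

Lemma cabsV z : cabs z^-1 = (cabs z)^-1.
Proof.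
have [->|z0] := eqVneq z 0; first by rewrite invr0 cabs0 invr0.
have c0 : cabs z != 0 by rewrite cabs_eq0.
by apply: (mulIf c0); rewrite -cabsM mulVf// cabs1 mulVf.
Qed.

Lemma cabsJ z : cabs z^*%C = cabs z.
Proof. by case: z => a b /=; rewrite sqrrN. Qed.

Lemma cabsR a : cabs a%:C = `|a|.
Proof. by rewrite /= expr0n addr0 sqrtr_sqr. Qed.

Lemma cabs_sqr z : cabs z ^+ 2 = complex.Re z ^+ 2 + complex.Im z ^+ 2.
Proof. by case: z => a b /=; rewrite sqr_sqrtr// addr_ge0 ?sqr_ge0. Qed.

Lemma mulcJ z : z^*%C * z = (cabs z ^+ 2)%:C.
Proof. by rewrite cabs_sqr mulrC; case: z => a b; simpc; rewrite !expr2; congr (_ +i* _); ring. Qed.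

Lemma Re_le_cabs z : `|complex.Re z| <= cabs z.
Proof.
rewrite -(ler_pXn2r (_ : 0 < 2)%N)// ?nnegrE ?cabs_ge0//.
by rewrite cabs_sqr real_normK ?num_real// lerDl sqr_ge0.
Qed.

Lemma Im_le_cabs z : `|complex.Im z| <= cabs z.
Proof.
rewrite -(ler_pXn2r (_ : 0 < 2)%N)// ?nnegrE ?cabs_ge0//.
by rewrite cabs_sqr real_normK ?num_real// lerDr sqr_ge0.
Qed.

Lemma cabs_le_ReIm z : cabs z <= `|complex.Re z| + `|complex.Im z|.
Proof.
rewrite -(ler_pXn2r (_ : 0 < 2)%N)// ?nnegrE ?cabs_ge0 ?addr_ge0//.
rewrite cabs_sqr sqrrD !real_normK ?num_real// addrAC lerDl.
by rewrite mulrn_wge0// mulr_ge0.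
Qed.

Lemma cabs_sum (I : Type) (r : seq I) (P : pred I) (F : I -> C) :
  cabs (\sum_(i <- r | P i) F i) <= \sum_(i <- r | P i) cabs (F i).
Proof.
elim/big_ind2 : _ => [|x1 a1 x2 a2 h1 h2|//]; first by rewrite cabs0.
by apply: le_trans (cabsD _ _) _; exact: lerD.
Qed.

Lemma scC x y : x *: y = x * y. Proof. by []. Qed.

Lemma gt0_complex (e : C) : 0 < e -> exists2 a : R, 0 < a & e = a%:C.
Proof.
case: e => a b; rewrite ltcE/= => /andP[/eqP -> a0]; exists a => //.
Qed.

(** The derivative without a quotient: the point w = z needs no exclusion, and the rules for
    products and compositions become estimates of moduli. *)
Definition cder (f : C -> C) z d := forall e : R, 0 < e ->
  exists2 r : R, 0 < r & forall w, cabs (w - z) < r ->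
    cabs (f w - f z - d * (w - z)) <= e * cabs (w - z).

Lemma derivable_cder f z : derivable f z 1 <-> exists d, cder f z d.
Proof.
split.
  pose D := lim (h^-1 *: (f (h *: (1 : C) + z) - f z) @[h --> 0^']).
  move=> df; exists D => e e0.
  move/cvgrPdist_le : df => /(_ e%:C ltac:(by rewrite ltcR)).
  move=> /nbhs_ballP[_/posnumP[r0] /= H].
  have [r rp rE] := gt0_complex (gt0 r0); exists r => // w wr.
  have [->|wz] := eqVneq w z; first by rewrite !subrr mulr0 subr0 cabs0 mulr0.
  have wz0 : w - z != 0 by rewrite subr_eq0.
  have := H (w - z); rewrite -ball_normE/= sub0r normrN rE => /(_ ltac:(by rewrite cnormE ltcR)) /(_ wz0).
  rewrite cnormE lecR [_ *: 1]scC mulr1 subrK -/D.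
  rewrite -(ler_pM2r (_ : 0 < cabs (w - z))) ?cabs_gt0// -cabsM mulrBl.
  rewrite [X in cabs X](_ : _ = - (f w - f z - D * (w - z))) ?cabsN//.
  by rewrite scC [_^-1 * _ * _]mulrAC mulVf ?mul1r ?opprB.
move=> [d hd]; apply/cvg_ex; exists d; apply/cvgrPdist_le => e0 /gt0_complex[e ep ->].
have [r rp hr] := hd _ ep.
apply/nbhs_ballP; exists r%:C => /=; first by rewrite ltcR.
move=> h; rewrite -ball_normE/= sub0r normrN cnormE ltcR => hr1 h0.
have := hr (h + z); rewrite addrK => /(_ hr1) H.
rewrite cnormE lecR [_ *: 1]scC mulr1 -(ler_pM2r (_ : 0 < cabs h)) ?cabs_gt0//.
rewrite -cabsM mulrBl.
rewrite [X in cabs X](_ : _ = - (f (h + z) - f z - d * h)) ?cabsN//.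
by rewrite scC [_^-1 * _ * _]mulrAC mulVf ?mul1r ?opprB.
Qed.

Implicit Types (f g : C -> C).

Lemma cder_lip f z d : cder f z d -> exists2 r : R, 0 < r &
  forall w, cabs (w - z) < r -> cabs (f w - f z) <= (cabs d + 1) * cabs (w - z).
Proof.
move=> /(_ _ ltr01)[r r0 hr]; exists r => // w /hr h.
rewrite -(subrK (d * (w - z)) (f w - f z)); apply: le_trans (cabsD _ _) _.
by rewrite cabsM addrC mulrDl lerD2l.
Qed.

Lemma cder_cst c z : cder (fun=> c) z 0.
Proof.
move=> e e0; exists 1 => // w _.
by rewrite mul0r subr0 subrr cabs0 mulr_ge0 ?cabs_ge0// ltW.
Qed.

Lemma cder_lin c k z : cder (fun w => c * w + k) z c.
Proof.
move=> e e0; exists 1 => // w _.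
rewrite (_ : _ - _ = 0) ?cabs0 ?mulr_ge0 ?cabs_ge0 ?(ltW e0)//; ring.
Qed.

Lemma cderD f g z d d' : cder f z d -> cder g z d' -> cder (fun w => f w + g w) z (d + d').
Proof.
move=> hf hg e e0; have e20 : 0 < e / 2 by rewrite divr_gt0.
have [r1 r10 h1] := hf _ e20; have [r2 r20 h2] := hg _ e20.
exists (Num.min r1 r2); first by rewrite lt_min r10.
move=> w; rewrite lt_min => /andP[/h1 H1 /h2 H2].
rewrite (_ : _ - _ = (f w - f z - d * (w - z)) + (g w - g z - d' * (w - z))); last by ring.
by apply: le_trans (cabsD _ _) _; move: H1 H2; lra.
Qed.

Lemma cderM f g z d d' : cder f z d -> cder g z d' ->
  cder (fun w => f w * g w) z (d * g z + f z * d').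
Proof.
move=> hf hg e e0.
pose A := cabs (g z) + cabs (f z) + 1.
pose B := (cabs d + 1) * (cabs d' + 1).
have A0 : 0 < A by rewrite /A ltr_wpDl// addr_ge0 ?cabs_ge0.
have B0 : 0 < B by rewrite /B mulr_gt0// ltr_wpDl// cabs_ge0.
have e1 : 0 < e / (2 * A) by rewrite divr_gt0// mulr_gt0.
have e2 : 0 < e / (2 * B) by rewrite divr_gt0// mulr_gt0.
have [r1 r10 h1] := hf _ e1; have [r2 r20 h2] := hg _ e1.
have [r3 r30 h3] := cder_lip hf; have [r4 r40 h4] := cder_lip hg.
exists (Num.min (Num.min r1 r2) (Num.min (Num.min r3 r4) (e / (2 * B)))).
  by rewrite !lt_min r10 r20 r30 r40.
move=> w; rewrite !lt_min => /andP[/andP[/h1 H1 /h2 H2] /andP[/andP[/h3 H3 /h4 H4] H5]].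
rewrite (_ : _ - _ = (f w - f z - d * (w - z)) * g z + f z * (g w - g z - d' * (w - z)) +
  (f w - f z) * (g w - g z)); last by ring.
have D0 := cabs_ge0 (w - z).
apply: le_trans (cabsD _ _) _; rewrite {1}[e]splitr [X in _ <= X]mulrDl; apply: lerD.
  apply: le_trans (cabsD _ _) _; rewrite !cabsM.
  apply: (@le_trans _ _ (e / (2 * A) * cabs (w - z) * (cabs (g z) + cabs (f z)))).
    rewrite [X in _ <= X]mulrDr; apply: lerD; first by rewrite ler_wpM2r ?cabs_ge0.
    by rewrite mulrC ler_wpM2r ?cabs_ge0.
  rewrite [X in _ <= X](_ : _ = e / (2 * A) * cabs (w - z) * A); last first.
    by field; exact: lt0r_neq0.
  apply: ler_wpM2l; first by apply: mulr_ge0 => //; exact: ltW.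
  by rewrite /A lerDl.
rewrite cabsM; apply: (@le_trans _ _ (B * cabs (w - z) * cabs (w - z))).
  rewrite /B [X in _ <= X](_ : _ = ((cabs d + 1) * cabs (w - z)) * ((cabs d' + 1) * cabs (w - z))); last by ring.
  by apply: ler_pM; rewrite ?cabs_ge0.
apply: ler_wpM2r => //; rewrite [X in _ <= X](_ : _ = B * (e / (2 * B))); last first.
  by field; exact: lt0r_neq0.
by rewrite ler_pM2l// ltW.
Qed.

Lemma cder_comp f g z d d' : cder f z d -> cder g (f z) d' -> cder (g \o f) z (d' * d).
Proof.
move=> hf hg e e0.
pose A := cabs d + 1; pose B := cabs d' + 1.
have A0 : 0 < A by rewrite /A ltr_wpDl// cabs_ge0.
have B0 : 0 < B by rewrite /B ltr_wpDl// cabs_ge0.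
have e1 : 0 < e / (2 * A) by rewrite divr_gt0// mulr_gt0.
have e2 : 0 < e / (2 * B) by rewrite divr_gt0// mulr_gt0.
have [r1 r10 h1] := hf _ e2; have [r2 r20 h2] := hg _ e1.
have [r3 r30 h3] := cder_lip hf; rewrite -/A in h3.
exists (Num.min r1 (Num.min r3 (r2 / A))).
  by rewrite !lt_min r10 r30 divr_gt0.
move=> w; rewrite !lt_min => /andP[/h1 H1 /andP[/h3 H3 H4]].
have := h2 (f w); rewrite ltr_pdivlMr// mulrC in H4.
move=> /(_ (le_lt_trans H3 H4)) H5; rewrite /=.
rewrite (_ : _ - _ = (g (f w) - g (f z) - d' * (f w - f z)) +
   d' * (f w - f z - d * (w - z))); last by ring.
have D0 := cabs_ge0 (w - z).
apply: le_trans (cabsD _ _) _; rewrite {1}[e]splitr [X in _ <= X]mulrDl; apply: lerD.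
  apply: le_trans H5 _.
  rewrite [X in _ <= X](_ : _ = e / (2 * A) * (A * cabs (w - z))); last first.
    by field; exact: lt0r_neq0.
  by rewrite ler_pM2l.
rewrite cabsM; apply: (@le_trans _ _ (B * (e / (2 * B) * cabs (w - z)))).
  by apply: ler_pM; rewrite ?cabs_ge0// /B lerDl.
by rewrite [X in X <= _](_ : _ = e / 2 * cabs (w - z))//; field; exact: lt0r_neq0.
Qed.

Lemma cder_inv z : z != 0 -> cder (fun w => w^-1) z (- z ^- 2).
Proof.
move=> z0 e e0; have cz : 0 < cabs z by rewrite cabs_gt0.
have K0 : 0 < e * cabs z ^+ 3 / 2 by rewrite divr_gt0// mulr_gt0// exprn_gt0.
(* The first bound keeps |w| above |z| / 2; the remainder is exactly (w - z)^2 / (w z^2), whence the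
   second. *)
exists (Num.min (cabs z / 2) (e * cabs z ^+ 3 / 2)).
  by rewrite lt_min K0 divr_gt0.
move=> w; rewrite lt_min => /andP[h1 h2].
have wz : cabs z / 2 <= cabs w.
  have := cabsB w (w - z); rewrite opprB addrC subrK => h; move: h h1; lra.
have w0 : w != 0 by rewrite -cabs_gt0 (lt_le_trans _ wz)// divr_gt0.
rewrite (_ : _ - _ = (w - z) ^+ 2 / (w * z ^+ 2)); last by field; rewrite w0 z0.
rewrite cabsM cabsX cabsV cabsM cabsX expr2 mulrAC.
apply: ler_wpM2r; first exact: cabs_ge0.
rewrite ler_pdivrMr ?mulr_gt0 ?exprn_gt0 ?cabs_gt0//.
apply: le_trans (ltW h2) _.
rewrite [X in X <= _](_ : _ = e * (cabs z / 2 * cabs z ^+ 2)); last by field.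
by rewrite ler_pM2l// ler_pM2r ?exprn_gt0.
Qed.

End complex_modulus.

(** * The complex exponential and its derivative *)

Section exponential.
Context (R : realType).
Local Notation C := R[i].
Local Notation cabs := (@ComplexField.Normc.normc R).
Local Notation Re := complex.Re.
Local Notation Im := complex.Im.
Implicit Types (x y z w : C) (a b t : R).

Lemma derive_at0 (f : R -> R) d : is_derive (0 : R) 1 f d -> forall e : R, 0 < e ->
  exists2 r : R, 0 < r & forall a, `|a| < r -> `|f a - f 0 - d * a| <= e * `|a|.
Proof.
move=> [df dE] e e0.
have /cvgrPdist_le/(_ _ e0) : (h^-1 *: (f (h *: (1 : R) + 0) - f 0) @[h --> 0^']) --> d.
  by rewrite -dE; exact: df.
move=> /nbhs_ballP[r /= r0 H]; exists r => // a ar.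
have [->|a0] := eqVneq a 0; first by rewrite !subrr mulr0 subr0 normr0 mulr0.
have := H a; rewrite -ball_normE/= sub0r normrN => /(_ ar a0).
rewrite /GRing.scale/= mulr1 addr0 -(ler_pM2r (_ : 0 < `|a|)) ?normr_gt0//.
rewrite -normrM mulrBl [a^-1 * _ * _]mulrAC mulVf// mul1r.
by rewrite distrC.
Qed.

Definition cis t : C := cos t +i* sin t.
Definition cexp w : C := (expR (Re w))%:C * cis (Im w).

Lemma cisD a b : cis (a + b) = cis a * cis b.
Proof. by rewrite /cis cosD sinD; simpc; congr (_ +i* _); ring. Qed.

Lemma cis0 : cis 0 = 1. Proof. by rewrite /cis cos0 sin0. Qed.

Lemma cabs_cis t : cabs (cis t) = 1.
Proof. by rewrite /= cos2Dsin2 sqrtr1. Qed.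

Lemma cexpD w z : cexp (w + z) = cexp w * cexp z.
Proof.
rewrite /cexp; case: w z => [a b] [c d]/=.
by rewrite expRD cisD rmorphM/=; ring.
Qed.

Lemma cexp0 : cexp 0 = 1.
Proof. by rewrite /cexp/= expR0 cis0 mulr1. Qed.

Lemma cabs_cexp w : cabs (cexp w) = expR (Re w).
Proof. by rewrite /cexp cabsM cabsR cabs_cis mulr1 ger0_norm// expR_ge0. Qed.

Lemma cder_cexp0 : cder cexp 0 1.
Proof.
move=> e e0; have e8 : 0 < e / 16 by rewrite divr_gt0.
(* The real and imaginary parts of the remainder will cost [3 * e1] and [5 * e1]; the bound 1 keeps
   |a| below 1 and the increments of exp and sin below twice their arguments. *)
have [e1 [e10 e1e e11]] : exists e1, [/\ 0 < e1, e1 <= e / 16 & e1 <= 1].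
  by exists (Num.min (e / 16) 1); split; rewrite ?lt_min ?e8 ?ge_min ?lexx ?orbT//=.
have [r1 r10 h1] := derive_at0 (is_derive_expR 0) e10.
have [r2 r20 h2] := derive_at0 (is_derive_cos 0) e10.
have [r3 r30 h3] := derive_at0 (is_derive_sin 0) e10.
rewrite expR0 in h1; rewrite cos0 sin0 oppr0 in h2; rewrite sin0 cos0 in h3.
exists (Num.min (Num.min r1 r2) (Num.min r3 e1)).
  by rewrite !lt_min r10 r20 r30.
case=> a b; rewrite subr0 !lt_min => /andP[/andP[l1 l2] /andP[l3 l4]].
have la := Re_le_cabs (a +i* b); have lb := Im_le_cabs (a +i* b); rewrite [Re _]/= in la; rewrite [Im _]/= in lb.
have {h1} := h1 _ (le_lt_trans la l1).
have {h2} := h2 _ (le_lt_trans lb l2).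
have {h3} := h3 _ (le_lt_trans lb l3).
rewrite subr0 mul1r mul0r subr0 mul1r => S1 C1 E1.
have a1 := le_trans la (ltW l4).
have a0 := normr_ge0 a; have b0 := normr_ge0 b.
have cb1 : `|cos b| <= 1 by rewrite ler_norml cos_geN1 cos_le1.
have E2 : `|expR a - 1| <= 2 * `|a|.
  rewrite -[expR a - 1](subrK a); apply: le_trans (ler_normD _ _) _.
  apply: le_trans (lerD E1 (lexx _)) _; have := ler_piMl a0 e11; lra.
have S2 : `|sin b| <= 2 * `|b|.
  rewrite -[sin b](subrK b); apply: le_trans (ler_normD _ _) _.
  apply: le_trans (lerD S1 (lexx _)) _; have := ler_piMl b0 e11; lra.
apply: le_trans (cabs_le_ReIm _) _; rewrite cexp0 mul1r /cexp/cis.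
set u := Re _; set v := Im _.
have uE : u = (expR a - 1 - a) * cos b + (1 + a) * (cos b - 1) by rewrite /u/=; ring.
have vE : v = (expR a - 1) * sin b + (sin b - b) by rewrite /v/=; ring.
set c := cabs (a +i* b) in la lb *.
have c0 : 0 <= c := cabs_ge0 _.
have U : `|u| <= 3 * e1 * c.
  rewrite uE; apply: le_trans (ler_normD _ _) _; rewrite !normrM.
  have -> : 3 * e1 * c = e1 * c + 2 * (e1 * c) by ring.
  apply: lerD.
    apply: (@le_trans _ _ (e1 * `|a| * 1)); first by apply: ler_pM.
    by rewrite mulr1 ler_pM2l.
  apply: ler_pM => //; last by apply: le_trans C1 _; rewrite ler_pM2l.
  apply: le_trans (ler_normD _ _) _; rewrite normr1; move: (le_trans a1 e11); lra.
have V : `|v| <= 5 * e1 * c.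
  rewrite vE; apply: le_trans (ler_normD _ _) _; rewrite !normrM.
  have -> : 5 * e1 * c = (2 * e1) * (2 * c) + e1 * c by ring.
  apply: lerD; last by apply: le_trans S1 _; rewrite ler_pM2l.
  apply: ler_pM => //.
    by apply: le_trans E2 _; rewrite ler_pM2l.
  by apply: le_trans S2 _; rewrite ler_pM2l.
have : e1 * c <= e / 16 * c by rewrite ler_wpM2r.
have : 0 <= e * c by rewrite mulr_ge0// ltW.
rewrite mulrAC; move: U V; rewrite -!(mulrA _ e1); move: (e1 * c) (e * c) => p p'; lra.
Qed.

Lemma cder_cexp z : cder cexp z (cexp z).
Proof.
have h d : cder cexp 0 d -> cder (fun w => cexp (w - z)) z d.
  move=> c0; have := @cder_comp R (fun w => 1 * w + - z) cexp z 1 d (cder_lin 1 (- z) z).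
  rewrite mul1r subrr mulr1 => /(_ c0); rewrite /comp.
  by under eq_fun do rewrite mul1r.
have /(cderM (cder_cst (cexp z) z)) := h _ cder_cexp0.
rewrite mul0r add0r mulr1; congr cder; apply/funext => w.
by rewrite -cexpD addrC subrK.
Qed.
End exponential.

(** * Continuous functions on the closed disk: Heine's theorem and boundedness *)

Section disk_continuity.
Context (R : realType).
Local Notation C := R[i].
Local Notation cabs := (@ComplexField.Normc.normc R).
Local Notation Re := complex.Re.
Local Notation Im := complex.Im.
Implicit Types (f g : C -> C) (z w p : C).

Lemma diskE z : disk z = (cabs z <= 1) :> Prop.
Proof. by rewrite /disk/= cnormE lecR. Qed.

Lemma circleE z : circle z <-> cabs z = 1.
Proof. by rewrite /circle/= cnormE; split=> [[]//|->]. Qed.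

Lemma within_cabsP (A : set C) f : {within A, continuous f} <-> forall p, A p ->
  forall e : R, 0 < e -> exists2 d : R, 0 < d &
    forall w, A w -> cabs (w - p) < d -> cabs (f w - f p) <= e.
Proof.
split.
  move=> /subspace_continuousP cf p Ap e e0.
  have /cvgrPdist_le/(_ e%:C ltac:(by rewrite ltcR)) := cf p Ap.
  rewrite /prop_near1/within/= => /nbhs_ballP[_/posnumP[r0] /= H].
  have [r rp rE] := gt0_complex (gt0 r0); exists r => // w Aw wr.
  have := H w; rewrite -ball_normE/= rE -[`|p - w|]/((cabs (p - w))%:C) ltcR cabsBC.
  by move=> /(_ wr Aw); rewrite cnormE lecR cabsBC.
move=> h; apply/subspace_continuousP => p Ap; apply/cvgrPdist_le => e0 /gt0_complex[e ep ->].
have [r rp hr] := h p Ap _ ep.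
apply/nbhs_ballP; exists r%:C => /=; first by rewrite ltcR.
move=> w; rewrite -ball_normE/= cnormE ltcR cabsBC => wr Aw.
by rewrite cnormE lecR cabsBC; exact: hr.
Qed.

Lemma disk_unif f : {within @disk R, continuous f} -> forall e : R, 0 < e ->
  exists2 d : R, 0 < d & forall z w, disk z -> disk w -> cabs (z - w) < d ->
    cabs (f z - f w) <= e.
Proof.
move=> /within_cabsP cf e e0; apply: contrapT => nex.
have bad n : exists zw : C * C, [/\ disk zw.1, disk zw.2, cabs (zw.1 - zw.2) < n.+1%:R^-1
    & e < cabs (f zw.1 - f zw.2)].
  apply: contrapT => nb; apply: nex; exists n.+1%:R^-1; first by rewrite invr_gt0.
  move=> z w Dz Dw zw; rewrite leNgt; apply/negP => fe.
  by apply: nb; exists (z, w).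
have {bad}[zw hzw] := choice bad.
pose u n : R * R := (Re (zw n).1, Im (zw n).1).
have cK : compact (`[-1, 1]%classic `*` `[-1, 1]%classic : set (R * R)).
  by apply: compact_setX; exact: segment_compact.
have uK n : (`[-1, 1]%classic `*` `[-1, 1]%classic : set (R * R)) (u n).
  have [+ _ _ _] := hzw n; rewrite diskE => h.
  by split; rewrite /= in_itv/= -ler_norml (le_trans _ h)// ?Re_le_cabs ?Im_le_cabs.
have [|[a b] [_ cl]] := cK (u @ \oo) _.
  by exists 0%N => // n _; exact: uK.
pose p : C := a +i* b.
have near (d : R) (N : nat) : 0 < d -> exists2 n, (N <= n)%N & cabs ((zw n).1 - p) < d.
  move=> d0; have d20 : 0 < d / 2 by rewrite divr_gt0.
  have nB : nbhs ((a, b) : R * R) (ball a (d / 2) `*` ball b (d / 2)).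
    by exists (ball a (d / 2), ball b (d / 2)) => //; split; exact: nbhsx_ballx.
  have nA : (u @ \oo) (u @` [set n | (N <= n)%N]) by exists N => // n Nn; exists n.
  have [_ [[n Nn <-] []]] := cl _ _ nA nB.
  rewrite -!ball_normE/= => h1 h2; exists n => //.
  apply: le_lt_trans (cabs_le_ReIm _) _; rewrite !raddfB/=.
  by rewrite [`|Re _ - _|]distrC [`|Im _ - _|]distrC; move: h1 h2; lra.
have Dp : disk p.
  rewrite diskE; apply/ler_addgt0Pl => d d0; have [n _ hn] := near d 0%N d0.
  have [+ _ _ _] := hzw n; rewrite diskE => h.
  have := cabsB (zw n).1 ((zw n).1 - p); rewrite opprB addrC subrK.
  by move: h hn; lra.
have [d d0 hd] := cf _ Dp _ (divr_gt0 e0 (ltr0n R 3)).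
have d20 : 0 < d / 2 by rewrite divr_gt0.
have [N hN] : exists N : nat, forall n, (N <= n)%N -> n.+1%:R^-1 < d / 2.
  have [N _ hN] := near_infty_natSinv_lt (PosNum d20).
  by exists N => n Nn; exact: hN.
have [n Nn hn] := near _ N d20.
have [D1 D2 zwn fe] := hzw n.
have d2d : d / 2 < d by rewrite ltr_pdivrMr// ltr_pMr// ltr1n.
have H1 := hd _ D1 (lt_trans hn d2d).
have H2 : cabs (f (zw n).2 - f p) <= e / 3.
  apply: hd => //; apply: le_lt_trans (cabs_dist _ _ (zw n).1) _.
  rewrite cabsBC [X in _ < X]splitr; exact: ltrD (lt_trans zwn (hN _ Nn)) hn.
have := cabs_dist (f (zw n).1) (f (zw n).2) (f p).
by rewrite [cabs (f p - _)]cabsBC; move: fe H1 H2 e0; lra.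
Qed.

(** Walking from 0 to z along the segment in n + 1 steps shorter than the modulus of continuity d, f
    changes by at most 1 at each step. *)
Lemma disk_bounded f : {within @disk R, continuous f} ->
  exists2 M : R, 0 <= M & forall z, disk z -> cabs (f z) <= M.
Proof.
move=> /disk_unif/(_ _ ltr01)[d d0 hd].
have [n hn] : exists n : nat, n.+1%:R^-1 < d.
  by have [N _ hN] := near_infty_natSinv_lt (PosNum d0); exists N; exact: (hN N (leqnn N)).
have D0 : disk (0 : C) by rewrite diskE cabs0.
exists (cabs (f 0) + n.+1%:R) => [|z Dz]; first by rewrite addr_ge0// cabs_ge0.
pose u k : C := (k%:R / n.+1%:R)%:C * z.
have Du k : (k <= n.+1)%N -> disk (u k).
  move=> kn; rewrite diskE cabsM cabsR ger0_norm ?divr_ge0//; rewrite diskE in Dz.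
  by rewrite mulr_ile1 ?divr_ge0 ?cabs_ge0// ler_pdivrMr// mul1r ler_nat.
have H k : (k <= n.+1)%N -> cabs (f (u k)) <= cabs (f 0) + k%:R.
  elim: k => [_|k IH kn]; first by rewrite /u mul0r mul0r addr0.
  have h : cabs (f (u k.+1) - f (u k)) <= 1.
    apply: hd; [exact: Du|exact: Du (ltnW kn)|].
    rewrite -mulrBl -rmorphB -mulrBl/= -natrB// subSnn cabsM cabsR.
    rewrite mul1r ger0_norm ?invr_ge0//; apply: le_lt_trans hn.
    by rewrite ler_piMr ?invr_ge0// -diskE.
  have := cabsD (f (u k.+1) - f (u k)) (f (u k)); rewrite subrK.
  by move: (IH (ltnW kn)) h; rewrite -natr1; lra.
by have := H n.+1 (leqnn _); rewrite /u divff// mul1r.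
Qed.

End disk_continuity.

(** * Fourier coefficients of a holomorphic function on concentric circles *)

Section circle_coefficients.
Context (R : realType).
Local Notation C := R[i].
Local Notation cabs := (@ComplexField.Normc.normc R).
Local Notation Re := complex.Re.
Local Notation Im := complex.Im.
Implicit Types (f : C -> C) (z w p : C) (r s t k : R).

(** The real form Re (h dz) = Re h ds - Im h dt is closed: by the Cauchy-Riemann equations both
    cross derivatives are minus the imaginary part of the derivative of h. *)
Lemma cder_closed (h : C -> C) (D : set R) : (forall s t, D s -> exists d, cder h (s +i* t) d) ->
  forall s0 t0, D s0 -> exists al be ga : R, forall e : R, 0 < e ->
   exists2 d : R, 0 < d & forall s t, `|s - s0| < d -> `|t - t0| < d ->
    `|Re (h (s +i* t)) - Re (h (s0 +i* t0)) - al * (s - s0) - be * (t - t0)| <= e * (`|s - s0| + `|t - t0|) /\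
    `|- Im (h (s +i* t)) - - Im (h (s0 +i* t0)) - be * (s - s0) - ga * (t - t0)| <= e * (`|s - s0| + `|t - t0|).
Proof.
move=> hD s0 t0 /hD-/(_ t0)[[d1 d2] hd]; exists d1, (- d2), (- d1) => e e0.
have [r r0 hr] := hd _ e0.
exists (r / 2); first by rewrite divr_gt0.
move=> s t sr tr.
have st : cabs ((s +i* t) - (s0 +i* t0)) <= `|s - s0| + `|t - t0| by exact: cabs_le_ReIm.
have := hr (s +i* t) (le_lt_trans st _); rewrite [X in _ < X]splitr ltrD// => /(_ isT) H.
have {}H : cabs (h (s +i* t) - h (s0 +i* t0) - (d1 +i* d2) * ((s +i* t) - (s0 +i* t0)))
    <= e * (`|s - s0| + `|t - t0|).
  by apply: le_trans H _; apply: ler_wpM2l => //; exact: ltW.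
split.
  apply: le_trans H; apply: le_trans (Re_le_cabs _).
  by case: (h _) (h _) => [a b] [a' b']/=; rewrite le_eqVlt; apply/orP; left; apply/eqP; congr `|_|; ring.
apply: le_trans H; apply: le_trans (Im_le_cabs _); rewrite -normrN.
by case: (h _) (h _) => [a b] [a' b']/=; rewrite le_eqVlt; apply/orP; left; apply/eqP; congr `|_|; ring.
Qed.

(** Not normalized: the factor 2 pi is divided out when matrix entries are computed. *)
Definition cint (g : R -> C) : C :=
  segint (fun t => Re (g t)) 0 (2 * pi) +i* segint (fun t => Im (g t)) 0 (2 * pi).

Definition cts (g : R -> C) := forall t e, 0 < e -> exists2 d : R, 0 < d &
  forall t', `|t' - t| < d -> cabs (g t' - g t) <= e.

Let ctsRI (g : R -> C) (F : C -> R) a b : (forall x y, `|F x - F y| <= cabs (x - y)) ->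
  cts g -> {within `[a, b], continuous (fun t => F (g t))}.
Proof.
move=> FL cg; apply: continuous_subspaceT => t; apply/cvgrPdist_le => e e0.
have [d d0 hd] := cg t e e0; near=> t'.
apply: le_trans (FL _ _) _; rewrite cabsBC; apply: hd; rewrite distrC.
by near: t'; exact: (@cvgr_dist_lt _ _ _ _ _ id t cvg_id).
Unshelve. all: by end_near. Qed.

Lemma cts_Re (g : R -> C) a b : cts g -> {within `[a, b], continuous (fun t => Re (g t))}.
Proof. by apply: ctsRI => x y; rewrite -raddfB; exact: Re_le_cabs. Qed.

Lemma cts_Im (g : R -> C) a b : cts g -> {within `[a, b], continuous (fun t => Im (g t))}.
Proof. by apply: ctsRI => x y; rewrite -raddfB; exact: Im_le_cabs. Qed.

Let pi2 : 0 <= 2 * pi :> R. Proof. by rewrite mulr_ge0// pi_ge0. Qed.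

(** The constant is twice the length of the period because real and imaginary parts are estimated
    separately. *)
Lemma cint_le (g1 g2 : R -> C) e : cts g1 -> cts g2 ->
  (forall t, cabs (g1 t - g2 t) <= e) -> cabs (cint g1 - cint g2) <= 4 * pi * e.
Proof.
move=> c1 c2 ge; apply: le_trans (cabs_le_ReIm _) _; rewrite /=.
have -> : 4 * pi * e = e * (2 * pi - 0) + e * (2 * pi - 0) by ring.
apply: lerD; rewrite -[- segint _ _ _]opprK.
  rewrite opprK -segintB; [|exact: cts_Re..].
  have := @segint_near R (fun t => Re (g1 t) - Re (g2 t)) 0 e 0 (2 * pi) pi2.
  rewrite mul0r subr0; apply; first by move=> t; apply: cvgB; exact: cts_Re.
  by move=> t _; rewrite subr0 -raddfB (le_trans (Re_le_cabs _)).
rewrite opprK -segintB; [|exact: cts_Im..].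
have := @segint_near R (fun t => Im (g1 t) - Im (g2 t)) 0 e 0 (2 * pi) pi2.
rewrite mul0r subr0; apply; first by move=> t; apply: cvgB; exact: cts_Im.
by move=> t _; rewrite subr0 -raddfB (le_trans (Im_le_cabs _)).
Qed.

Lemma cts_cst c : cts (fun=> c).
Proof. by move=> t e e0; exists 1 => // t' _; rewrite subrr cabs0 ltW. Qed.

Lemma cint0 : cint (fun=> 0) = 0.
Proof. by rewrite /cint !segint_cst// mul0r. Qed.

Lemma cintZ k (g : R -> C) : cts g -> cint (fun t => k%:C * g t) = k%:C * cint g.
Proof.
move=> cg; rewrite /cint; simpc; congr (_ +i* _).
  rewrite /segint -RintegralZl//; last by apply: cts_integrable; exact: cts_Re.
  by apply: eq_Rintegral => t _; case: (g t) => a b /=; ring.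
rewrite /segint -RintegralZl//; last by apply: cts_integrable; exact: cts_Im.
by apply: eq_Rintegral => t _; case: (g t) => a b /=; ring.
Qed.

Lemma cder_cint (h : C -> C) (D : set R) s1 s2 : (forall s t, D s -> exists d, cder h (s +i* t) d) ->
  (forall s, D s -> h (s +i* 0) = h (s +i* (2 * pi))) ->
  `[s1, s2] `<=` D -> s1 <= s2 ->
  cint (fun t => h (s1 +i* t)) = cint (fun t => h (s2 +i* t)).
Proof.
move=> hD per sD s12.
(* Goursat only compares the integrals of - Im h; applied to c h with c = - i and c = - 1 it yields
   the real and the imaginary part. *)
have H c : segint (fun t => - Im (c * h (s1 +i* t))) 0 (2 * pi) =
    segint (fun t => - Im (c * h (s2 +i* t))) 0 (2 * pi).
  have hD' s t : D s -> exists d, cder (fun w => c * h w) (s +i* t) d.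
    move=> /hD-/(_ t)[d hd]; exists (0 * h (s +i* t) + c * d).
    by apply: cderM => //; exact: cder_cst.
  by apply: (goursat_periodic (cder_closed hD') sD s12 pi2) => x Dx /=; rewrite per.
rewrite /cint; congr (_ +i* _).
  have {}H := H (- 'i); transitivity (segint (fun t => - Im (- 'i * h (s1 +i* t))) 0 (2 * pi)).
    by apply: eq_Rintegral => t _; case: (h _) => a b /=; ring.
  by rewrite H; apply: eq_Rintegral => t _; case: (h _) => a b /=; ring.
have {}H := H (- 1); transitivity (segint (fun t => - Im (- 1 * h (s1 +i* t))) 0 (2 * pi)).
  by apply: eq_Rintegral => t _; case: (h _) => a b /=; ring.
by rewrite H; apply: eq_Rintegral => t _; case: (h _) => a b /=; ring.
Qed.

Lemma ctsM (g1 g2 : R -> C) : cts g1 -> cts g2 -> cts (fun t => g1 t * g2 t).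
Proof.
move=> c1 c2 t e e0.
pose A := cabs (g1 t) + cabs (g2 t) + 1.
have A0 : 0 < A by rewrite /A ltr_wpDl// addr_ge0 ?cabs_ge0.
have e1 : 0 < e / (2 * A) by rewrite divr_gt0// mulr_gt0.
have [d1 d10 h1] := c1 t _ e1; have [d2 d20 h2] := c2 t _ e1; have [d3 d30 h3] := c2 t _ ltr01.
exists (Num.min d1 (Num.min d2 d3)); first by rewrite !lt_min d10 d20.
move=> t'; rewrite !lt_min => /andP[/h1 H1 /andP[/h2 H2 /h3 H3]].
rewrite (_ : _ - _ = (g1 t' - g1 t) * g2 t' + g1 t * (g2 t' - g2 t)); last by ring.
apply: le_trans (cabsD _ _) _; rewrite !cabsM.
have B : cabs (g2 t') <= A.
  have := cabsD (g2 t' - g2 t) (g2 t); rewrite subrK => /le_trans; apply.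
  by rewrite /A; have := cabs_ge0 (g1 t); lra.
have B' : cabs (g1 t) <= A by rewrite /A; have := cabs_ge0 (g2 t); lra.
have -> : e = (e / (2 * A)) * A + A * (e / (2 * A)) by field; exact: lt0r_neq0.
by apply: lerD; apply: ler_pM; rewrite ?cabs_ge0.
Qed.

Lemma cexpi t : cexp (0 +i* t) = cis t.
Proof. by rewrite /cexp/= expR0 mul1r. Qed.

Lemma cts_cis k : cts (fun t => cis (k * t)).
Proof.
move=> t e e0.
have := cder_comp (cder_lin k%:C 0 (0 +i* t)) (cder_cexp _).
move=> /cder_lip[r r0 hr]; set K := _ + 1 in hr.
have K0 : 0 < K by rewrite /K ltr_wpDl// cabs_ge0.
exists (Num.min r (e / K)); first by rewrite lt_min r0 divr_gt0.
move=> t'; rewrite lt_min => /andP[h1 h2].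
have E : cabs ((0 +i* t') - (0 +i* t)) = `|t' - t|.
  by rewrite /= subrr expr0n add0r sqrtr_sqr.
have := hr (0 +i* t'); rewrite E => /(_ h1).
have F u : cexp (k%:C * (0 +i* u) + 0) = cis (k * u).
  by rewrite addr0; simpc; rewrite cexpi.
rewrite /comp !F => /le_trans; apply.
by rewrite ltr_pdivlMr// mulrC in h2; exact: ltW.
Qed.

Lemma disk_cis r t : 0 <= r <= 1 -> disk (r%:C * cis t).
Proof. by move=> /andP[r0 r1]; rewrite diskE cabsM cabs_cis mulr1 cabsR ger0_norm. Qed.

(** 2 pi times the Fourier coefficient of index - k on the circle of radius r: Taylor coefficients
    sit at k = - n. The frequency is real so as to serve as an exponent of r. *)
Definition fcoef f r k : C := cint (fun t => f (r%:C * cis t) * cis (k * t)).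

Lemma cts_circle f k r : {within @disk R, continuous f} -> 0 <= r <= 1 ->
  cts (fun t => f (r%:C * cis t) * cis (k * t)).
Proof.
move=> /disk_unif cf r01; apply: ctsM; last exact: cts_cis.
move=> t e /cf[d d0 hd].
have [d' d'0 hd'] := cts_cis 1 t (ltac:(by rewrite divr_gt0) : 0 < d / 2).
exists d' => // t' /hd'; rewrite !mul1r => h.
apply: hd; [exact: disk_cis|exact: disk_cis|].
rewrite -mulrBr cabsM cabsR; case/andP: r01 => r0 r1; rewrite ger0_norm//.
apply: (@le_lt_trans _ _ (d / 2)); last by rewrite ltr_pdivrMr// ltr_pMr// ltr1n.
by apply: le_trans h; rewrite ler_piMl// cabs_ge0.
Qed.

Lemma cis2pi n : cis (n%:R * (2 * pi)) = 1 :> C.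
Proof.
elim: n => [|n IH]; first by rewrite mul0r cis0.
rewrite -natr1 mulrDl cisD IH mul1r /cis.
by rewrite !mul1r mulr_natl cos2pi sin2pi.
Qed.

Lemma cisN t : cis (- t) = (cis t)^*%C.
Proof. by rewrite /cis cosN sinN. Qed.

(* In the coordinate s + i t = log z circles become vertical segments, so that
   Goursat's lemma on rectangles, applied to the 2 pi-periodic function
   f (exp (s + i t)) exp (k (s + i t)), relates the coefficients on all circles. *)
Section holomorphic.
Variable f : C -> C.
Hypothesis cf : {within @disk R, continuous f}.
Hypothesis hf : forall z, cabs z < 1 -> exists d, cder f z d.

Let fcoef_exp k s1 s2 : cis (k * (2 * pi)) = 1 -> s1 <= s2 -> s2 < 0 ->
  (expR (k * s1))%:C * fcoef f (expR s1) k = (expR (k * s2))%:C * fcoef f (expR s2) k.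
Proof.
move=> k2 s12 s20.
pose h w := f (cexp w) * cexp (k%:C * w).
have hE s t : h (s +i* t) = (expR (k * s))%:C * (f ((expR s)%:C * cis t) * cis (k * t)).
  by rewrite /h/cexp/= !mul0r subr0 addr0; ring.
have s0 s : s < 0 -> 0 <= expR s <= 1 by move=> ss; rewrite expR_ge0/= -expR0 ler_expR ltW.
have s10 : s1 < 0 by exact: le_lt_trans s20.
rewrite /fcoef -!cintZ; try by apply: cts_circle => //; exact: s0.
have -> : (fun t => (expR (k * s1))%:C * (f ((expR s1)%:C * cis t) * cis (k * t))) =
   (fun t => h (s1 +i* t)) by apply/funext => t; rewrite hE.
have -> : (fun t => (expR (k * s2))%:C * (f ((expR s2)%:C * cis t) * cis (k * t))) =
   (fun t => h (s2 +i* t)) by apply/funext => t; rewrite hE.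
apply: (@cder_cint h [set s | s < 0]) => // [s t /= ss|s /= ss|s /=].
- have [|d hd] := hf (z := cexp (s +i* t)).
    by rewrite cabs_cexp -expR0 ltr_expR.
  have h1 := cder_comp (cder_cexp (s +i* t)) hd.
  have h2 := cder_comp (cder_lin k%:C 0 (s +i* t)) (cder_cexp _).
  exists (d * cexp (s +i* t) * cexp (k%:C * (s +i* t)) +
     f (cexp (s +i* t)) * (cexp (k%:C * (s +i* t)) * k%:C)).
  have := cderM h1 h2; rewrite /= addr0.
  by congr (cder _ _ _); apply/funext => w; rewrite /h /= addr0.
- by rewrite !hE mulr0 k2 cis0; have := cis2pi 1; rewrite mul1r => ->.
- by rewrite in_itv/= => /andP[_]; move=> /le_lt_trans; apply.
Qed.

Let fcoef_pow k r1 r2 : cis (k * (2 * pi)) = 1 -> 0 < r1 -> r1 <= r2 -> r2 < 1 ->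
  (r1 `^ k)%:C * fcoef f r1 k = (r2 `^ k)%:C * fcoef f r2 k.
Proof.
move=> k2 r10 r12 r21; have r20 := lt_le_trans r10 r12.
have := @fcoef_exp k (ln r1) (ln r2) k2; rewrite !lnK ?posrE//.
by rewrite ler_ln ?posrE// r12 ln_lt0 ?r20// /powR !gt_eqF// => /(_ isT isT).
Qed.

Let fcoef_unif e : 0 < e -> exists2 d : R, 0 < d & forall r k, 0 <= r <= 1 ->
  1 - r < d -> cabs (fcoef f 1 k - fcoef f r k) <= e.
Proof.
move=> e0; have K0 : 0 < 4 * pi :> R by rewrite mulr_gt0// pi_gt0.
have [d d0 hd] := disk_unif cf (divr_gt0 e0 K0); exists d => // r k r01 rd.
have i1 : 0 <= (1 : R) <= 1 by rewrite lexx ler01.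
have -> : e = 4 * pi * (e / (4 * pi)) by rewrite mulrC divfK// gt_eqF.
apply: cint_le; [exact: cts_circle|exact: cts_circle|] => t.
rewrite -mulrBl cabsM cabs_cis mulr1; apply: hd; [exact: disk_cis|exact: disk_cis|].
rewrite -mulrBl cabsM cabs_cis mulr1 -rmorphB cabsR ger0_norm// subr_ge0.
by case/andP: r01.
Qed.

(** The unit circle is charged by the measure but f is differentiable only inside: uniform
    continuity carries the coefficients to radius 1. *)
Let fcoef_lim n k c : (forall r, 0 < r < 1 -> fcoef f r k = (r ^+ n)%:C * c) ->
  fcoef f 1 k = c.
Proof.
move=> H; apply/eqP; rewrite -subr_eq0 -cabs_eq0 eq_le cabs_ge0 andbT.
apply/ler_addgt0Pl => e e0; rewrite addr0.
have e20 : 0 < e / 2 by rewrite divr_gt0.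
have [d d0 hd] := fcoef_unif e20.
have L0 : 0 < n%:R * cabs c + 1 by rewrite ltr_wpDl// mulr_ge0// cabs_ge0.
(* m is the gap 1 - r: 1 / 2 keeps r positive, d / 2 serves [fcoef_unif], and the last term absorbs
   Bernoulli's bound [1 - r ^+ n <= n%:R * m]. *)
pose m := Num.min (Num.min (1 / 2) (d / 2)) (e / 2 / (n%:R * cabs c + 1)).
have m0 : 0 < m by rewrite /m !lt_min !divr_gt0.
have m1 : m <= 1 / 2 by rewrite /m !ge_min lexx.
have m2 : m <= d / 2 by rewrite /m !ge_min lexx orbT.
have m3 : m <= e / 2 / (n%:R * cabs c + 1) by rewrite /m !ge_min lexx orbT.
clearbody m; pose r := 1 - m.
have r0 : 0 < r by rewrite /r; lra.
have r1 : r < 1 by rewrite /r; lra.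
have h1 : cabs (fcoef f 1 k - fcoef f r k) <= e / 2.
  by apply: hd; rewrite ?ltW// /r; lra.
have h2 : cabs (fcoef f r k - c) <= e / 2.
  rewrite H ?r0// -{2}[c]mul1r -mulrBl cabsM -rmorphB cabsR.
  have b : 1 - r ^+ n <= n%:R * m.
    elim: n {H L0 m3} => [|n IH]; first by rewrite expr0 subrr mul0r.
    rewrite exprS -natr1 mulrDl mul1r.
    have : m * r ^+ n <= m by rewrite ler_piMr ?(ltW m0)// exprn_ile1// ltW.
    by rewrite {2}/r; move: IH; lra.
  rewrite distrC ger0_norm; last by rewrite subr_ge0 exprn_ile1// ltW.
  apply: le_trans (ler_wpM2r (cabs_ge0 c) b) _.
  move: m3; rewrite ler_pdivlMr// mulrDr mulr1 => m3.
  by rewrite mulrAC mulrC; move: m3 m0; lra.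
by have := cabs_dist (fcoef f 1 k) c (fcoef f r k); lra.
Qed.

Let r_half : 0 < (1 / 2 : R) < 1. Proof. by apply/andP; split; lra. Qed.

(** The constant is 2 pi times the n-th Taylor coefficient, read off on the reference circle of
    radius 1 / 2. *)
Lemma fcoef_pos n : exists c : C, forall r, 0 < r <= 1 ->
  fcoef f r (- n%:R) = (r ^+ n)%:C * c.
Proof.
have kpi : cis (- n%:R * (2 * pi) : R) = 1 by rewrite mulNr cisN cis2pi conjc1.
have pE r : 0 < r -> r `^ (- n%:R) = r ^- n.
  by move=> r0; rewrite powRN powR_mulrn// ltW.
pose c := (((1 / 2) `^ (- n%:R))%:C * fcoef f (1 / 2) (- n%:R)).
have H r : 0 < r < 1 -> fcoef f r (- n%:R) = (r ^+ n)%:C * c.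
  move=> /andP[r0 r1].
  have E : (r `^ (- n%:R))%:C * fcoef f r (- n%:R) = c.
    have /andP[h0 h1] := r_half; have [rh|/ltW hr] := leP r (1 / 2).
      exact: fcoef_pow.
    by rewrite /c; symmetry; exact: fcoef_pow.
  rewrite -E mulrA pE// -rmorphM/= divff ?mul1r// expf_eq0 gt_eqF ?andbF//.
exists c => r /andP[r0]; rewrite le_eqVlt => /predU1P[->|r1]; last by rewrite H ?r0.
by rewrite expr1n mul1r; exact: fcoef_lim H.
Qed.

(** The product of r^(n+1) with the coefficient does not depend on r, and it tends to 0 with r since
    f is bounded: no negative powers occur. *)
Lemma fcoef_neg n r : 0 < r <= 1 -> fcoef f r n.+1%:R = 0.
Proof.
have kpi : cis (n.+1%:R * (2 * pi) : R) = 1 by rewrite cis2pi.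
have pE r' : 0 < r' -> r' `^ (n.+1%:R) = r' ^+ n.+1 by move=> r0; rewrite powR_mulrn// ltW.
have [M M0 hM] := disk_bounded cf.
have B r' : 0 < r' < 1 -> cabs (fcoef f r' n.+1%:R) <= 4 * pi * M.
  move=> /andP[r0 r1]; have r01 : 0 <= r' <= 1 by rewrite !ltW.
  have := cint_le (cts_circle n.+1%:R cf r01) (cts_cst 0) (e := M).
  rewrite cint0 subr0; apply => t.
  by rewrite subr0 cabsM cabs_cis mulr1; exact/hM/disk_cis.
have H r' : 0 < r' < 1 -> fcoef f r' n.+1%:R = 0.
  move=> /andP[r0 r1]; apply/eqP; rewrite -cabs_eq0 eq_le cabs_ge0 andbT.
  have K0 : 0 <= 4 * pi * M by rewrite !mulr_ge0// pi_ge0.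
  apply/ler_addgt0Pl => e e0; rewrite addr0.
  have p0 : 0 < r' ^+ n.+1 by rewrite exprn_gt0.
  pose m := Num.min r' (e * r' ^+ n.+1 / (4 * pi * M + 1)).
  have m0 : 0 < m by rewrite lt_min r0 divr_gt0// ?mulr_gt0// ltr_wpDl.
  have m1 : m <= r' by rewrite ge_min lexx.
  have m2 : m <= e * r' ^+ n.+1 / (4 * pi * M + 1) by rewrite ge_min lexx orbT.
  clearbody m.
  have := fcoef_pow kpi m0 m1 r1; rewrite !pE// => /(congr1 cabs).
  rewrite !cabsM !cabsR !ger0_norm ?(ltW p0) ?exprn_ge0 ?(ltW m0)// => E.
  rewrite -(ler_pM2l p0) -E.
  have m11 : m < 1 by exact: le_lt_trans r1.
  apply: le_trans (ler_wpM2l (exprn_ge0 _ (ltW m0)) (B m _)) _; first by rewrite m0.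
  rewrite mulrC exprS mulrA; apply: (@le_trans _ _ (4 * pi * M * m)).
    by rewrite ler_piMr ?mulr_ge0 ?pi_ge0 ?(ltW m0)// exprn_ile1// ltW.
  apply: le_trans (ler_wpM2l K0 m2) _; rewrite mulrCA.
  rewrite [r' ^+ n.+1 * e]mulrC ler_piMr ?mulr_ge0 ?(ltW e0) ?(ltW p0)//.
  by rewrite mulrC ler_pdivrMl ?ltr_wpDl// mulr1 lerDl.
move=> /andP[r0]; rewrite le_eqVlt => /predU1P[->|r1]; last by rewrite H ?r0.
by apply: (@fcoef_lim 0) => r' /H ->; rewrite mulr0.
Qed.

End holomorphic.
End circle_coefficients.

(** * Maximum principle for polynomials and their uniform limits *)

Section polynomials_on_disk.
Context (R : realType).
Local Notation C := R[i].
Local Notation cabs := (@ComplexField.Normc.normc R).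
Implicit Types (p q : {poly C}) (z w : C).

(** 'X^n - 1 splits and is separable, and a complete set of n distinct n-th roots of unity contains
    a primitive one. *)
Lemma complex_prim_root n : (0 < n)%N -> exists z : C, n.-primitive_root z.
Proof.
pose p : {poly C} := 'X^n - 1; have [r Dp] := closed_field_poly_normal p.
move=> n0; rewrite (monicP _) ?monicXnsubC// scale1r in Dp.
have rn1 : all n.-unity_root r by apply/allP => z; rewrite -root_prod_XsubC -Dp.
have sz_r : (n < (size r).+1)%N by rewrite -(size_prod_XsubC r id) -Dp size_XnsubC.
have [|z] := hasP (has_prim_root n0 rn1 _ sz_r); last by exists z.
by rewrite -separable_prod_XsubC -Dp separable_Xn_sub_1 // pnatr_eq0 -lt0n.
Qed.

(* The n-th coefficient is an average of p over roots of unity. *)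
Lemma coef_le_circle p M n : (forall w, cabs w = 1 -> cabs p.[w] <= M) -> cabs p`_n <= M.
Proof.
move=> hM.
(* With N above both the degree and n, no two exponents in play agree modulo N, so the average
   isolates one coefficient. *)
pose N := (maxn (size p) n.+1).
have N0 : (0 < N)%N by rewrite /N leq_max orbT.
have [u prim_u] := complex_prim_root N0.
have uN : u ^+ N = 1 := prim_expr_order prim_u.
have u1 : cabs u = 1.
  have : cabs u ^+ N = 1 by rewrite -cabsX uN cabs1.
  by move/eqP; rewrite pexpr_eq1 ?cabs_ge0// => /eqP.
have u0 : u != 0 by rewrite -cabs_gt0 u1.
have E : \sum_(k < N) p.[u ^+ k] * (u ^- n) ^+ k = N%:R * p`_n.
  under eq_bigr => k _.
    rewrite (@horner_coef_wide _ N) ?leq_maxl// mulr_suml.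
    over.
  rewrite exchange_big/=.
  rewrite (bigD1 (Ordinal (leq_maxr (size p) n.+1 : (n < N)%N)))//= [X in _ + X]big1 ?addr0.
    under eq_bigr => k _.
      rewrite -mulrA -exprM mulnC exprM -exprMn divff ?expf_neq0// expr1n mulr1.
      over.
    by rewrite sumr_const card_ord mulr_natl.
  move=> j jn; under eq_bigr => k _.
    rewrite -mulrA -exprM mulnC exprM -exprMn.
    over.
  rewrite -mulr_sumr; set v := u ^+ j / u ^+ n.
  have vN : v ^+ N = 1 by rewrite /v expr_div_n -!exprM ![(_ * N)%N]mulnC !exprM uN !expr1n divr1.
  have v1 : v != 1.
    apply: contra jn => /eqP v1; apply/eqP/val_inj => /=.
    have : u ^+ j = u ^+ n by rewrite -[LHS](divfK (expf_neq0 n u0)) -/v v1 mul1r.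
    move/eqP; rewrite (eq_prim_root_expr prim_u) !modn_small//; first by move/eqP.
    by rewrite leq_max leqnn orbT.
  have := subrX1 v N; rewrite vN subrr => /esym/eqP; rewrite mulf_eq0 subr_eq0 (negPf v1)/= => /eqP ->.
  by rewrite mulr0.
have N0' : (0 : R) < N%:R by rewrite ltr0n.
have cN : cabs (N%:R : C) = N%:R.
  by rewrite -(rmorph_nat (real_complex R)) cabsR ger0_norm// ler0n.
rewrite -(ler_pM2l N0') -cN -cabsM -E cN; apply: le_trans (cabs_sum _ _ _) _.
apply: (@le_trans _ _ (\sum_(k < N) M)).
  apply: ler_sum => k _; rewrite cabsM cabsX cabsV cabsX u1 expr1n invr1 expr1n mulr1.
  by apply: hM; rewrite cabsX u1 expr1n.
by rewrite sumr_const card_ord mulr_natl.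
Qed.

(* The bound on coefficients loses a factor 1 / (1 - |z|); applying it to p ^+ n
   and taking n-th roots removes this factor. *)
Lemma poly_max_circle p M : (forall w, cabs w = 1 -> cabs p.[w] <= M) ->
  forall z, cabs z <= 1 -> cabs p.[z] <= M.
Proof.
move=> hM z; rewrite le_eqVlt => /predU1P[/hM//|z1].
have M0 : 0 <= M by apply: le_trans (hM 1 (cabs1 _)); exact: cabs_ge0.
have z10 : 0 < 1 - cabs z by rewrite subr_gt0.
have crude q B : (forall w, cabs w = 1 -> cabs q.[w] <= B) -> cabs q.[z] <= B / (1 - cabs z).
  move=> hB; have B0 : 0 <= B by apply: le_trans (hB 1 (cabs1 _)); exact: cabs_ge0.
  rewrite horner_coef; apply: le_trans (cabs_sum _ _ _) _.
  apply: (@le_trans _ _ (\sum_(k < size q) B * cabs z ^+ k)).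
    apply: ler_sum => k _; rewrite cabsM cabsX ler_wpM2r ?exprn_ge0 ?cabs_ge0//.
    exact: coef_le_circle.
  rewrite -mulr_sumr ler_wpM2l// -(ler_pM2l z10) divff ?gt_eqF//.
  rewrite -[X in X <= _]opprK -mulNr opprB -subrX1 opprB lerBlDr lerDl.
  by rewrite exprn_ge0// cabs_ge0.
have pw k : cabs p.[z] ^+ k <= M ^+ k / (1 - cabs z).
  rewrite -cabsX -horner_exp; apply: crude => w w1; rewrite horner_exp cabsX.
  by rewrite lerXn2r ?nnegrE ?cabs_ge0//; exact: hM.
rewrite leNgt; apply/negP => Mx.
have [M00|Mp] := eqVneq M 0.
  by move: (pw 1%N); rewrite !expr1 M00 mul0r leNgt -M00 Mx.
have {}Mp : 0 < M by rewrite lt_def Mp.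
pose x := cabs p.[z] / M; have x1 : 0 < x - 1 by rewrite subr_gt0 /x ltr_pdivlMr// mul1r.
(* Bernoulli's inequality: for x > 1 the powers outgrow the fixed bound [(1 - cabs z)^-1]. *)
have bern k : 1 + k%:R * (x - 1) <= x ^+ k.
  elim: k => [|k IH]; first by rewrite mul0r addr0 expr0.
  rewrite exprS -natr1; have h : 0 <= x by move: x1; lra.
  apply: le_trans (ler_wpM2l h IH); rewrite -subr_ge0.
  have -> : x * (1 + k%:R * (x - 1)) - (1 + (k%:R + 1) * (x - 1)) = k%:R * (x - 1) ^+ 2 by ring.
  by rewrite mulr_ge0// sqr_ge0.
have xb k : x ^+ k <= (1 - cabs z)^-1.
  by rewrite /x expr_div_n ler_pdivrMr ?exprn_gt0// mulrC; exact: pw.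
have := Num.Theory.truncnS_gt ((1 - cabs z)^-1 / (x - 1)).
rewrite ltr_pdivrMr// => h; have := le_trans (bern _) (xb (Num.trunc ((1 - cabs z)^-1 / (x - 1))).+1).
by move: h; set u := _ * (x - 1); lra.
Qed.

Lemma cder_horner p z : exists d, cder (horner p) z d.
Proof.
elim/poly_ind: p => [|p c [d IH]].
  exists 0; rewrite (_ : horner 0 = fun=> 0); first exact: cder_cst.
  by apply/funext => w; rewrite horner0.
have := cderD (cderM IH (cder_lin 1 0 z)) (cder_cst c z).
move=> h; eexists; move: h; congr (cder _ _ _).
by apply/funext => w; rewrite hornerMXaddC mul1r addr0.
Qed.

Lemma cder_cts (f : C -> C) z d : cder f z d -> forall e : R, 0 < e ->
  exists2 r : R, 0 < r & forall w, cabs (w - z) < r -> cabs (f w - f z) <= e.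
Proof.
move=> /cder_lip[r r0 hr] e e0; have K0 : 0 < cabs d + 1 by rewrite ltr_wpDl// cabs_ge0.
exists (Num.min r (e / (cabs d + 1))); first by rewrite lt_min r0 divr_gt0.
move=> w; rewrite lt_min => /andP[/hr h1 h2]; apply: le_trans h1 _.
by rewrite ltr_pdivlMr// mulrC in h2; exact: ltW.
Qed.

Definition ulim (A : set C) (f : nat -> C -> C) (F : C -> C) := forall e : R, 0 < e ->
  exists N, forall n, (N <= n)%N -> forall z, A z -> cabs (f n z - F z) <= e.

Lemma ulim_continuous (A : set C) f F : ulim A f F ->
  (forall n, {within A, continuous (f n)}) -> {within A, continuous F}.
Proof.
move=> fF fc; apply/within_cabsP => p Ap e e0.
have e30 : 0 < e / 3 by rewrite divr_gt0.
have [N hN] := fF _ e30.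
have /within_cabsP/(_ p Ap _ e30)[d d0 hd] := fc N.
exists d => // w Aw wp; have h1 := hd w Aw wp.
have h2 := hN N (leqnn _) w Aw; have h3 := hN N (leqnn _) p Ap.
have := cabs_dist (F w) (F p) (f N w).
have := cabs_dist (f N w) (F p) (f N p).
by move: h2; rewrite cabsBC; move: h1 h3; lra.
Qed.

Lemma cauchyR (u : nat -> R) : (forall e : R, 0 < e -> exists N, forall m n,
  (N <= m)%N -> (N <= n)%N -> `|u m - u n| <= e) ->
  exists l, forall e : R, 0 < e -> exists N, forall n, (N <= n)%N -> `|u n - l| <= e.
Proof.
move=> cu; have /cvg_ex[l hl] : cvg (u @ \oo).
  apply/cauchy_cvgP/cauchy_exP => e e0.
  have e20 : 0 < e / 2 by rewrite divr_gt0.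
  have [N hN] := cu _ e20; exists (u N); exists N => // n /= Nn.
  rewrite -ball_normE/=; apply: le_lt_trans (hN _ _ (leqnn N) Nn) _.
  by rewrite ltr_pdivrMr// ltr_pMr// ltr1n.
exists l => e e0; move/cvgrPdist_le : hl => /(_ _ e0)[N _ hN].
by exists N => n /hN; rewrite distrC.
Qed.

Lemma cauchyC (u : nat -> C) : (forall e : R, 0 < e -> exists N, forall m n,
  (N <= m)%N -> (N <= n)%N -> cabs (u m - u n) <= e) ->
  exists l, forall e : R, 0 < e -> exists N, forall n, (N <= n)%N -> cabs (u n - l) <= e.
Proof.
move=> cu.
have [|a ha] := @cauchyR (fun n => complex.Re (u n)).
  move=> e /cu[N hN]; exists N => m n Nm Nn /=; rewrite -raddfB.
  exact: le_trans (Re_le_cabs _) (hN _ _ Nm Nn).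
have [|b hb] := @cauchyR (fun n => complex.Im (u n)).
  move=> e /cu[N hN]; exists N => m n Nm Nn /=; rewrite -raddfB.
  exact: le_trans (Im_le_cabs _) (hN _ _ Nm Nn).
exists (a +i* b) => e e0; have e20 : 0 < e / 2 by rewrite divr_gt0.
have [N1 h1] := ha _ e20; have [N2 h2] := hb _ e20; exists (maxn N1 N2) => n.
rewrite geq_max => /andP[/h1 H1 /h2 H2]; apply: le_trans (cabs_le_ReIm _) _.
by rewrite [e]splitr !raddfB/=; exact: lerD.
Qed.

Definition ucauchy (A : set C) (f : nat -> C -> C) := forall e : R, 0 < e ->
  exists N, forall m n, (N <= m)%N -> (N <= n)%N ->
  forall z, A z -> cabs (f m z - f n z) <= e.

Lemma ucauchy_ulim (A : set C) f : ucauchy A f -> exists F, ulim A f F.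
Proof.
move=> cf.
have H z : exists l, A z -> forall e : R, 0 < e -> exists N, forall n, (N <= n)%N ->
    cabs (f n z - l) <= e.
  have [Az|nAz] := pselect (A z); last by exists 0.
  have [|l hl] := @cauchyC (f ^~ z); last by exists l.
  by move=> e /cf[N hN]; exists N => m n Nm Nn; exact: hN.
have [F hF] := choice H; exists F => e e0.
have e20 : 0 < e / 2 by rewrite divr_gt0.
have [N hN] := cf _ e20; exists N => n Nn z Az.
have [M hM] := hF z Az _ e20.
apply: le_trans (cabs_dist _ _ (f (maxn N M) z)) _; rewrite [e]splitr; apply: lerD.
  by apply: hN => //; rewrite leq_maxl.
by apply: hM; rewrite leq_maxr.
Qed.

Lemma ulim_ucauchy (A : set C) f F : ulim A f F -> ucauchy A f.
Proof.
move=> fF e e0; have e20 : 0 < e / 2 by rewrite divr_gt0.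
have [N hN] := fF _ e20; exists N => m n Nm Nn z Az.
apply: le_trans (cabs_dist _ _ (F z)) _; rewrite [e]splitr; apply: lerD; first exact: hN.
by rewrite cabsBC; exact: hN.
Qed.

Lemma ucauchy_poly (p : nat -> {poly C}) : ucauchy (@circle R) (fun n => horner (p n)) ->
  ucauchy (@disk R) (fun n => horner (p n)).
Proof.
move=> cp e /cp[N hN]; exists N => m n Nm Nn z; rewrite diskE => z1.
rewrite -hornerN -hornerD; apply: poly_max_circle z1 => w w1.
by rewrite hornerD hornerN; apply: hN => //; apply/circleE.
Qed.

Lemma poly_continuous (A : set C) p : {within A, continuous (horner p)}.
Proof.
apply/within_cabsP => z _ e e0; have [d /cder_cts/(_ _ e0)[r r0 hr]] := cder_horner p z.
by exists r => // w _; exact: hr.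
Qed.

(** Divide p_n - p_n(z) by X - z. On the circle |w - z| >= 1 - |z|, so the quotients are uniformly
    Cauchy there, hence on the disk by the maximum principle. Their limit G is continuous with F w -
    F z = G w (w - z), and G z is the derivative. *)
Lemma ulim_poly_HolD (p : nat -> {poly C}) (F : C -> C) :
  ulim (@disk R) (fun n => horner (p n)) F -> HolD F.
Proof.
move=> pF; split; first by apply: ulim_continuous pF _ => n; exact: poly_continuous.
move=> z; rewrite cnormE ltcR => z1; apply/derivable_cder.
have z10 : 0 < 1 - cabs z by rewrite subr_gt0.
have qE n : exists q : {poly C}, p n - (p n).[z]%:P = q * ('X - z%:P).
  by apply/factor_theorem; rewrite /root hornerD hornerN hornerC subrr.
have [q {}qE] := choice qE.
have qw n w : (p n).[w] - (p n).[z] = (q n).[w] * (w - z).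
  have := congr1 (horner^~ w) (qE n).
  by rewrite hornerD hornerN hornerC hornerM hornerXsubC.
have Dz : disk z by rewrite diskE ltW.
have cq : ucauchy (@circle R) (fun n => horner (q n)).
  move=> e e0; have e'0 : 0 < e * (1 - cabs z) / 2 by rewrite divr_gt0// mulr_gt0.
  have [N hN] := ulim_ucauchy pF e'0; exists N => m n Nm Nn w /circleE w1.
  have wz : 1 - cabs z <= cabs (w - z).
    by rewrite -w1; have := cabs_dist w 0 z; rewrite !subr0; lra.
  rewrite -(ler_pM2r (lt_le_trans z10 wz)) -cabsM mulrBl -!qw.
  rewrite (_ : _ - _ = ((p m).[w] - (p n).[w]) - ((p m).[z] - (p n).[z])); last by ring.
  apply: le_trans (cabsB _ _) _; apply: (@le_trans _ _ (e * (1 - cabs z))).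
    have h1 := hN m n Nm Nn z Dz; have Dw : disk w by rewrite diskE w1.
    by have := hN m n Nm Nn w Dw; move: h1; lra.
  by rewrite ler_pM2l.
have [G qG] := ucauchy_ulim (ucauchy_poly cq).
have /within_cabsP/(_ z Dz) cG : {within @disk R, continuous G}.
  by apply: ulim_continuous qG _ => n; exact: poly_continuous.
have FG w : disk w -> F w - F z = G w * (w - z).
  move=> Dw; apply/eqP; rewrite -subr_eq0 -cabs_eq0 eq_le cabs_ge0 andbT.
  apply/ler_addgt0Pl => e e0; rewrite addr0.
  have e40 : 0 < e / 4 by rewrite divr_gt0.
  have [N1 h1] := pF _ e40; have [N2 h2] := qG _ e40.
  have H1 := h1 _ (leq_maxl N1 N2) _ Dw; have H3 := h1 _ (leq_maxl N1 N2) _ Dz.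
  have H2 := h2 _ (leq_maxr N1 N2) _ Dw; move: (maxn _ _) H1 H2 H3 => n H1 H2 H3.
  rewrite (_ : _ - _ = ((q n).[w] - G w) * (w - z) - ((p n).[w] - F w) + ((p n).[z] - F z)); last first.
    by rewrite mulrBl -qw; ring.
  have wz2 : cabs (w - z) <= 2 by have := cabsB w z; move: Dw z1; rewrite diskE; lra.
  have HM : cabs (((q n).[w] - G w) * (w - z)) <= e / 4 * 2.
    by rewrite cabsM; apply: ler_pM; rewrite ?cabs_ge0.
  apply: le_trans (cabsD _ _) _; have := cabsB (((q n).[w] - G w) * (w - z)) ((p n).[w] - F w).
  by move: HM H1 H3; lra.
exists (G z) => e /cG[r r0 hr]; exists (Num.min r (1 - cabs z)); first by rewrite lt_min r0.
move=> w; rewrite lt_min => /andP[wr wz].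
have Dw : disk w by rewrite diskE; have := cabs_dist w 0 z; rewrite !subr0; move: wz; lra.
by rewrite FG// -mulrBl cabsM ler_wpM2r ?cabs_ge0//; exact: hr.
Qed.

End polynomials_on_disk.

(** * Square-integrable functions: representatives and the inner product *)

Section L2_space.
Context d (T : measurableType d) (R : realType).
Variable mu : {measure set T -> \bar R}.
Local Notation C := R[i].
Local Notation cabs := (@ComplexField.Normc.normc R).
Local Notation Re := complex.Re.
Local Notation Im := complex.Im.
Local Notation L2 := (L2 mu).
Implicit Types (f g : T -> C) (x y z : L2).
Local Open Scope quotient_scope.

Definition mC f := measurable_fun setT (fun t => Re (f t)) /\ measurable_fun setT (fun t => Im (f t)).

Lemma mC_cabs f : mC f -> measurable_fun setT (fun t => cabs (f t)).
Proof. by case=> fr fi; exact: (measurable_normc fr fi). Qed.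

Lemma mC_sq f : mC f -> measurable_fun setT (fun t => (cabs (f t) ^+ 2)%:E).
Proof. by move=> mf; apply/measurable_EFinP; apply: measurable_funX; exact: mC_cabs. Qed.

Lemma mC_cst c : mC (fun=> c).
Proof. by split; exact: measurable_cst. Qed.

Lemma mCD f g : mC f -> mC g -> mC (fun t => f t + g t).
Proof.
move=> [fr fi] [gr gi]; split.
- rewrite (_ : (fun t => _) = (fun t => Re (f t) + Re (g t))); first exact: measurable_funD.
  by apply/funext => t; case: (f t) (g t) => ? ? [].
- rewrite (_ : (fun t => _) = (fun t => Im (f t) + Im (g t))); first exact: measurable_funD.
  by apply/funext => t; case: (f t) (g t) => ? ? [].
Qed.

Lemma mCM f g : mC f -> mC g -> mC (fun t => f t * g t).
Proof.
move=> [fr fi] [gr gi]; split.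
- rewrite (_ : (fun t => _) = (fun t => Re (f t) * Re (g t) - Im (f t) * Im (g t))).
    by apply: measurable_funB; exact: measurable_funM.
  by apply/funext => t; case: (f t) (g t) => ? ? [].
- rewrite (_ : (fun t => _) = (fun t => Re (f t) * Im (g t) + Im (f t) * Re (g t))).
    by apply: measurable_funD; exact: measurable_funM.
  by apply/funext => t; case: (f t) (g t) => ? ? [].
Qed.

Lemma mCJ f : mC f -> mC (fun t => (f t)^*%C).
Proof.
move=> [fr fi]; split.
- by rewrite (_ : (fun t => _) = (fun t => Re (f t)))//; apply/funext => t; case: (f t).
- rewrite (_ : (fun t => _) = (fun t => - Im (f t))); first exact: measurableT_comp.
  by apply/funext => t; case: (f t).
Qed.

Definition sqI f : \bar R := (\int[mu]_t (cabs (f t) ^+ 2)%:E)%E.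

Lemma sqI_ge0 f : (0 <= sqI f)%E.
Proof. by apply: integral_ge0 => t _; rewrite lee_fin sqr_ge0. Qed.

Lemma cnorm2_sqI f : (cnorm2 mu f `^ 2 = sqI f)%E.
Proof.
rewrite /cnorm2 powR_Lnorm ?pnatr_eq0//; apply: eq_integral => t _ /=.
by rewrite ger0_norm ?cabs_ge0// powR_mulrn// cabs_ge0.
Qed.

Lemma sqintP f : sqint mu f <-> mC f /\ (sqI f < +oo)%E.
Proof.
split=> [[fr fi nf]|[[fr fi] nf]]; split => //.
  by rewrite -cnorm2_sqI poweR_lty.
rewrite ltey; apply/eqP => E; move: nf; rewrite -cnorm2_sqI E poweRyr ?ltxx//.
Qed.

Lemma repr_sqint x : sqint mu (repr x).
Proof. by case: (repr x) => f /= /L2funP. Qed.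

Lemma reprmC x : mC (repr x).
Proof. by case/sqintP : (repr_sqint x). Qed.

Lemma repr_L2class f : sqint mu f -> (repr (L2class mu f) : T -> C) = f %[ae mu].
Proof.
move=> sf; have sf' : f \in L2fun mu by apply/L2funP.
have /asboolP : repr (L2class mu f) - (PreL2 sf') \in @L2null d T R mu.
  rewrite Quotient.idealrBE reprK /L2class; apply/eqP; congr (\pi_L2 _).
  by apply: val_inj; rewrite val_insubd sf'.
by apply: filterS => t /= /(_ I) /subr0_eq.
Qed.

Lemma L2classP f x : sqint mu f -> f = (repr x : T -> C) %[ae mu] -> L2class mu f = x.
Proof.
move=> sf fx; rewrite -[x]reprK -[LHS]reprK.
apply/eqP; rewrite -Quotient.idealrBE; apply/asboolP.
have := repr_L2class sf; move: fx; apply: filterS2 => t /= /(_ I) fx /(_ I) ft _.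
by rewrite -[LHS]/(repr (L2class mu f) t - repr x t) ft fx subrr.
Qed.

Lemma L2_eq x y : (repr x : T -> C) = repr y %[ae mu] -> x = y.
Proof.
move=> xy; rewrite -(@L2classP (repr y) y (repr_sqint y)); last exact: ae_eq_refl.
by apply/esym/L2classP; [exact: repr_sqint|move: xy; apply: filterS => t /= /(_ I) ->].
Qed.

Lemma reprD x y : (repr (x + y) : T -> C) = (fun t => repr x t + repr y t) %[ae mu].
Proof.
have /asboolP : repr (x + y) - (repr x + repr y) \in @L2null d T R mu.
  by rewrite Quotient.idealrBE reprK raddfD/= !reprK.
by apply: filterS => t /= /(_ I) /subr0_eq.
Qed.

Lemma reprZ (a : C) x : (repr (a *: x) : T -> C) = (fun t => a * repr x t) %[ae mu].
Proof.
have /asboolP : repr (a *: x) - (a *: repr x) \in @L2null d T R mu.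
  by rewrite Quotient.idealrBE reprK.
by apply: filterS => t /= /(_ I) /subr0_eq.
Qed.

Lemma L2norm_sqI x : ((L2norm x ^+ 2)%:E = sqI (repr x))%E.
Proof.
rewrite -cnorm2_sqI -(fineK (cnorm2_fin (repr x))) -/(L2norm x).
by rewrite poweR_EFin powR_mulrn// L2norm_ge0.
Qed.

Lemma sqI_ae f g : mC f -> mC g -> f = g %[ae mu] -> sqI f = sqI g.
Proof.
move=> mf mg fg; apply: ae_eq_integral => //; [exact: mC_sq|exact: mC_sq|].
by apply: filterS fg => t /= /(_ I) ->.
Qed.

Lemma L2norm_class f : sqint mu f -> ((L2norm (L2class mu f) ^+ 2)%:E = sqI f)%E.
Proof.
move=> sf; rewrite L2norm_sqI; apply: sqI_ae; [exact: reprmC|by case/sqintP: sf|].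
exact: repr_L2class.
Qed.

Lemma sqint_dom f g (M : R) : mC f -> (forall t, cabs (f t) <= M * cabs (g t)) ->
  0 <= M -> sqint mu g -> sqint mu f /\ (sqI f <= (M ^+ 2)%:E * sqI g)%E.
Proof.
move=> mf fg M0 /sqintP[mg gy].
have le : (sqI f <= (M ^+ 2)%:E * sqI g)%E.
  rewrite -ge0_integralZl ?lee_fin ?sqr_ge0//; last 2 first.
  - exact: mC_sq.
  - by move=> t _; rewrite lee_fin sqr_ge0.
  apply: ge0_le_integral => //; [by move=> t _; rewrite lee_fin sqr_ge0|exact: mC_sq| |].
  - by apply: emeasurable_funM => //; exact: mC_sq.
  move=> t _; rewrite -EFinM lee_fin -exprMn.
  by rewrite lerXn2r ?nnegrE ?cabs_ge0// mulr_ge0// cabs_ge0.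
by split => //; apply/sqintP; split => //; apply: le_lt_trans le _; rewrite lte_mul_pinfty// lee_fin sqr_ge0.
Qed.

Section dot.
Implicit Types u v : T -> C.

Lemma integrable_dot u v : sqint mu u -> sqint mu v ->
  mu.-integrable setT (EFin \o (fun t => Re ((u t)^*%C * v t))) /\
  mu.-integrable setT (EFin \o (fun t => Im ((u t)^*%C * v t))).
Proof.
move=> /sqintP[mu_ ui] /sqintP[mv vi].
have [mr mi] := mCM (mCJ mu_) mv.
have int2 w : mC w -> (sqI w < +oo)%E -> mu.-integrable setT (fun t => (cabs (w t) ^+ 2)%:E).
  move=> mw wi; apply/integrableP; split; first exact: mC_sq.
  by under eq_integral do rewrite gee0_abs ?lee_fin ?sqr_ge0//.
have I := integrableD measurableT (int2 _ mu_ ui) (int2 _ mv vi).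
have B t (F : R) : `|F| <= cabs ((u t)^*%C * v t) ->
    (`|F%:E| <= `|((cabs (u t) ^+ 2)%:E + (cabs (v t) ^+ 2)%:E)|)%E.
  move=> h; rewrite -EFinD !abse_EFin lee_fin (le_trans h)// cabsM cabsJ.
  rewrite [X in _ <= X]ger0_norm ?addr_ge0 ?sqr_ge0//.
  have := sqr_ge0 (cabs (u t) - cabs (v t)).
  have := mulr_ge0 (cabs_ge0 (u t)) (cabs_ge0 (v t)).
  rewrite sqrrB; lra.
split; apply: (le_integrable _ _ _ I) => //.
- exact/measurable_EFinP.
- by move=> t _; apply: B; exact: Re_le_cabs.
- exact/measurable_EFinP.
- by move=> t _; apply: B; exact: Im_le_cabs.
Qed.

(** The inner product of functions rather than classes: concrete integrals are computed with it and
    moved to [L2dot] by [L2dotE]. *)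
Definition pdot u v : C := (\int[mu]_t Re ((u t)^*%C * v t)) +i* (\int[mu]_t Im ((u t)^*%C * v t)).

Lemma Rintegral_ae (f g : T -> R) : measurable_fun setT f -> measurable_fun setT g ->
  f = g %[ae mu] -> \int[mu]_t f t = \int[mu]_t g t.
Proof.
move=> mf mg fg; rewrite /Rintegral; congr fine; apply: ae_eq_integral => //.
- exact/measurable_EFinP.
- exact/measurable_EFinP.
- by apply: filterS fg => t /= /(_ I) ->.
Qed.

Lemma pdot_ae u v u' v' : mC u -> mC v -> mC u' -> mC v' -> u = u' %[ae mu] ->
  v = v' %[ae mu] -> pdot u v = pdot u' v'.
Proof.
move=> mu_ mv mu' mv' uu vv; rewrite /pdot.
have [a b] := mCM (mCJ mu_) mv; have [a' b'] := mCM (mCJ mu') mv'.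
by congr (_ +i* _); apply: Rintegral_ae => //; move: uu vv;
  apply: filterS2 => t /= /(_ I) -> /(_ I) ->.
Qed.

Lemma pdot_linear u v w (a : C) : sqint mu u -> sqint mu v -> sqint mu w ->
  pdot u (fun t => a * v t + w t) = a * pdot u v + pdot u w.
Proof.
move=> su sv sw.
have [i1 i2] := integrable_dot su sv; have [i3 i4] := integrable_dot su sw.
have iZ (k : R) (h : T -> R) : mu.-integrable setT (EFin \o h) ->
    mu.-integrable setT (EFin \o (fun t => k * h t)).
  by move=> ih; apply: (integrableZl measurableT k) ih.
have iD (h h' : T -> R) : mu.-integrable setT (EFin \o h) -> mu.-integrable setT (EFin \o h') ->
    mu.-integrable setT (EFin \o (fun t => h t + h' t)).
  by move=> ih ih'; apply: (integrableD measurableT) ih ih'.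
rewrite /pdot; case: a => a b.
have -> : (\int[mu]_t Re ((u t)^*%C * ((a +i* b) * v t + w t))) =
   a * (\int[mu]_t Re ((u t)^*%C * v t)) + (- b) * (\int[mu]_t Im ((u t)^*%C * v t)) + \int[mu]_t Re ((u t)^*%C * w t).
  rewrite -!RintegralZl// -!RintegralD//; try by first [exact: iZ|exact: (iD _ _ (iZ _ _ i1) (iZ _ _ i2))].
  by apply: eq_Rintegral => t _; case: (u t) (v t) (w t) => ? ? [? ?] [? ?]/=; ring.
have -> : (\int[mu]_t Im ((u t)^*%C * ((a +i* b) * v t + w t))) =
   b * (\int[mu]_t Re ((u t)^*%C * v t)) + a * (\int[mu]_t Im ((u t)^*%C * v t)) + \int[mu]_t Im ((u t)^*%C * w t).
  rewrite -!RintegralZl// -!RintegralD//; try by first [exact: iZ|exact: (iD _ _ (iZ _ _ i1) (iZ _ _ i2))].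
  by apply: eq_Rintegral => t _; case: (u t) (v t) (w t) => ? ? [? ?] [? ?]/=; ring.
by apply/eqP; rewrite eq_complex/=; apply/andP; split; apply/eqP; ring.
Qed.

Lemma pdotC u v : sqint mu u -> sqint mu v -> pdot v u = (pdot u v)^*%C.
Proof.
move=> su sv; have [i1 i2] := integrable_dot su sv; rewrite /pdot/=; congr (_ +i* _).
  by apply: eq_Rintegral => t _; case: (u t) (v t) => ? ? [? ?]/=; ring.
rewrite -mulN1r -RintegralZl//.
by apply: eq_Rintegral => t _; case: (u t) (v t) => ? ? [? ?]/=; ring.
Qed.

End dot.

Lemma L2dot_linear z x y (a : C) : L2dot z (a *: x + y) = a * L2dot z x + L2dot z y.
Proof.
have := pdot_linear a (repr_sqint z) (repr_sqint x) (repr_sqint y).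
rewrite -[L2dot z x]/(pdot _ _) -[L2dot z y]/(pdot _ _) => <-.
have mz := reprmC z; have mx := reprmC x; have my := reprmC y.
apply: pdot_ae; [exact: reprmC|exact: reprmC|exact: reprmC|exact: mCD (mCM (mC_cst a) mx) my|exact: ae_eq_refl|].
have h1 := reprD (a *: x) y; have h2 := reprZ a x.
by move: h1 h2; apply: filterS2 => t /= /(_ I) -> /(_ I) ->.
Qed.

Lemma L2dotC x y : L2dot y x = (L2dot x y)^*%C.
Proof. exact: pdotC (repr_sqint x) (repr_sqint y). Qed.

Lemma L2dotE f g : sqint mu f -> sqint mu g ->
  L2dot (L2class mu f) (L2class mu g) = pdot f g.
Proof.
move=> sf sg; apply: pdot_ae; [exact: reprmC|exact: reprmC|..].
- by case/sqintP: sf.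
- by case/sqintP: sg.
- exact: repr_L2class.
- exact: repr_L2class.
Qed.

Lemma L2dotxx x : L2dot x x = (L2norm x ^+ 2)%:C.
Proof.
have := L2norm_sqI x => /(congr1 fine)/= ->; rewrite -[LHS]/(pdot _ _) /pdot.
congr (_ +i* _).
  rewrite /Rintegral; congr fine; apply: eq_integral => t _.
  by rewrite mulcJ.
rewrite (_ : (fun t => _) = (fun=> 0)); last by apply/funext => t; rewrite mulcJ.
by rewrite Rintegral_cst// mul0r.
Qed.

End L2_space.

Arguments L2dot : simpl never.
Arguments L2norm : simpl never.

(** * L2 as a Hilbert space: Cauchy-Schwarz and completeness *)

Section L2_hilbert.
Context d (T : measurableType d) (R : realType).
Variable mu : {measure set T -> \bar R}.
Local Notation C := R[i].
Local Notation cabs := (@ComplexField.Normc.normc R).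
Local Notation Re := complex.Re.
Local Notation Im := complex.Im.
Local Notation L2 := (L2 mu).
Implicit Types (f g : T -> C) (x y z : L2) (a : C).

Lemma conjD (a b : C) : (a + b)^*%C = a^*%C + b^*%C. Proof. exact: rmorphD. Qed.
Lemma conjM (a b : C) : (a * b)^*%C = a^*%C * b^*%C. Proof. exact: rmorphM. Qed.
Lemma conjN (a : C) : (- a)^*%C = - a^*%C. Proof. exact: rmorphN. Qed.
Lemma conjB (a b : C) : (a - b)^*%C = a^*%C - b^*%C. Proof. exact: rmorphB. Qed.
Lemma conj0 : (0 : C)^*%C = 0. Proof. exact: rmorph0. Qed.

Lemma rcM (a b : R) : (a * b)%:C = a%:C * b%:C. Proof. exact: rmorphM. Qed.
Lemma rcB (a b : R) : (a - b)%:C = a%:C - b%:C. Proof. exact: rmorphB. Qed.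
Lemma rcD (a b : R) : (a + b)%:C = a%:C + b%:C. Proof. exact: rmorphD. Qed.

Lemma L2norm_triangle x y : L2norm (x + y) <= L2norm x + L2norm y.
Proof. by have := L2normD x y; rewrite -[X in _ <= X]raddfD/= lecR. Qed.

Lemma L2normZr a x : L2norm (a *: x) = cabs a * L2norm x.
Proof. by have := L2normZ a x; rewrite cnormE -rmorphM/= => -[]. Qed.

Lemma L2norm0_eq0 x : L2norm x = 0 -> x = 0.
Proof. by move=> h; apply: L2norm_eq0; rewrite h. Qed.

Lemma L2dotDr z x y : L2dot z (x + y) = L2dot z x + L2dot z y.
Proof. by have := L2dot_linear z x y 1; rewrite scale1r mul1r. Qed.

Lemma L2dot0r z : L2dot z 0 = 0.
Proof. by have := L2dotDr z 0 0; rewrite addr0 => /esym/eqP; rewrite -subr_eq0 addrK => /eqP. Qed.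

Lemma L2dotZr z a x : L2dot z (a *: x) = a * L2dot z x.
Proof. by have := L2dot_linear z x 0 a; rewrite addr0 L2dot0r addr0. Qed.

Lemma L2dotNr z x : L2dot z (- x) = - L2dot z x.
Proof. by rewrite -scaleN1r L2dotZr mulN1r. Qed.

Lemma L2dotBr z x y : L2dot z (x - y) = L2dot z x - L2dot z y.
Proof. by rewrite L2dotDr L2dotNr. Qed.

Lemma L2dotDl z x y : L2dot (x + y) z = L2dot x z + L2dot y z.
Proof. by rewrite L2dotC L2dotDr conjD -!L2dotC. Qed.

Lemma L2dotZl z a x : L2dot (a *: x) z = a^*%C * L2dot x z.
Proof. by rewrite L2dotC L2dotZr conjM -L2dotC. Qed.

Lemma L2dotNl z x : L2dot (- x) z = - L2dot x z.
Proof. by rewrite L2dotC L2dotNr conjN -L2dotC. Qed.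

Lemma L2dotBl z x y : L2dot (x - y) z = L2dot x z - L2dot y z.
Proof. by rewrite L2dotDl L2dotNl. Qed.

Lemma L2dot_sumr (I : Type) (r : seq I) (P : pred I) (F : I -> L2) z :
  L2dot z (\sum_(i <- r | P i) F i) = \sum_(i <- r | P i) L2dot z (F i).
Proof. exact: (big_morph _ (L2dotDr z) (L2dot0r z)). Qed.

(** Expand the square norm of [a%:C *: y - c *: x] with a the square norm of x: it is a (a |y|^2 -
    |c|^2), without any division. *)
Lemma cauchy_schwarz x y : cabs (L2dot x y) <= L2norm x * L2norm y.
Proof.
have [/L2norm0_eq0 ->|x0] := eqVneq (L2norm x) 0.
  by rewrite L2dotC L2dot0r conj0 cabs0 mulr_ge0// L2norm_ge0.
have xp : 0 < L2norm x by rewrite lt_def x0 L2norm_ge0.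
set c := L2dot x y.
pose a : R := L2norm x ^+ 2; have a0 : 0 < a by rewrite exprn_gt0.
have E : L2dot (a%:C *: y - c *: x) (a%:C *: y - c *: x) = (a * (a * L2norm y ^+ 2 - cabs c ^+ 2))%:C.
  rewrite !(L2dotBr, L2dotBl, L2dotZr, L2dotZl) !L2dotxx (L2dotC x y) -/c.
  rewrite -/a conjc_real rcM rcB rcM -mulcJ; ring.
have : 0 <= a * (a * L2norm y ^+ 2 - cabs c ^+ 2).
  by move: E; rewrite L2dotxx => -[<-]; rewrite sqr_ge0.
rewrite pmulr_rge0// subr_ge0 /a -exprMn => h.
by rewrite -(ler_pXn2r (_ : 0 < 2)%N)// ?nnegrE ?cabs_ge0// mulr_ge0// L2norm_ge0.
Qed.

Lemma L2normN x : L2norm (- x) = L2norm x.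
Proof. by rewrite -scaleN1r L2normZr cabsN cabs1 mul1r. Qed.

Lemma L2norm0 : L2norm (0 : L2) = 0.
Proof. by rewrite -(scale0r (0 : L2)) L2normZr cabs0 mul0r. Qed.

Lemma L2distC x y : L2norm (x - y) = L2norm (y - x).
Proof. by rewrite -L2normN opprB. Qed.

Lemma L2dist x y z : L2norm (x - y) <= L2norm (x - z) + L2norm (z - y).
Proof. by apply: le_trans (L2norm_triangle _ _); rewrite addrA subrK. Qed.

Lemma pythagoras x y : L2dot x y = 0 -> L2norm (x + y) ^+ 2 = L2norm x ^+ 2 + L2norm y ^+ 2.
Proof.
move=> xy; have := L2dotxx (x + y).
rewrite !(L2dotDl, L2dotDr) xy (L2dotC x y) xy conj0 addr0 add0r !L2dotxx -rcD.
by case.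
Qed.

Lemma norm_le_ortho x y : L2dot y (x - y) = 0 -> L2norm y ^+ 2 <= L2norm x ^+ 2.
Proof.
move=> h; have := pythagoras h; rewrite subrKC => ->.
by rewrite lerDl sqr_ge0.
Qed.

Lemma sqintD f g : sqint mu f -> sqint mu g -> sqint mu (fun t => f t + g t).
Proof.
move=> /L2funP sf /L2funP sg; apply/L2funP.
by have := @rpredD _ (L2fun mu) f g sf sg.
Qed.

Lemma L2classD f g : sqint mu f -> sqint mu g ->
  L2class mu (fun t => f t + g t) = L2class mu f + L2class mu g.
Proof.
move=> sf sg; apply: L2classP; first exact: sqintD.
have h1 := repr_L2class sf; have h2 := repr_L2class sg.
have h3 := reprD (L2class mu f) (L2class mu g).
move: h1 h2 h3; apply: filterS3 => t /= /(_ I) e1 /(_ I) e2 /(_ I) ->.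
by rewrite e1 e2.
Qed.

Lemma sqintZ a f : sqint mu f -> sqint mu (fun t => a * f t).
Proof.
move=> sf; have [mf _] := iffLR (sqintP mu f) sf.
have h t : cabs (a * f t) <= cabs a * cabs (f t) by rewrite cabsM.
have m : mC (fun t => a * f t) by exact: mCM (mC_cst _ a) mf.
by have [] := sqint_dom m h (cabs_ge0 a) sf.
Qed.

Lemma L2classZ a f : sqint mu f -> L2class mu (fun t => a * f t) = a *: L2class mu f.
Proof.
move=> sf; apply: L2classP; first exact: sqintZ.
have h1 := repr_L2class sf; have h3 := reprZ a (L2class mu f).
by move: h1 h3; apply: filterS2 => t /= /(_ I) e1 /(_ I) ->; rewrite e1.
Qed.

Lemma L2classB f g : sqint mu f -> sqint mu g ->
  L2class mu (fun t => f t - g t) = L2class mu f - L2class mu g.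
Proof.
move=> sf sg; rewrite -scaleN1r -L2classZ// -L2classD//; last exact: sqintZ.
by congr L2class; apply/funext => t; rewrite mulN1r.
Qed.

Lemma sqintB f g : sqint mu f -> sqint mu g -> sqint mu (fun t => f t - g t).
Proof.
move=> sf /(sqintZ (-1)) sg; have := sqintD sf sg.
by congr sqint; apply/funext => t; rewrite mulN1r.
Qed.

Lemma L2class_repr x : L2class mu (repr x) = x.
Proof. by apply: L2classP; [exact: repr_sqint|exact: ae_eq_refl]. Qed.

(** Riesz-Fischer: a subsequence with geometrically small increments converges almost everywhere,
    and Fatou's lemma shows that its pointwise limit is the limit in norm. *)
Lemma L2complete (u : nat -> L2) : (forall e : R, 0 < e -> exists N, forall m n,
    (N <= m)%N -> (N <= n)%N -> L2norm (u m - u n) <= e) ->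
  exists l, forall e : R, 0 < e -> exists N, forall n, (N <= n)%N -> L2norm (u n - l) <= e.
Proof.
move=> cu.
have H k : exists N, forall m n, (N <= m)%N -> (N <= n)%N ->
    L2norm (u m - u n) <= (4 ^+ k)^-1 by apply: cu; rewrite invr_gt0 exprn_gt0.
have [N hN] := choice H.
(* The running maximum makes all later indices good for every earlier rank. *)
pose phi k := \max_(j < k.+1) N j.
have phiN k l : (k <= l)%N -> (N k <= phi l)%N.
  by move=> kl; rewrite -ltnS in kl; exact: (leq_bigmax (Ordinal kl)).
pose v k := u (phi k).
have vv k l : (k <= l)%N -> L2norm (v l - v k) <= (4 ^+ k)^-1.
  by move=> kl; apply: hN; apply: phiN.
pose g k : T -> C := repr (v k).
have sg k : sqint mu (g k) by exact: repr_sqint.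
have mg k : mC (g k) by exact: reprmC.
(* The squared increments have integral at most 16^-k, so the weight 4^k leaves a convergent series,
   while finiteness of its sum at t forces increments of order 2^-k there. *)
pose D k t : \bar R := ((4 ^+ k * cabs (g k.+1 t - g k t) ^+ 2)%:E)%E.
have mgB k l : mC (fun t => g k t - g l t) by have [] := iffLR (sqintP mu _) (sqintB (sg k) (sg l)).
have D0 k t : (0 <= D k t)%E by rewrite lee_fin mulr_ge0 ?sqr_ge0// exprn_ge0.
have mD k : measurable_fun setT (D k).
  apply/measurable_EFinP; apply: measurable_funM => //.
  by apply: measurable_funX; apply: mC_cabs; exact: mgB.
have sqgB k l : sqI mu (fun t => g l t - g k t) = (L2norm (v l - v k) ^+ 2)%:E.
  by rewrite -L2norm_class ?L2classB ?L2class_repr//; exact: sqintB.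
have iD k : (\int[mu]_t D k t <= ((4 ^+ k)^-1)%:E)%E.
  rewrite /D; under eq_integral do rewrite EFinM.
  rewrite ge0_integralZl_EFin ?exprn_ge0//; last 2 first.
  - by move=> t _; rewrite lee_fin sqr_ge0.
  - by apply: mC_sq; exact: mgB.
  rewrite -/(sqI _ _) sqgB -EFinM lee_fin.
  have e0 : 0 < 4 ^+ k :> R by rewrite exprn_gt0.
  rewrite -(ler_pM2l (_ : 0 < (4 ^+ k)^-1)) ?invr_gt0// mulKf ?gt_eqF//.
  by rewrite -expr2 lerXn2r ?nnegrE ?L2norm_ge0 ?invr_ge0 ?(ltW e0)//; exact: vv.
pose F t := (\sum_(k <oo) D k t)%E.
have mF : measurable_fun setT F by apply: ge0_emeasurable_sum.
have F0 t : (0 <= F t)%E by apply: nneseries_ge0 => k _ _; exact: D0.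
have iF : (\int[mu]_t F t < +oo)%E.
  rewrite /F integral_nneseries//.
  apply: (@le_lt_trans _ _ (\sum_(k <oo) ((1 / (4 ^+ k))%:E))%E).
    apply: lee_nneseries => k _ *; first exact: integral_ge0.
    by rewrite mul1r; exact: iD.
  apply: (@le_lt_trans _ _ (2%:E)); last by rewrite ltry.
  apply: lime_le; first by apply: is_cvg_nneseries => n _ _; rewrite lee_fin divr_ge0// exprn_ge0.
  near=> n; rewrite sumEFin lee_fin.
  have -> : \sum_(0 <= k < n) 1 / 4 ^+ k = (4 - 4 / 4 ^+ n) / 3 :> R.
    elim: (n) => [|m IH]; first by rewrite big_nil expr0 divr1 subrr mul0r.
    rewrite big_nat_recr//= IH exprS; field.
    by rewrite expf_neq0.
  have : 0 <= 4 / 4 ^+ n :> R by rewrite divr_ge0// exprn_ge0.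
  lra.
pose A := [set t | F t \is a fin_num].
have aeA : {ae mu, forall t, A t}.
  have : mu.-integrable setT F.
    apply/integrableP; split => //.
    by under eq_integral do rewrite gee0_abs//.
  by move=> /integrable_ae - /(_ measurableT); apply: filterS => t /(_ I).
have mA : measurable A by rewrite -[A]setTI; exact: emeasurable_fin_num.
(* Changed to 0 on a null set, the representatives converge at every point. *)
pose h k t : C := if t \in A then g k t else 0.
have mh k : mC (h k).
  have E (F' : C -> R) : F' 0 = 0 -> measurable_fun setT (fun t => F' (g k t)) ->
      measurable_fun setT (fun t => F' (h k t)).
    move=> F00 mFg; rewrite (_ : (fun t => _) = (fun t => F' (g k t)) \_ A).
      by apply/measurable_restrict => //; rewrite setTI; exact: measurable_funTS.
    by apply/funext => t; rewrite /h /patch; case: ifP.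
  by have [a b] := mg k; split; apply: E.
have hg k : h k = g k %[ae mu].
  by apply: filterS aeA => t At _; rewrite /h mem_set.
have sh k : sqint mu (h k).
  apply/sqintP; split => //; rewrite (sqI_ae (mh k) (mg k) (hg k)).
  by have [] := iffLR (sqintP mu _) (sg k).
have hv k : L2class mu (h k) = v k by apply: L2classP.
have hcv t : exists l, forall e : R, 0 < e -> exists N, forall n, (N <= n)%N -> cabs (h n t - l) <= e.
  apply: cauchyC => e e0; have [At|At] := boolP (t \in A); last first.
    by exists 0%N => m n _ _; rewrite /h (negPf At) subrr cabs0 ltW.
  have Ffin : F t \is a fin_num by rewrite inE in At.
  (* The added 1 gives [S - 1 <= S * S], so that S also bounds the square root of F t. *)
  pose S := fine (F t) + 1; have S0 : 1 <= S by rewrite lerDr fine_ge0.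
  have S1 : 0 < S by exact: lt_le_trans S0.
  have dS k : cabs (g k.+1 t - g k t) <= S * (2 ^+ k)^-1.
    have : (D k t <= (S - 1)%:E)%E.
      rewrite /S addrK fineK//; apply: le_trans (nneseries_lim_ge (m:=0) k.+1 _); last by move=> *.
      by rewrite big_nat_recr//= leeDr// sume_ge0.
    rewrite lee_fin => h4; rewrite -(ler_pXn2r (_ : 0 < 2)%N)// ?nnegrE ?cabs_ge0//; last first.
      by rewrite mulr_ge0 ?invr_ge0 ?exprn_ge0// ltW.
    rewrite exprMn exprVn -exprM mulnC exprM (_ : 2 ^+ 2 = 4 :> R); last by rewrite expr2 -natrM.
    rewrite ler_pdivlMr ?exprn_gt0// mulrC; apply: le_trans h4 _.
    rewrite lerBlDr expr2; apply: (@le_trans _ _ (S * S)); first by rewrite ler_peMr// ltW.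
    by rewrite lerDl.
  have tail k n : cabs (g (k + n)%N t - g k t) <= S * (2 / 2 ^+ k - 2 / 2 ^+ (k + n)).
    elim: n => [|n IH]; first by rewrite addn0 !subrr cabs0 mulr0.
    apply: le_trans (cabs_dist _ _ (g (k + n)%N t)) _; rewrite addnS.
    apply: le_trans (lerD (dS _) IH) _; rewrite -mulrDr ler_pM2l//.
    rewrite exprS invfM mulrA divff// mul1r.
    have -> : 2 / 2 ^+ (k + n) = (2 ^+ (k + n))^-1 + (2 ^+ (k + n))^-1 :> R by ring.
    lra.
  have [M hM] : exists M : nat, S * (2 / 2 ^+ M) <= e / 2.
    have /cvgrPdist_le/(_ (e / 2) ltac:(by rewrite divr_gt0))[M _ hM] :
        (fun n => (S * 2) * (2^-1) ^+ n) @ \oo --> (0 : R).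
      rewrite -[X in _ --> X](mulr0 (S * 2)); apply: cvgMl_tmp; apply: cvg_expr.
      by rewrite ger0_norm ?invr_ge0// invf_lt1// ltr1n.
    exists M; have := hM M (leqnn _); rewrite sub0r normrN exprVn mulrA.
    exact: le_trans (ler_norm _).
  have HM n : (M <= n)%N -> cabs (g n t - g M t) <= e / 2.
    move=> Mn; have := tail M (n - M)%N; rewrite subnKC// => /le_trans; apply.
    apply: le_trans hM; rewrite ler_pM2l// lerBlDr lerDl divr_ge0// exprn_ge0.
  exists M => m n Mm Mn; rewrite /h At.
  apply: le_trans (cabs_dist _ _ (g M t)) _; rewrite [e]splitr.
  by apply: lerD; [exact: HM|rewrite cabsBC; exact: HM].
have [G hG] := choice hcv.
have mG : mC G.
  split; [apply: (@measurable_fun_cvg _ _ _ _ (fun n t => Re (h n t)))|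
    apply: (@measurable_fun_cvg _ _ _ _ (fun n t => Im (h n t)))].
  - by move=> n; have [] := mh n.
  - move=> t _; apply/cvgrPdist_le => e /(hG t)[n0 hn0]; exists n0 => // n /= /hn0.
    by rewrite distrC -raddfB; exact: le_trans (Re_le_cabs _).
  - by move=> n; have [] := mh n.
  - move=> t _; apply/cvgrPdist_le => e /(hG t)[n0 hn0]; exists n0 => // n /= /hn0.
    by rewrite distrC -raddfB; exact: le_trans (Im_le_cabs _).
have fatouG k : (sqI mu (fun t => (G t - h k t)%R) <= (((4 ^+ k)^-1) ^+ 2)%:E)%E.
  pose q l t : \bar R := (cabs (h (k + l)%N t - h k t) ^+ 2)%:E.
  have mq l : measurable_fun setT (q l).
    by apply: mC_sq; have [] := iffLR (sqintP mu _) (sqintB (sh (k + l)%N) (sh k)).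
  have q0 l t : setT t -> (0 <= q l t)%E by rewrite lee_fin sqr_ge0.
  have := fatou mu measurableT mq q0.
  have -> : (\int[mu]_x limn_einf (q^~ x) = sqI mu (fun t => (G t - h k t)%R))%E.
    apply: eq_integral => t _; apply: (cvg_limn_einf_sup _).1.
    apply/cvg_EFin; first by near=> n.
    rewrite /= (_ : (_ \o _) = (fun l => cabs (h (k + l)%N t - h k t) * cabs (h (k + l)%N t - h k t))); last first.
      by apply/funext => l /=; rewrite expr2.
    have cv : (fun l => cabs (h (k + l)%N t - h k t)) @ \oo --> cabs (G t - h k t).
      apply/cvgrPdist_le => e /(hG t)[n0 hn0]; exists n0 => // n /= n0n.
      have kn : (n0 <= k + n)%N by rewrite (leq_trans n0n)// leq_addl.
      have H1 := cabs_dist (G t) (h k t) (h (k + n)%N t).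
      have H2 := cabs_dist (h (k + n)%N t) (h k t) (G t).
      have H3 := hn0 _ kn; have H4 := H3; rewrite cabsBC in H4.
      rewrite ler_norml; apply/andP; clear -H1 H2 H3 H4; split; lra.
    by rewrite expr2; apply: cvgM.
  move=> /le_trans; apply; rewrite limn_einf_lim.
  apply: lime_le; first exact: is_cvg_einfs.
  near=> l; apply: (@le_trans _ _ (\int[mu]_x q l x)%E).
    by apply: ereal_inf_lbound; exists l => /=.
  rewrite -/(sqI mu _) -L2norm_class ?L2classB//; last exact: sqintB.
  rewrite !hv lee_fin lerXn2r ?nnegrE ?L2norm_ge0 ?invr_ge0 ?exprn_ge0//.
  by apply: vv; rewrite leq_addr.
have sGh k : sqint mu (fun t => G t - h k t).
  apply/sqintP; split; last by apply: le_lt_trans (fatouG k) _; rewrite ltry.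
  have := mCD mG (mCM (mC_cst _ (-1)) (mh k)); congr mC.
  by apply/funext => t; rewrite mulN1r.
have sG : sqint mu G.
  have := sqintD (sGh 0%N) (sh 0%N); congr sqint.
  by apply/funext => t; rewrite subrK.
have lG k : L2norm (L2class mu G - v k) <= (4 ^+ k)^-1.
  rewrite -(ler_pXn2r (_ : 0 < 2)%N)// ?nnegrE ?L2norm_ge0 ?invr_ge0 ?exprn_ge0//.
  by rewrite -lee_fin -hv -L2classB// L2norm_class.
exists (L2class mu G) => e e0.
have [k hk] : exists k : nat, 2 / 4 ^+ k <= e :> R.
  have /cvgrPdist_le/(_ e e0)[M _ hM] : (fun n => 2 * (4^-1) ^+ n) @ \oo --> (0 : R).
    rewrite -[X in _ --> X](mulr0 2); apply: cvgMl_tmp; apply: cvg_expr.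
    by rewrite ger0_norm ?invr_ge0// invf_lt1// ltr1n.
  exists M; have := hM M (leqnn _); rewrite sub0r normrN exprVn.
  exact: le_trans (ler_norm _).
exists (phi k) => n pn; apply: le_trans (L2dist _ _ (v k)) _.
apply: le_trans hk; rewrite (_ : 2 / 4 ^+ k = (4 ^+ k)^-1 + (4 ^+ k)^-1 :> R); last by ring.
apply: lerD; last by rewrite L2distC.
by apply: hN; [exact: leq_trans (phiN _ _ (leqnn k)) pn|exact: phiN].
Unshelve. all: by end_near. Qed.
End L2_hilbert.

(** * The measure on the disk as a series of circle averages *)

Section disk_measure_theory.
Context (R : realType).
Local Notation C := R[i].
Local Notation cabs := (@ComplexField.Normc.normc R).
Local Notation Re := complex.Re.
Local Notation Im := complex.Im.
Local Notation leb := (@lebesgue_measure R).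

Lemma circle_mapE (r t : R) : circle_map r t = r%:C * cis t :> C.
Proof. by rewrite /circle_map/cis; simpc. Qed.

Section weights.
Variables (q : R) (hq : 0 < q < 1).

Let q0 : 0 < q. Proof. by case/andP: hq. Qed.
Let q1 : q < 1. Proof. by case/andP: hq. Qed.

Let fac m i : R := 1 - q ^+ m * q ^+ i.+1.

Let fac01 m i : 0 <= fac m i <= 1.
Proof.
rewrite /fac -exprD subr_ge0 exprn_ile1 ?(ltW q0) ?(ltW q1)//= lerBlDr lerDl.
by rewrite exprn_ge0// ltW.
Qed.

Let W m n : R := \prod_(i < n) fac m i.

Let W01 m n : 0 <= W m n <= 1.
Proof.
apply/andP; split; first by apply: prodr_ge0 => i _; case/andP: (fac01 m i).
by apply: prodr_ile1 => i _; exact: fac01.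
Qed.

Let W_cvg m : cvgn (W m).
Proof.
apply: nonincreasing_is_cvgn.
  apply/nonincreasing_seqP => n; rewrite /W big_ord_recr/=.
  by rewrite ler_piMr//; [case/andP: (W01 m n)|case/andP: (fac01 m n)].
by exists 0 => _ [n _ <-]; case/andP: (W01 m n).
Qed.

(** Choose K so that the powers of q beyond K sum to at most 1 / 2. The later factors then multiply
    to at least 1 / 2 because prod (1 - x_i) >= 1 - sum x_i, which is [tail] with the geometric sum
    in closed form. *)
Let W_lb : exists2 e : R, 0 < e & forall n, e <= W 0 n.
Proof.
have [K hK] : exists K : nat, q ^+ K.+1 / (1 - q) <= 1 / 2.
  have /cvgrPdist_le/(_ (1 / 2) ltac:(lra))[M _ hM] : (fun n => (q / (1 - q)) * q ^+ n) @ \oo --> (0 : R).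
    rewrite -[X in _ --> X](mulr0 (q / (1 - q))); apply: cvgMl_tmp; apply: cvg_expr.
    by rewrite ger0_norm// ltW.
  exists M; have := hM M (leqnn _); rewrite sub0r normrN => /(le_trans (ler_norm _)).
  by rewrite exprS mulrAC.
have WK : 0 < W 0 K.
  apply: prodr_gt0 => i _; rewrite /fac expr0 mul1r subr_gt0.
  by rewrite exprn_ilt1// ltW.
have q11 : 0 < 1 - q by rewrite subr_gt0.
have tail n : W 0 K * (1 - q ^+ K.+1 * (1 - q ^+ n) / (1 - q)) <= W 0 (K + n).
  elim: n => [|n IH]; first by rewrite addn0 expr0 subrr mulr0 mul0r subr0 mulr1.
  rewrite addnS /W big_ord_recr/= -/(W 0 (K + n)).
  rewrite {2}/fac expr0 mul1r; set x := q ^+ (K + n).+1.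
  have x0 : 0 <= x by rewrite exprn_ge0// ltW.
  have x1 : x <= 1 by rewrite exprn_ile1// ltW.
  have : (W 0 K * (1 - q ^+ K.+1 * (1 - q ^+ n) / (1 - q))) * (1 - x) <= W 0 (K + n) * (1 - x).
    by rewrite ler_wpM2r// subr_ge0.
  apply: le_trans; rewrite -[X in _ <= X]mulrA ler_pM2l//.
  have xE : x = q ^+ K.+1 * q ^+ n by rewrite /x -addSn exprD.
  have -> : q ^+ K.+1 * (1 - q ^+ n.+1) / (1 - q) = q ^+ K.+1 * (1 - q ^+ n) / (1 - q) + x.
    by rewrite xE [q ^+ n.+1]exprS; field; rewrite gt_eqF.
  have : 0 <= q ^+ K.+1 * (1 - q ^+ n) / (1 - q) * x.
    rewrite !mulr_ge0// ?exprn_ge0 ?(ltW q0)// ?invr_ge0 ?(ltW q11)//.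
    by rewrite subr_ge0 exprn_ile1// ltW.
  set y := q ^+ K.+1 * _ / _; move: (y) => y' hy; lra.
exists (W 0 K / 2) => [|n]; first by rewrite divr_gt0.
have h n' : W 0 K / 2 <= W 0 (K + n').
  apply: le_trans (tail n'); rewrite ler_pM2l// -mulrA.
  have : q ^+ K.+1 * ((1 - q ^+ n') / (1 - q)) <= q ^+ K.+1 / (1 - q).
    rewrite ler_pM2l ?exprn_gt0// -{2}[(1 - q)^-1]mul1r ler_pM2r ?invr_gt0//.
    by rewrite lerBlDr lerDl exprn_ge0// ltW.
  by move: hK; lra.
have [Kn|nK] := leqP K n; first by have := h (n - K)%N; rewrite subnKC.
have := h 0%N; rewrite addn0 => /le_trans; apply.
have mono k : W 0 (n + k) <= W 0 n.
  elim: k => [|k IH]; first by rewrite addn0.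
  apply: le_trans IH; rewrite addnS /W big_ord_recr/=.
  by rewrite ler_piMr//; [case/andP: (W01 0 (n + k))|case/andP: (fac01 0 (n + k))].
by have := mono (K - n)%N; rewrite subnKC// ltnW.
Qed.

Definition cw m : R := `|qweight q m|.

(** The product for circle m lies between that for circle 0 and 1. Total mass, the norms of
    monomials and the dilation are all controlled by this comparison with q^m. *)
Lemma cw_bounds : exists2 e : R, 0 < e & forall m, e * q ^+ m <= cw m <= q ^+ m.
Proof.
have [e e0 he] := W_lb; exists e => // m.
have qm0 : 0 < q ^+ m by rewrite exprn_gt0.
have W0m n : W 0 n <= W m n.
  apply: ler_prod => i _; case/andP: (fac01 0 i) => -> _ /=.
  rewrite /fac expr0 mul1r lerD2l lerN2 ler_piMl// ?exprn_ge0// ?(ltW q0)//.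
  by rewrite exprn_ile1// ltW.
have l1 : e <= limn (W m).
  by apply: limr_ge; [exact: W_cvg|near=> n; exact: le_trans (he _) (W0m _)].
have l2 : limn (W m) <= 1.
  by apply: limr_le; [exact: W_cvg|near=> n; case/andP: (W01 m n)].
rewrite /cw /qweight -/(W m).
rewrite ger0_norm ?mulr_ge0 ?(ltW qm0)// ?(le_trans (ltW e0))//.
by rewrite mulrC ler_pM2l// l1 ler_piMr// ltW.
Unshelve. all: by end_near. Qed.

Lemma cw_ge0 m : 0 <= cw m. Proof. exact: normr_ge0. Qed.

End weights.

Lemma measurable_fun_open (D : set C) (f : C -> R) : measurable D ->
  (forall U : set R, open U -> exists2 V : set C, open V & D `&` f @^-1` U = D `&` V) ->
  measurable_fun D f.
Proof.
move=> mD fo; apply: (measurability _ (RGenOpens.measurableE R)).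
move=> _ [_ [a [b ->] <-]]; have [V oV ->] := fo _ (@interval_open _ (BRight a) (BLeft b) isT isT).
by apply: measurableI => //; exact: sub_sigma_algebra.
Qed.

Lemma lip_measurable (f : C -> R) : (forall z w, `|f z - f w| <= cabs (z - w)) ->
  measurable_fun setT f.
Proof.
move=> fL; apply: measurable_fun_open => // U oU; exists (f @^-1` U) => //.
rewrite openE => z Uz; move: oU; rewrite openE => /(_ _ Uz).
rewrite /interior => /nbhs_ballP[e /= e0 he]; apply/nbhs_ballP; exists e%:C; first by rewrite /= ltcR.
move=> w; rewrite -ball_normE/= cnormE ltcR => zw; apply: he.
by rewrite -ball_normE/=; exact: le_lt_trans (fL _ _) zw.
Qed.

Lemma measurable_cabs : measurable_fun setT cabs.
Proof.
apply: lip_measurable => z w; rewrite ler_norml.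
have := cabs_dist z 0 w; have := cabs_dist w 0 z; rewrite !subr0 (cabsBC w z) => a b.
by apply/andP; split; lra.
Qed.

Lemma measurable_disk : measurable (@disk R).
Proof.
rewrite (_ : @disk R = [set: C] `&` cabs @^-1` `]-oo, 1]); last first.
  by apply/seteqP; split=> z /=; rewrite in_itv/= -diskE //; case.
by apply: measurable_cabs => //; exact: measurable_itv.
Qed.

Lemma measurable_Re : measurable_fun setT (@complex.Re R).
Proof. by apply: lip_measurable => z w; rewrite -raddfB; exact: Re_le_cabs. Qed.

Lemma measurable_Im : measurable_fun setT (@complex.Im R).
Proof. by apply: lip_measurable => z w; rewrite -raddfB; exact: Im_le_cabs. Qed.

Lemma mC_id : mC (@id C).
Proof. by split; [exact: measurable_Re|exact: measurable_Im]. Qed.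

Lemma mC_patch (f : C -> C) : {within @disk R, continuous f} ->
  mC (patch (fun=> 0) (@disk R) f).
Proof.
move=> /within_cabsP cf.
have H (F : C -> R) : (forall z w, `|F z - F w| <= cabs (z - w)) -> F 0 = 0 ->
    measurable_fun setT (fun z => F (patch (fun=> 0) (@disk R) f z)).
  move=> FL F0; rewrite (_ : (fun z => _) = (fun z => F (f z)) \_ (@disk R)); last first.
    by apply/funext => z; rewrite /patch; case: ifP.
  apply/measurable_restrict => //; first exact: measurable_disk.
  rewrite setTI; apply: measurable_fun_open; first exact: measurable_disk.
  move=> U oU.
  (* As f is continuous relative to the disk only, the preimage is the trace of an open set: the
     union of all balls whose part in the disk is sent into U. *)
  pose V := \bigcup_(p in [set p : C * R | 0 < p.2 /\ forall w, disk w ->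
     cabs (w - p.1) < p.2 -> U (F (f w))]) [set w | cabs (w - p.1) < p.2].
  exists V.
    rewrite openE => z [[p r] /= [r0 hr] zp]; rewrite /interior.
    apply/nbhs_ballP; exists (r - cabs (z - p))%:C; first by rewrite /= ltcR subr_gt0.
    move=> w; rewrite -ball_normE/= cnormE ltcR => zw; exists (p, r) => //=.
    by have := cabs_dist w p z; rewrite (cabsBC w z); lra.
  apply/seteqP; split=> z /= [Dz]; last first.
    by move=> [[p r] /= [r0 hr] zp]; split => //; exact: hr.
  move=> Uz; split => //; move: oU; rewrite openE => /(_ _ Uz).
  rewrite /interior => /nbhs_ballP[e /= e0 he].
  have [d d0 hd] := cf z Dz _ (ltac:(by rewrite divr_gt0) : 0 < e / 2).
  exists (z, d) => /=; last by rewrite subrr cabs0.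
  split => // w Dw wz; apply: he; rewrite -ball_normE/=.
  apply: le_lt_trans (FL _ _) _; rewrite cabsBC; apply: le_lt_trans (hd _ Dw wz) _.
  by rewrite ltr_pdivrMr// ltr_pMr// ltr1n.
by split; apply: H => // z w; rewrite -raddfB ?Re_le_cabs ?Im_le_cabs.
Qed.

Lemma open_dilate (k : R) (U : set C) : 0 <= k <= 1 -> open U ->
  open [set z : C | U (k%:C * z)].
Proof.
move=> /andP[k0 k1]; rewrite !openE => oU z /= /oU.
rewrite /interior => /nbhs_ballP[_ /gt0_complex[r r0 ->] hr].
apply/nbhs_ballP; exists (r%:C); first by rewrite /= ltcR.
move=> w; rewrite -ball_normE/= cnormE ltcR => zw; apply: hr.
rewrite -ball_normE/= -mulrBr cnormE ltcR cabsM cabsR ger0_norm//.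
by apply: le_lt_trans zw; rewrite ler_piMl ?cabs_ge0.
Qed.

Lemma nneseries_shift (b : nat -> \bar R) k : (forall m, 0 <= b m)%E ->
  (\sum_(m <oo) b (k + m)%N <= \sum_(m <oo) b m)%E.
Proof.
move=> b0.
have -> : (\sum_(m <oo) b (k + m)%N = \sum_(k <= m <oo) b m)%E.
  by rewrite -(@nneseries_addn R b k b0); apply: eq_eseriesr => m _; rewrite addnC.
rewrite [X in (_ <= X)%E](nneseries_split 0 k) => [|m _]; last exact: b0.
by rewrite add0n leeDr// sume_ge0.
Qed.

Section integrals.
Variables (q : R) (hq : 0 < q < 1).
Local Notation mu := (disk_measure q).
Local Notation rad m := (Num.sqrt (q ^+ m)).

Lemma rad01 m : 0 < rad m <= 1.
Proof.
case/andP: hq => q0 q1; rewrite sqrtr_gt0 exprn_gt0//=.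
by rewrite -[leRHS]sqrtr1 ler_sqrt// exprn_ile1// ltW.
Qed.

Definition cavg (F : C -> \bar R) (r : R) : \bar R :=
  ((2 * pi)^-1%:E * \int[leb]_(t in `[0%R, (2 * pi)%R]) F (circle_map r t))%E.

Lemma diskint (F : C -> \bar R) : measurable_fun setT F -> (forall z, 0 <= F z)%E ->
  (\int[mu]_z F z = \sum_(m <oo) ((cw q m)%:E * cavg F (rad m)))%E.
Proof.
move=> mF F0; rewrite /disk_measure ge0_integral_measure_series//.
apply: eq_eseriesr => m _; rewrite ge0_integral_mscale//; congr (_ * _)%E.
rewrite /circle_prob ge0_integral_distribution//.
rewrite integral_uniform ?subr0//; last by move=> t; exact: F0.
exact: measurableT_comp.
Qed.

Lemma cavg_ge0 F r : (forall z, 0 <= F z)%E -> (0 <= cavg F r)%E.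
Proof.
move=> F0; rewrite /cavg mule_ge0//; last exact: integral_ge0.
by rewrite lee_fin invr_ge0 mulr_ge0// pi_ge0.
Qed.

Lemma eq_cavg F G r : (forall t, F (circle_map r t) = G (circle_map r t)) -> cavg F r = cavg G r.
Proof. by move=> FG; rewrite /cavg; congr (_ * _)%E; apply: eq_integral. Qed.

Lemma cavg_cst (k : R) r : cavg (fun=> k%:E) r = k%:E.
Proof.
rewrite /cavg integral_cst//= lebesgue_measure_itv/= lte_fin twopi_gt0.
by rewrite -EFinB -!EFinM subr0 mulrCA mulVf ?mulr1// gt_eqF// twopi_gt0.
Qed.

Lemma circle_map_disk m t : disk (circle_map (rad m) t : C).
Proof. by rewrite circle_mapE; apply: disk_cis; case/andP: (rad01 m) => /ltW -> ->. Qed.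

(** All charged circles lie in the disk, so an inequality there suffices. *)
Lemma diskint_le (F G : C -> \bar R) : measurable_fun setT F -> (forall z, 0 <= F z)%E ->
  measurable_fun setT G -> (forall z, 0 <= G z)%E -> (forall z, disk z -> F z <= G z)%E ->
  (\int[mu]_z F z <= \int[mu]_z G z)%E.
Proof.
move=> mF F0 mG G0 FG; rewrite !diskint//; apply: lee_nneseries => m _ *.
  by rewrite mule_ge0 ?cavg_ge0// lee_fin cw_ge0.
rewrite lee_wpmul2l ?lee_fin ?cw_ge0// /cavg lee_wpmul2l ?lee_fin ?invr_ge0 ?mulr_ge0 ?pi_ge0//.
have mc (K : C -> \bar R) : measurable_fun setT K ->
    measurable_fun `[0, 2 * pi]%classic (fun t : measurableTypeR R => K (circle_map (rad m) t)).
  by move=> mK; apply: measurable_funTS; exact: (measurableT_comp mK (@circle_map_measurable R (rad m))).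
apply: ge0_le_integral => //; [exact: mc|exact: mc|].
by move=> t _; apply: FG; exact: circle_map_disk.
Qed.

Lemma mu_finite : (mu setT < +oo)%E.
Proof.
have [q0 q1] := andP hq.
have q11 : 0 < 1 - q by rewrite subr_gt0.
have -> : mu setT = (\int[mu]_z (1%:E))%E by rewrite integral_cst// mul1e.
rewrite diskint//.
apply: (@le_lt_trans _ _ ((1 - q)^-1)%:E); last by rewrite ltry.
apply: lime_le.
  by apply: is_cvg_nneseries => n _ _; rewrite mule_ge0 ?cavg_ge0// lee_fin cw_ge0.
near=> n; have [e e0 he] := cw_bounds hq.
apply: (@le_trans _ _ (\sum_(0 <= k < n) (q ^+ k)%:E)%E).
  by apply: lee_sum => k _; rewrite cavg_cst mule1 lee_fin; case/andP: (he k).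
rewrite sumEFin lee_fin -(ler_pM2l q11) divff ?gt_eqF// big_mkord.
rewrite -[X in X <= _]opprK -mulNr opprB -subrX1 opprB lerBlDr lerDl.
by rewrite exprn_ge0// ltW.
Unshelve. all: by end_near. Qed.

Lemma ae_disk : {ae mu, forall z, @disk R z}.
Proof.
have mN : measurable (~` @disk R) by apply: measurableC; exact: measurable_disk.
exists (~` @disk R); split => //.
have : (\int[mu]_z (\1_(~` @disk R) z)%:E = 0)%E.
  apply/eqP; rewrite eq_le integral_ge0 ?andbT; last by move=> z _; rewrite lee_fin.
  rewrite -[X in (_ <= X)%E](integral0 mu setT).
  apply: diskint_le => //.
  - by apply/measurable_EFinP; exact: measurable_indic.
  - by move=> z Dz; rewrite indicE memNset.
by rewrite integral_indic// setIT.
Qed.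

Lemma sqI_le (f g : C -> C) (M : R) : mC f -> mC g -> 0 <= M ->
  (forall z, disk z -> cabs (f z) <= M * cabs (g z)) -> (sqI mu f <= (M ^+ 2)%:E * sqI mu g)%E.
Proof.
move=> mf mg M0 fg; rewrite -ge0_integralZl ?lee_fin ?sqr_ge0//; last 2 first.
- exact: mC_sq.
- by move=> t _; rewrite lee_fin sqr_ge0.
apply: diskint_le.
- exact: mC_sq.
- by move=> z; rewrite lee_fin sqr_ge0.
- by apply: emeasurable_funM => //; exact: mC_sq.
- by move=> z; rewrite -EFinM lee_fin mulr_ge0 ?sqr_ge0.
- by move=> z /fg h; rewrite -EFinM lee_fin -exprMn lerXn2r ?nnegrE ?cabs_ge0// mulr_ge0// cabs_ge0.
Qed.

Lemma sqint_le (f g : C -> C) (M : R) : mC f -> 0 <= M ->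
  (forall z, disk z -> cabs (f z) <= M * cabs (g z)) -> sqint mu g -> sqint mu f.
Proof.
move=> mf M0 fg /sqintP[mg gi]; apply/sqintP; split => //.
by apply: le_lt_trans (sqI_le mf mg M0 fg) _; rewrite lte_mul_pinfty// lee_fin sqr_ge0.
Qed.

Lemma sqint_bdd (f : C -> C) (M : R) : mC f -> 0 <= M ->
  (forall z, disk z -> cabs (f z) <= M) -> sqint mu f.
Proof.
move=> mf M0 fM; apply: (@sqint_le f (fun=> 1) M) => //.
  by move=> z /fM; rewrite cabs1 mulr1.
apply/sqintP; split; first exact: mC_cst.
by rewrite /sqI cabs1 expr1n integral_cst// mul1e mu_finite.
Qed.

Lemma L2norm_le (f g : C -> C) (M : R) : sqint mu f -> sqint mu g -> 0 <= M ->
  (forall z, disk z -> cabs (f z) <= M * cabs (g z)) ->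
  L2norm (L2class mu f) <= M * L2norm (L2class mu g).
Proof.
move=> sf sg M0 fg.
rewrite -(ler_pXn2r (_ : 0 < 2)%N)// ?nnegrE ?mulr_ge0 ?L2norm_ge0//.
rewrite exprMn -lee_fin [X in (_ <= X)%E]EFinM !L2norm_class//; apply: sqI_le => //.
- by case/sqintP: sf.
- by case/sqintP: sg.
Qed.

Lemma mC_dilate (f : C -> C) : mC f -> mC (fun z => f (q%:C * z)).
Proof.
move=> mf; have [q0 q1] := andP hq.
have mqm : measurable_fun setT (fun z : C => q%:C * z).
  apply: (measurability (@open C)) => // _ [U oU <-]; rewrite setTI.
  by apply: sub_sigma_algebra; apply: open_dilate => //; rewrite !ltW.
by have [a b] := mf; split; [exact: (measurableT_comp a mqm)|exact: (measurableT_comp b mqm)].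
Qed.

(* The dilation by q maps the charged circle of index m to that of index m + 2. *)
Lemma sqI_dilate : exists2 K : R, 0 <= K & forall f : C -> C, mC f ->
  (sqI mu (fun z => f (q%:C * z)%R) <= K%:E * sqI mu f)%E.
Proof.
have [q0 q1] := andP hq; have [e e0 he] := cw_bounds hq.
(* K bounds the ratio of the weights of circles m and m + 2, at most q^m / (e q^(m+2)). *)
pose K := (e * q ^+ 2)^-1; have K0 : 0 <= K by rewrite invr_ge0 mulr_ge0 ?(ltW e0)// sqr_ge0.
exists K => // f mf.
have mfq := mC_dilate mf.
rewrite /sqI -ge0_integralZl//; last 2 first.
- exact: mC_sq.
- by move=> t _; rewrite lee_fin sqr_ge0.
have mKf : measurable_fun setT (fun x : C => (K%:E * (cabs (f x) ^+ 2)%:E)%E).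
  by apply: emeasurable_funM => //; exact: mC_sq.
have Kf0 z : (0 <= K%:E * (cabs (f z) ^+ 2)%:E)%E by rewrite -EFinM lee_fin mulr_ge0 ?sqr_ge0.
rewrite diskint; [|exact: mC_sq|by move=> z; rewrite lee_fin sqr_ge0].
rewrite diskint//.
pose b m := ((cw q m)%:E * cavg (fun z => K%:E * (cabs (f z) ^+ 2)%:E) (rad m))%E.
have b0 m : (0 <= b m)%E by rewrite mule_ge0 ?cavg_ge0// lee_fin cw_ge0.
apply: (@le_trans _ _ (\sum_(m <oo) b m.+2)%E).
  apply: lee_nneseries => m _ *.
    by rewrite mule_ge0 ?cavg_ge0 ?lee_fin ?cw_ge0// => z; rewrite lee_fin sqr_ge0.
  have radE t : q%:C * circle_map (rad m) t = circle_map (rad m.+2) t :> C.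
    rewrite !circle_mapE mulrA -rcM; congr (_%:C * _).
    by rewrite -addn2 exprD sqrtrM ?exprn_ge0 ?(ltW q0)// sqrtr_sqr gtr0_norm// mulrC.
  rewrite /b; set A := cavg _ _.
  have -> : A = cavg (fun z => (cabs (f z) ^+ 2)%:E) (rad m.+2).
    by rewrite /A /cavg; congr (_ * _)%E; apply: eq_integral => t _; rewrite radE.
  have -> : cavg (fun z => K%:E * (cabs (f z) ^+ 2)%:E)%E (rad m.+2) =
     (K%:E * cavg (fun z => (cabs (f z) ^+ 2)%:E) (rad m.+2))%E.
    rewrite /cavg muleCA; congr (_ * _)%E; rewrite ge0_integralZl//.
    - apply: measurable_funTS; apply: (measurableT_comp (mC_sq mf)) => //.
    - by move=> t _; rewrite lee_fin sqr_ge0.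
  rewrite [X in (_ <= X)%E]muleA; apply: lee_wpmul2r; first by apply: cavg_ge0 => z; rewrite lee_fin sqr_ge0.
  rewrite -EFinM lee_fin /K; have /andP[_ h1] := he m; have /andP[h2 _] := he m.+2.
  rewrite ler_pdivlMr ?mulr_gt0 ?exprn_gt0//; apply: le_trans h2.
  have -> : q ^+ m.+2 = q ^+ m * q ^+ 2 by rewrite -exprD addn2.
  by rewrite mulrCA ler_pM2l// ler_pM2r ?exprn_gt0.
exact: (@nneseries_shift b 2).
Qed.

(** On each circle the positive and the negative part have the same integral, so their series agree
    term by term. *)
Lemma diskint0 (u : C -> R) : measurable_fun setT u ->
  (forall m, {within `[0, 2 * pi], continuous (fun t => u (circle_map (rad m) t))}) ->
  (forall m, segint (fun t => u (circle_map (rad m) t)) 0 (2 * pi) = 0) ->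
  \int[mu]_z u z = 0.
Proof.
move=> mu_ cu u0; rewrite /Rintegral.
have mE : measurable_fun setT (EFin \o u) by exact/measurable_EFinP.
rewrite integralE !diskint//; [|exact: measurable_funeneg|exact: measurable_funepos].
suff -> : (\sum_(m <oo) (cw q m)%:E * cavg (EFin \o u)^\+ (rad m) =
  \sum_(m <oo) (cw q m)%:E * cavg (EFin \o u)^\- (rad m))%E.
  (* A common infinite value is harmless: [fine] of an infinite difference is 0. *)
  set S := (\sum_(_ <oo) _)%E; case: S => [r||]//=.
  by rewrite subrr.
apply: eq_eseriesr => m _; congr (_ * _)%E; rewrite /cavg; congr (_ * _)%E.
pose v (t : R) := u (circle_map (rad m) t).
have iv : leb.-integrable `[0, 2 * pi] (EFin \o v) by exact: (cts_integrable (cu m)).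
have := u0 m; rewrite /segint /Rintegral -/v integralE.
have p1 : (\int[leb]_(t in `[0%R, (2 * pi)%R]) (EFin \o v)^\+ t \is a fin_num)%E.
  exact: integrable_pos_fin_num.
have p2 : (\int[leb]_(t in `[0%R, (2 * pi)%R]) (EFin \o v)^\- t \is a fin_num)%E.
  exact: integrable_neg_fin_num.
rewrite fineB// => /eqP; rewrite subr_eq0 => /eqP h.
have {}h : (\int[leb]_(t in `[0%R, (2 * pi)%R]) (EFin \o v)^\+ t =
   \int[leb]_(t in `[0%R, (2 * pi)%R]) (EFin \o v)^\- t)%E by rewrite -(fineK p1) -(fineK p2) h.
by etransitivity; [|etransitivity; [exact: h|]]; apply: eq_integral => t _; rewrite ?funeposE ?funenegE.
Qed.

End integrals.

End disk_measure_theory.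

(** * Inner products of monomials with holomorphic multiples of monomials *)

Section disk_L2.
Context (R : realType) (q : R).
Hypothesis hq : 0 < q < 1.
Local Notation C := R[i].
Local Notation cabs := (@ComplexField.Normc.normc R).
Local Notation Re := complex.Re.
Local Notation Im := complex.Im.
Local Notation mu := (disk_measure q).
Local Notation L2mu := (L2 mu).
Local Notation rad m := (Num.sqrt (q ^+ m)).
Implicit Types (f g : C -> C) (x y : L2mu).

Lemma mC_exp n : mC (fun z : C => z ^+ n).
Proof.
elim: n => [|n IH]; first by under eq_fun do rewrite expr0; exact: mC_cst.
by under eq_fun do rewrite exprS; exact: (mCM (mC_id _) IH).
Qed.

Lemma disk_exp (z : C) n : disk z -> cabs (z ^+ n) <= 1.
Proof. by rewrite diskE cabsX => z1; rewrite exprn_ile1// cabs_ge0. Qed.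

Lemma sqint_exp n : sqint mu (fun z => z ^+ n).
Proof. by apply: (sqint_bdd hq (mC_exp n) ler01) => z; exact: disk_exp. Qed.

Lemma cintB (g1 g2 : R -> C) : cts g1 -> cts g2 ->
  cint (fun t => g1 t - g2 t) = cint g1 - cint g2.
Proof.
move=> c1 c2; apply/eqP; rewrite eq_complex /cint/=.
apply/andP; split; apply/eqP.
  rewrite -segintB; [|exact: cts_Re..].
  by apply: eq_Rintegral => t _; case: (g1 t) (g2 t) => ? ? [].
rewrite -segintB; [|exact: cts_Im..].
by apply: eq_Rintegral => t _; case: (g1 t) (g2 t) => ? ? [].
Qed.

Lemma cint_cst (K : C) : cint (fun=> K) = (2 * pi)%:C * K.
Proof.
rewrite /cint !segint_cst ?mulr_ge0 ?pi_ge0//.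
by case: K => a b; apply/eqP; rewrite eq_complex/=; apply/andP; split; apply/eqP; ring.
Qed.

Lemma pdot_circle0 f g : mC f -> mC g ->
  (forall m, cts (fun t => (f ((rad m)%:C * cis t))^*%C * g ((rad m)%:C * cis t))) ->
  (forall m, cint (fun t => (f ((rad m)%:C * cis t))^*%C * g ((rad m)%:C * cis t)) = 0) ->
  pdot mu f g = 0.
Proof.
move=> mf mg cc c0; have [mr mi] := mCM (mCJ mf) mg.
have E m (F : C -> R) : (fun t => F ((f (circle_map (rad m) t))^*%C * g (circle_map (rad m) t))) =
    (fun t => F ((f ((rad m)%:C * cis t))^*%C * g ((rad m)%:C * cis t))).
  by apply/funext => t; rewrite circle_mapE.
apply/eqP; rewrite eq_complex/=; apply/andP; split; apply/eqP.
  apply: (diskint0 mr) => m; rewrite (E m (@complex.Re R)); first exact: cts_Re (cc m).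
  by have [+ _] := c0 m.
apply: (diskint0 mi) => m; rewrite (E m (@complex.Im R)); first exact: cts_Im (cc m).
by have [_ +] := c0 m.
Qed.

Lemma cisX t n : cis t ^+ n = cis (n%:R * t) :> C.
Proof.
elim: n => [|n IH]; first by rewrite expr0 mul0r cis0.
by rewrite exprS IH -cisD -natr1 mulrDl mul1r addrC.
Qed.

Lemma conjX (z : C) n : (z ^+ n)^*%C = (z^*%C) ^+ n.
Proof. by elim: n => [|n IH]; rewrite ?expr0 ?conjc1// !exprS conjM IH. Qed.

Lemma rcX (r : R) n : (r ^+ n)%:C = r%:C ^+ n.
Proof. exact: rmorphXn. Qed.

(** The positive frequency l - k is written as a successor to fit [fcoef_neg]; [circle_dot_ge] fits
    [fcoef_pos]. *)
Lemma circle_dot_lt f r k l t : (k < l)%N ->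
  ((r%:C * cis t) ^+ k)^*%C * (f (r%:C * cis t) * (r%:C * cis t) ^+ l) =
  (r ^+ (k + l))%:C * (f (r%:C * cis t) * cis ((l - k.+1).+1%:R * t)).
Proof.
move=> kl; rewrite !exprMn conjM -!rcX conjc_real !cisX -cisN exprD rcM.
rewrite (_ : cis (_.+1%:R * t) = cis (- (k%:R * t)) * cis (l%:R * t)); first by ring.
by rewrite -cisD subnSK// natrB ?(ltnW kl)//; congr cis; ring.
Qed.

Lemma circle_dot_ge f r k l t : (l <= k)%N ->
  ((r%:C * cis t) ^+ k)^*%C * (f (r%:C * cis t) * (r%:C * cis t) ^+ l) =
  (r ^+ (k + l))%:C * (f (r%:C * cis t) * cis ((- (k - l)%:R) * t)).
Proof.
move=> kl; rewrite !exprMn conjM -!rcX conjc_real !cisX -cisN exprD rcM.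
rewrite (_ : cis (- _ * t) = cis (- (k%:R * t)) * cis (l%:R * t)); first by ring.
by rewrite -cisD natrB//; congr cis; ring.
Qed.

Let rad0 m : 0 <= rad m <= 1.
Proof. by have /andP[/ltW -> ->] := rad01 hq m. Qed.

Lemma patchE f z : disk z -> patch (fun=> 0) (@disk R) f z = f z.
Proof. by move=> Dz; rewrite /patch mem_set. Qed.

Lemma ctsZ (k : C) (g : R -> C) : cts g -> cts (fun t => k * g t).
Proof. by move=> cg; apply: ctsM => //; exact: cts_cst. Qed.

Let mfl f l : {within @disk R, continuous f} ->
  mC (fun z => patch (fun=> 0) (@disk R) f z * z ^+ l).
Proof. by move=> cf; exact: mCM (mC_patch cf) (mC_exp l). Qed.

Lemma hol_pdot_lt f k l : HolD f -> (k < l)%N ->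
  pdot mu (fun z => z ^+ k) (fun z => patch (fun=> 0) (@disk R) f z * z ^+ l) = 0.
Proof.
move=> [cf hf] kl.
have hf' z : cabs z < 1 -> exists d, cder f z d.
  by move=> z1; apply/derivable_cder/hf; rewrite cnormE ltcR.
have E m : (fun t => (((rad m)%:C * cis t) ^+ k)^*%C *
    (patch (fun=> 0) (@disk R) f ((rad m)%:C * cis t) * ((rad m)%:C * cis t) ^+ l)) =
    (fun t => (rad m ^+ (k + l))%:C * (f ((rad m)%:C * cis t) * cis ((l - k.+1).+1%:R * t))).
  by apply/funext => t; rewrite patchE ?circle_dot_lt//; exact: disk_cis.
apply: pdot_circle0 => [||m|m]; [exact: mC_exp|exact: mfl| |]; rewrite E.
  by apply: ctsZ; exact: cts_circle.
rewrite cintZ; last exact: cts_circle.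
by rewrite -/(fcoef f (rad m) _) fcoef_neg ?mulr0//; exact: rad01.
Qed.

(** On the circle of radius r the mean of conj(z)^k f(z) z^l is r^(k+l) r^(k-l) = r^(2k) times the
    Taylor coefficient, i.e. that coefficient times the mean of |z^k|^2. Hence f z^l minus the
    multiple of z^k is orthogonal to z^k circle by circle, whatever the weights. *)
Lemma hol_pdot_coef f (c : nat -> C) : {within @disk R, continuous f} ->
  (forall n (r : R), 0 < r <= 1 -> fcoef f r (- n%:R) = (r ^+ n)%:C * c n) ->
  forall k l, (l <= k)%N ->
  pdot mu (fun z => z ^+ k) (fun z => patch (fun=> 0) (@disk R) f z * z ^+ l) =
  c (k - l)%N / (2 * pi)%:C * pdot mu (fun z => z ^+ k) (fun z => z ^+ k).
Proof.
move=> cf hc k l lk; pose c' n := c n / (2 * pi)%:C; rewrite -/(c' _).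
pose F z := patch (fun=> 0) (@disk R) f z * z ^+ l.
have Fb : exists2 M : R, 0 <= M & forall z, disk z -> cabs (F z) <= M.
  have [M M0 hM] := disk_bounded cf; exists M => // z Dz.
  rewrite /F patchE// cabsM -[M]mulr1; apply: ler_pM; rewrite ?cabs_ge0//; first exact: hM.
  exact: disk_exp.
have sF : sqint mu F by have [M M0 hM] := Fb; apply: (sqint_bdd hq (mfl l cf) M0 hM).
have sk := sqint_exp k.
have FE : F = (fun z => c' (k - l)%N * z ^+ k + (F z - c' (k - l)%N * z ^+ k)).
  by apply/funext => z; ring.
transitivity (pdot mu (fun z => z ^+ k) F); first by [].
rewrite [in LHS]FE pdot_linear//; last exact: sqintB (sqintZ _ sk).
rewrite [X in _ + X](_ : _ = 0) ?addr0//.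
have Er r t : r%:C * cis t = r%:C * cis t :> C by [].
have E m : (fun t => (((rad m)%:C * cis t) ^+ k)^*%C *
    (F ((rad m)%:C * cis t) - c' (k - l)%N * ((rad m)%:C * cis t) ^+ k)) =
    (fun t => (rad m ^+ (k + l))%:C * (f ((rad m)%:C * cis t) * cis ((- (k - l)%:R) * t)) -
      (c' (k - l)%N) * (rad m ^+ (k + k))%:C).
  apply/funext => t; rewrite mulrBr /F patchE ?circle_dot_ge//; last exact: disk_cis.
  congr (_ - _); rewrite mulrCA; congr (_ * _).
  have := @circle_dot_ge (fun=> 1) (rad m) k k t (leqnn k).
  by rewrite !mul1r subnn oppr0 mul0r cis0 mulr1.
apply: pdot_circle0 => [||m|m].
- exact: mC_exp.
- by have [] := iffLR (sqintP mu _) (sqintB sF (sqintZ (c' (k - l)%N) sk)).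
- rewrite E; have h1 := ctsZ (rad m ^+ (k + l))%:C (@cts_circle _ f (- (k - l)%:R) _ cf (rad0 m)).
  move=> t e e0; have [d d0 hd] := h1 t e e0; exists d => // t' /hd.
  by congr (cabs _ <= _); ring.
- pose G t := f ((rad m)%:C * cis t) * cis ((- (k - l)%:R) * t).
  have cG : cts G := @cts_circle R f (- (k - l)%:R) (rad m) cf (rad0 m).
  pose K := c' (k - l)%N * (rad m ^+ (k + k))%:C.
  have -> : cint (fun t => (((rad m)%:C * cis t) ^+ k)^*%C *
    (F ((rad m)%:C * cis t) - c' (k - l)%N * ((rad m)%:C * cis t) ^+ k)) =
    (rad m ^+ (k + l))%:C * cint G - (2 * pi)%:C * K.
    by rewrite -cintZ// -cint_cst -cintB ?E//; [exact: ctsZ|exact: cts_cst].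
  have -> : cint G = (rad m ^+ (k - l))%:C * c (k - l)%N by apply: hc; exact: rad01.
  rewrite /K.
  have -> : (rad m ^+ (k + k))%:C = (rad m ^+ (k + l))%:C * (rad m ^+ (k - l))%:C :> C.
    by rewrite -rcM -exprD -addnA subnKC.
  have : (2 * pi)%:C != 0 :> C by rewrite -cabs_gt0 cabsR normr_gt0 gt_eqF// twopi_gt0.
  rewrite /c'; move: (2 * pi)%:C (_ ^+ (k + l))%:C (_ ^+ (k - l))%:C (c _) => a b d e a0.
  by field.
Qed.

Lemma dil_HolD f (r : R) : 0 < r <= 1 -> HolD f -> HolD (fun w => f (r%:C * w)).
Proof.
move=> /andP[r0 r1] [/within_cabsP cf hf]; split.
  have Dr w : disk w -> disk (r%:C * w).
    by rewrite !diskE cabsM cabsR ger0_norm ?(ltW r0)// => w1; rewrite mulr_ile1// ?cabs_ge0 ?(ltW r0).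
  apply/within_cabsP => p Dp e1 /(cf _ (Dr _ Dp))[d d0 hd]; exists d => // w Dw wp.
  apply: hd; first exact: Dr.
  rewrite -mulrBr cabsM cabsR ger0_norm ?(ltW r0)//; apply: le_lt_trans wp.
  by rewrite ler_piMl// cabs_ge0.
move=> w w1; apply/derivable_cder.
have w1' : `|r%:C * w + 0| < 1.
  rewrite cnormE ltcR in w1; rewrite cnormE ltcR addr0 cabsM cabsR ger0_norm ?(ltW r0)//.
  by apply: le_lt_trans w1; rewrite ler_piMl// cabs_ge0.
have [d hd] := iffLR (derivable_cder f (r%:C * w + 0)) (hf _ w1').
exists (d * r%:C); have := cder_comp (cder_lin r%:C 0 w) hd; congr (cder _ _ _).
by apply/funext => u /=; rewrite addr0.
Qed.

(** A single sequence, the Taylor coefficients of f, serves all dilations f(r .). Both the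
    commutation with j and the injectivity of f -> T(f) depend on this. *)
Lemma hol_pdot_ge f : HolD f -> exists c : nat -> C, forall r : R, 0 < r <= 1 -> forall k l, (l <= k)%N ->
  pdot mu (fun z => z ^+ k) (fun z => patch (fun=> 0) (@disk R) (fun w => f (r%:C * w)) z * z ^+ l) =
  (r ^+ (k - l))%:C * c (k - l)%N * pdot mu (fun z => z ^+ k) (fun z => z ^+ k).
Proof.
move=> hf0; have [cf hf] := hf0.
have hf' z : cabs z < 1 -> exists d, cder f z d.
  by move=> z1; apply/derivable_cder/hf; rewrite cnormE ltcR.
have [c hc] := choice (fcoef_pos cf hf').
exists (fun n => c n / (2 * pi)%:C) => r r01 k l lk.
have [cd _] := dil_HolD r01 hf0.
have hd n (s : R) : 0 < s <= 1 -> fcoef (fun w => f (r%:C * w)) s (- n%:R) =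
    (s ^+ n)%:C * ((r ^+ n)%:C * c n).
  move=> s01; have rs : 0 < r * s <= 1.
    move: r01 s01 => /andP[r0 r1] /andP[s0 s1].
    by rewrite mulr_gt0//= mulr_ile1// ltW.
  rewrite mulrA -rcM -exprMn [s * r]mulrC -hc// /fcoef; congr cint.
  by apply/funext => t; rewrite rcM mulrA.
by rewrite (hol_pdot_coef cd hd lk) mulrA.
Qed.

End disk_L2.

(** * Multiplication operators on L2 and norms of monomials *)

Section multiplication_operators.
Context (R : realType) (q : R).
Hypothesis hq : 0 < q < 1.
Local Notation C := R[i].
Local Notation cabs := (@ComplexField.Normc.normc R).
Local Notation mu := (disk_measure q).
Local Notation L2mu := (L2 mu).
Local Notation rad m := (Num.sqrt (q ^+ m)).
Local Notation pd f := (patch (fun=> 0) (@disk R) f).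
Implicit Types (f g : C -> C) (x y : L2mu).

Lemma ae_and (P Q : C -> Prop) : {ae mu, forall z, P z} -> {ae mu, forall z, Q z} ->
  {ae mu, forall z, P z /\ Q z}.
Proof. by apply: filterS2 => z. Qed.

Lemma sqint_mul f x : {within @disk R, continuous f} ->
  sqint mu (fun z => pd f z * repr x z).
Proof.
move=> cf; have [M M0 hM] := disk_bounded cf.
apply: (sqint_le hq (mCM (mC_patch cf) (reprmC x)) M0 _ (repr_sqint x)) => z Dz.
by rewrite cabsM ler_wpM2r ?cabs_ge0// patchE//; exact: hM.
Qed.

Lemma repr_mulop f x : {within @disk R, continuous f} ->
  (repr (mulop f x) : C -> C) = (fun z => f z * repr x z) %[ae mu].
Proof.
move=> cf; have h := repr_L2class (sqint_mul x cf).
by move: h (ae_disk hq); apply: filterS2 => z /(_ I) -> Dz _; rewrite patchE.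
Qed.

Lemma mulopP f x y : {within @disk R, continuous f} ->
  (repr y : C -> C) = (fun z => f z * repr x z) %[ae mu] -> mulop f x = y.
Proof.
move=> cf h; apply: L2_eq; have := repr_mulop x cf; move: h.
by apply: filterS2 => z /(_ I) -> /(_ I) ->.
Qed.

Lemma mulop_linear f (a : C) x y : {within @disk R, continuous f} ->
  mulop f (a *: x + y) = a *: mulop f x + mulop f y.
Proof.
move=> cf; apply: mulopP => //.
have := ae_and (reprD (a *: x) y) (ae_and (reprZ a x) (ae_and (reprD (a *: mulop f x) (mulop f y))
  (ae_and (reprZ a (mulop f x)) (ae_and (repr_mulop x cf) (repr_mulop y cf))))).
have alg (b c d e : C) : b * (c * d) + b * e = b * (c * d + e) by rewrite mulrDr.
apply: filterS => z [e1 [e2 [e3 [e4 [e5 e6]]]]] _.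
apply: etrans (etrans (e3 I) (congr2 +%R (etrans (e4 I) (congr1 ( *%R a) (e5 I))) (e6 I))) _.
apply/esym; apply: etrans (congr1 ( *%R (f z)) (etrans (e1 I) (congr1 (+%R^~ _) (e2 I)))) _.
by apply: etrans (esym (alg _ _ _ _)) _; congr (_ + _); exact: mulrCA.
Qed.

Lemma mulop_eq f g x : (forall z, disk z -> f z = g z) -> mulop f x = mulop g x.
Proof.
move=> fg; rewrite /mulop; congr L2class; apply/funext => z; congr (_ * _).
by rewrite /patch; case: ifPn => // /set_mem; exact: fg.
Qed.

Lemma mulopD f g x : {within @disk R, continuous f} -> {within @disk R, continuous g} ->
  mulop (fun z => f z + g z) x = mulop f x + mulop g x.
Proof.
move=> cf cg; apply: mulopP; first by move=> z; apply: cvgD; [exact: cf|exact: cg].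
have := ae_and (reprD (mulop f x) (mulop g x)) (ae_and (repr_mulop x cf) (repr_mulop x cg)).
apply: filterS => z [/(_ I) e1 [/(_ I) e2 /(_ I) e3]] _.
by rewrite e1 e2 e3; exact/esym/mulrDl.
Qed.

Lemma within_mul f g : {within @disk R, continuous f} -> {within @disk R, continuous g} ->
  {within @disk R, continuous (fun z => f z * g z)}.
Proof.
move=> cf cg; apply/within_cabsP => p Dp e e0.
have [M M0 hM] := disk_bounded cf; have [K K0 hK] := disk_bounded cg.
have MK0 : 0 < M + K + 1 by rewrite ltr_wpDl// addr_ge0.
have e10 : 0 < e / (M + K + 1) by rewrite divr_gt0.
have [d1 d10 h1] := iffLR (within_cabsP _ _) cf p Dp _ e10.
have [d2 d20 h2] := iffLR (within_cabsP _ _) cg p Dp _ e10.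
exists (Num.min d1 d2); first by rewrite lt_min d10.
move=> w Dw; rewrite lt_min => /andP[/(h1 _ Dw) H1 /(h2 _ Dw) H2].
have -> : f w * g w - f p * g p = f w * (g w - g p) + (f w - f p) * g p by ring.
apply: le_trans (cabsD _ _) _; rewrite !cabsM.
have H3 : cabs (f w) * cabs (g w - g p) <= M * (e / (M + K + 1)).
  by apply: ler_pM; rewrite ?cabs_ge0//; exact: hM.
have H4 : cabs (f w - f p) * cabs (g p) <= e / (M + K + 1) * K.
  by apply: ler_pM; rewrite ?cabs_ge0//; exact: hK.
apply: le_trans (lerD H3 H4) _; rewrite mulrC -mulrDr -[leRHS](divfK (lt0r_neq0 MK0)).
by rewrite ler_pM2l// lerDl.
Qed.

Lemma within_cst (a : C) : {within @disk R, continuous (fun=> a)}.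
Proof. by apply/within_cabsP => p _ e e0; exists 1 => // w _ _; rewrite subrr cabs0 ltW. Qed.

Lemma mulopZ f (a : C) x : {within @disk R, continuous f} ->
  mulop (fun z => a * f z) x = a *: mulop f x.
Proof.
move=> cf; apply: mulopP.
  exact: (@within_mul (fun=> a) f (@within_cst a) cf).
have := ae_and (reprZ a (mulop f x)) (repr_mulop x cf).
by apply: filterS => z [/(_ I) -> /(_ I) ->] _; exact: mulrA.
Qed.

Lemma mulop1 x : mulop (fun=> 1) x = x.
Proof.
apply: mulopP; first exact: (@within_cst 1).
by apply: filterE => z _; exact/esym/mul1r.
Qed.

Lemma mulop_norm f (M : R) x : {within @disk R, continuous f} -> 0 <= M ->
  (forall z, disk z -> cabs (f z) <= M) -> L2norm (mulop f x) <= M * L2norm x.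
Proof.
move=> cf M0 hM; rewrite -[in leRHS](L2class_repr x); apply: (L2norm_le hq) => //.
- exact: sqint_mul.
- exact: repr_sqint.
- by move=> z Dz; rewrite cabsM patchE// ler_wpM2r ?cabs_ge0//; exact: hM.
Qed.

Lemma within_conj f : {within @disk R, continuous f} ->
  {within @disk R, continuous (fun z => (f z)^*%C)}.
Proof.
move=> /within_cabsP cf; apply/within_cabsP => p Dp e /(cf p Dp)[d d0 hd].
by exists d => // w Dw /(hd w Dw); rewrite -conjB cabsJ.
Qed.

Lemma adj_alg (a b c : C) : a^*%C * (b * c) = (b^*%C * a)^*%C * c.
Proof. by rewrite conjM conjcK; ring. Qed.

Lemma mulop_adj f x y : {within @disk R, continuous f} ->
  L2dot y (mulop f x) = L2dot (mulop (fun z => (f z)^*%C) y) x.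
Proof.
move=> cf; have cj := within_conj cf.
have s1 := sqint_mul x cf; have s2 := sqint_mul y cj.
rewrite -[in LHS](L2class_repr y) -[x in RHS](L2class_repr x) /mulop.
rewrite !L2dotE ?L2class_repr//; [|exact: repr_sqint..].
have P z : (repr y z)^*%C * (pd f z * repr x z) =
    (pd (fun z => (f z)^*%C) z * repr y z)^*%C * repr x z.
  rewrite /patch; case: ifP => _; first exact: adj_alg.
  by rewrite !mul0r conj0 mul0r mulr0.
by rewrite /pdot; congr (_ +i* _); apply: eq_Rintegral => z _; rewrite P.
Qed.

Local Notation mono := (monomial q).

Lemma sqint_pmono f l : {within @disk R, continuous f} -> sqint mu (fun z => pd f z * z ^+ l).
Proof.
move=> cf; have [M M0 hM] := disk_bounded cf.
apply: (sqint_bdd hq (mCM (mC_patch cf) (mC_exp R l)) M0) => z Dz.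
rewrite patchE// cabsM -[M]mulr1; apply: ler_pM; rewrite ?cabs_ge0 ?disk_exp//.
exact: hM.
Qed.

Lemma mulop_mono f l : {within @disk R, continuous f} ->
  mulop f (mono l) = L2class mu (fun z => pd f z * z ^+ l).
Proof.
move=> cf; apply: mulopP => //.
have s := sqint_pmono l cf.
have := ae_and (repr_L2class s) (ae_and (repr_L2class (sqint_exp hq l)) (ae_disk hq)).
by apply: filterS => z [/(_ I) -> [/(_ I) -> Dz]] _; rewrite patchE.
Qed.

Lemma HolD_cst c : HolD (fun=> c : C).
Proof.
split; first exact: (@within_cst c).
by move=> z _; apply/derivable_cder; exists 0; exact: cder_cst.
Qed.

Lemma hol_dot_lt f k l : HolD f -> (k < l)%N -> L2dot (mono k) (mulop f (mono l)) = 0.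
Proof.
move=> hf kl; have [cf _] := hf; rewrite mulop_mono// L2dotE; [exact: hol_pdot_lt|exact: sqint_exp|].
exact: sqint_pmono.
Qed.

Lemma hol_dot_ge f : HolD f -> exists c : nat -> C, forall r : R, 0 < r <= 1 ->
  forall k l, (l <= k)%N -> L2dot (mono k) (mulop (fun z => f (r%:C * z)) (mono l)) =
    (r ^+ (k - l))%:C * c (k - l)%N * L2dot (mono k) (mono k).
Proof.
move=> hf; have [c hc] := hol_pdot_ge hq hf; exists c => r r01 k l lk.
have [cf _] := dil_HolD r01 hf.
rewrite mulop_mono// !L2dotE ?hc//; [exact: sqint_exp..|].
exact: sqint_pmono.
Qed.

Definition rho n : R := L2norm (mono n).

Lemma mono_dot k l : L2dot (mono k) (mono l) = if k == l then (rho k ^+ 2)%:C else 0.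
Proof.
have lt i j : (i < j)%N -> L2dot (mono i) (mono j) = 0.
  by move=> ij; have := hol_dot_lt (HolD_cst 1) ij; rewrite mulop1.
case: (ltngtP k l) => [/lt//|/lt kl|->]; last by rewrite L2dotxx.
by rewrite L2dotC kl conjc0.
Qed.

Lemma rho_dec n : rho n.+1 <= rho n.
Proof.
rewrite /rho -[leRHS]mul1r; apply: (L2norm_le hq) => //; try exact: sqint_exp.
move=> z; rewrite diskE => z1; rewrite mul1r !cabsX exprS ler_piMl// exprn_ge0//.
exact: cabs_ge0.
Qed.

(** The term m = 0 of the series is the unit circle, where |z^n| = 1, and its weight alone is at
    least e. *)
Lemma rho_lb : exists2 c : R, 0 < c & forall n, c <= rho n.
Proof.
have [e e0 he] := cw_bounds hq.
exists (Num.sqrt e) => [|n]; first by rewrite sqrtr_gt0.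
rewrite -(ler_pXn2r (_ : 0 < 2)%N)// ?nnegrE ?sqrtr_ge0 ?L2norm_ge0//.
rewrite sqr_sqrtr ?(ltW e0)// -lee_fin L2norm_class; last exact: sqint_exp.
rewrite /sqI diskint//; last 2 first.
- exact: mC_sq (mC_exp R n).
- by move=> z; rewrite lee_fin sqr_ge0.
apply: le_trans (nneseries_lim_ge (m := 0) 1 _); last first.
  by move=> *; rewrite mule_ge0 ?lee_fin ?cw_ge0// cavg_ge0// => z; rewrite lee_fin sqr_ge0.
rewrite big_nat1 expr0 sqrtr1.
rewrite (_ : cavg _ _ = 1%:E); last first.
  transitivity (cavg (fun=> 1%:E) 1 : \bar R); last exact: cavg_cst.
  apply: eq_cavg => t.
  by rewrite circle_mapE mul1r cabsX cabs_cis !expr1n.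
by rewrite mule1 lee_fin; have := he 0%N; rewrite expr0 mulr1 => /andP[].
Qed.

End multiplication_operators.

Arguments conjc : simpl never.

(** * Fourier series in L2 and the projection onto the Hardy space *)

Section orthonormal_expansion.
Context (R : realType) (q : R).
Hypothesis hq : 0 < q < 1.
Local Notation C := R[i].
Local Notation cabs := (@ComplexField.Normc.normc R).
Local Notation mu := (disk_measure q).
Local Notation L2mu := (L2 mu).
Local Notation mono := (monomial q).
Implicit Types (x y : L2mu) (a : nat -> C).

Lemma rho_gt0 n : 0 < rho q n.
Proof. by have [c c0 hc] := rho_lb hq; exact: lt_le_trans (hc n). Qed.

Definition en n : L2mu := ((rho q n)^-1)%:C *: mono n.

Lemma en_dot k l : L2dot (en k) (en l) = (k == l)%:R.
Proof.
rewrite /en L2dotZl L2dotZr mono_dot// conjc_real; case: eqVneq => [<-|_]; last by rewrite !mulr0.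
by rewrite -!rcM mulrA -invfM -expr2 mulVf// expf_neq0// gt_eqF// rho_gt0.
Qed.

Lemma mono_en n : mono n = (rho q n)%:C *: en n.
Proof. by rewrite /en scalerA -rcM divff ?scale1r// gt_eqF// rho_gt0. Qed.

Lemma en_dot_sum a k N M : L2dot (en k) (\sum_(N <= j < M) a j *: en j) =
  if (N <= k < M)%N then a k else 0.
Proof.
rewrite L2dot_sumr; under eq_bigr do rewrite L2dotZr en_dot.
case: ifP => h.
  rewrite (bigD1_seq k) ?mem_index_iota ?iota_uniq//= eqxx mulr1 big1 ?addr0//.
  by move=> j; rewrite eq_sym => /negPf ->; rewrite mulr0.
rewrite big_nat_cond big1// => j; rewrite andbT => hj.
by case: eqVneq => [kj|_]; rewrite ?mulr0//; rewrite kj hj in h.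
Qed.

Lemma norm_sum_en a N M : L2norm (\sum_(N <= j < M) a j *: en j) ^+ 2 =
  \sum_(N <= j < M) cabs (a j) ^+ 2.
Proof.
have [MN|] := leqP M N; first by rewrite !big_geq// L2norm0 expr0n.
move=> /ltnW/subnKC <-; elim: (M - N)%N => [|n IH].
  by rewrite addn0 !big_geq// L2norm0 expr0n.
rewrite addnS !big_nat_recr ?leq_addr//= pythagoras.
  rewrite IH L2normZr exprMn; congr (_ + _).
  have := L2dotxx (en (N + n)); rewrite en_dot eqxx => -[<-].
  by rewrite mulr1.
by rewrite L2dotC L2dotZl en_dot_sum ltnn andbF mulr0 conj0.
Qed.

Definition proj_sum x N := \sum_(0 <= j < N) L2dot (en j) x *: en j.

Lemma bessel x N : \sum_(0 <= j < N) cabs (L2dot (en j) x) ^+ 2 <= L2norm x ^+ 2.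
Proof.
rewrite -norm_sum_en; apply: norm_le_ortho.
rewrite L2dotC L2dot_sumr big_nat_cond big1 ?conj0// => j; rewrite andbT => hj.
by rewrite L2dotZr [L2dot (_ - _) _]L2dotC L2dotBr en_dot_sum hj subrr conj0 mulr0.
Qed.

Lemma L2normB_sum x M N : (N <= M)%N -> L2norm (proj_sum x M - proj_sum x N) ^+ 2 =
  \sum_(0 <= j < M) cabs (L2dot (en j) x) ^+ 2 - \sum_(0 <= j < N) cabs (L2dot (en j) x) ^+ 2.
Proof.
move=> NM; rewrite /proj_sum (big_cat_nat (leq0n N) NM)//= addrAC subrr add0r norm_sum_en.
by rewrite [in RHS](big_cat_nat (leq0n N) NM)//= addrAC subrr add0r.
Qed.

Lemma proj_sum_cvg x : exists l, forall e : R, 0 < e -> exists N, forall n, (N <= n)%N ->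
  L2norm (proj_sum x n - l) <= e.
Proof.
apply: L2complete => e e0.
pose b N := \sum_(0 <= j < N) cabs (L2dot (en j) x) ^+ 2.
have bnd : cvgn b.
  apply: nondecreasing_is_cvgn.
    by apply/nondecreasing_seqP => n; rewrite /b big_nat_recr//= lerDl sqr_ge0.
  by exists (L2norm x ^+ 2) => _ [n _ <-]; exact: bessel.
have /cvgrPdist_le/(_ (e ^+ 2 / 2) ltac:(by rewrite divr_gt0// exprn_gt0))[N _ hN] := bnd.
have h (m n : nat) : (N <= n)%N -> (n <= m)%N -> L2norm (proj_sum x m - proj_sum x n) <= e.
  move=> Nn nm; rewrite -(ler_pXn2r (_ : 0 < 2)%N)// ?nnegrE ?L2norm_ge0 ?(ltW e0)//.
  rewrite L2normB_sum// -/(b m) -/(b n).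
  have := hN n Nn; have := hN m (leq_trans Nn nm); rewrite /= !ler_norml.
  by move=> /andP[? ?] /andP[? ?]; lra.
exists N => m n Nm Nn; have [nm|/ltnW mn] := leqP n m; first exact: h.
by rewrite L2distC; exact: h.
Qed.

Lemma ball_L2 x y (e : R) : ball x e%:C y = (L2norm (x - y) < e) :> Prop.
Proof. by rewrite -ball_normE/= -[`|_|]/((L2norm _)%:C) ltcR. Qed.

Lemma cspanP x : reflect (forall e : R, 0 < e -> exists2 y, finspan mono y & L2norm (x - y) < e)
  (x \in cspan mono).
Proof.
apply: (iffP idP) => [/asboolP cx e e0|h].
  have [y [fy]] := cx _ (nbhsx_ballx x e%:C ltac:(by rewrite ltcR)).
  by rewrite ball_L2 => xy; exists y.
apply/asboolP => B /nbhs_ballP[_ /gt0_complex[e e0 ->] eB].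
by have [y fy xy] := h e e0; exists y; split => //; apply: eB; rewrite ball_L2.
Qed.

Lemma cspan_lim x : (forall e : R, 0 < e -> exists2 y, y \in cspan mono & L2norm (x - y) <= e) ->
  x \in cspan mono.
Proof.
move=> h; apply/cspanP => e e0; have e30 : 0 < e / 3 by rewrite divr_gt0.
have [y /cspanP/(_ _ e30)[z fz yz] xy] := h _ e30; exists z => //.
apply: le_lt_trans (L2dist _ _ y) _; apply: le_lt_trans (lerD xy (ltW yz)) _.
by clear -e0; lra.
Qed.

Lemma mono_cspan n : mono n \in cspan mono.
Proof.
apply/cspanP => e e0; exists (mono n); last by rewrite subrr L2norm0.
exists n.+1, (fun i => (i == n)%:R); rewrite big_ord_recr/= eqxx scale1r big1 ?add0r// => i _.
by rewrite (ltn_eqF (ltn_ord i)) scale0r.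
Qed.

Lemma en_cspan n : en n \in cspan mono.
Proof. by apply: rpredZ; exact: mono_cspan. Qed.

Lemma ortho_cspan x : (forall n, L2dot (mono n) x = 0) -> forall y, y \in cspan mono ->
  L2dot y x = 0.
Proof.
move=> h y /cspanP cy; apply/eqP; rewrite -cabs_eq0 eq_le cabs_ge0 andbT.
have K0 : 0 < L2norm x + 1 by rewrite ltr_wpDl// L2norm_ge0.
apply/ler_addgt0Pl => e e0; rewrite addr0.
have [z [n [c ->]] yz] := cy _ (divr_gt0 e0 K0).
have -> : L2dot y x = L2dot (y - \sum_(i < n) c i *: mono i) x.
  rewrite L2dotBl [X in _ - X](_ : _ = 0) ?subr0//.
  rewrite L2dotC L2dot_sumr big1 ?conj0// => i _.
  by rewrite L2dotZr L2dotC h conj0 mulr0.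
apply: le_trans (cauchy_schwarz _ _) _.
apply: (@le_trans _ _ (e / (L2norm x + 1) * (L2norm x + 1))); last by rewrite divfK// gt_eqF.
by apply: ler_pM; rewrite ?L2norm_ge0 ?(ltW yz)// lerDl.
Qed.

(** [proj] is picked by [xget], so it has meaning only once a projection exists: the limit of the
    Fourier partial sums, convergent by Bessel's inequality. *)
Lemma proj_ex x : exists h : hardy q, forall k : hardy q, L2dot (val k) (x - val h) = 0.
Proof.
have [l hl] := proj_sum_cvg x.
have lH : l \in cspan mono.
  apply: cspan_lim => e /hl[N /(_ N (leqnn _)) h]; exists (proj_sum x N); last by rewrite L2distC.
  by apply: rpred_sum => i _; apply: rpredZ; exact: en_cspan.
exists (Hardy lH) => -[k kH] /=; apply: ortho_cspan => // n.
apply/eqP; rewrite -cabs_eq0 eq_le cabs_ge0 andbT.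
apply/ler_addgt0Pl => e e0; rewrite addr0.
have [N hN] := hl _ (divr_gt0 e0 (rho_gt0 n)).
have hM := hN _ (leq_maxl N n.+1); set M := maxn _ _ in hM.
have -> : L2dot (mono n) (x - l) = L2dot (mono n) (proj_sum x M - l).
  rewrite !L2dotBr; congr (_ - _); rewrite /proj_sum mono_en !(L2dotZl _ (rho q n)%:C) en_dot_sum.
  by rewrite leq0n/= leq_maxr.
apply: le_trans (cauchy_schwarz _ _) _; rewrite -/(rho q n).
by rewrite -ler_pdivlMl ?rho_gt0// [leRHS]mulrC.
Qed.

Lemma projP x (k : hardy q) : L2dot (val k) (val (Defs.proj x)) = L2dot (val k) x.
Proof.
have h : L2dot (val k) (x - val (Defs.proj x)) = 0 := xgetPex (0 : hardy q) (proj_ex x) k.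
by apply: esym; apply: subr0_eq; apply: etrans (esym (L2dotBr _ _ _)) h.
Qed.

End orthonormal_expansion.

Local Notation cont f := {within @disk _, continuous f}.

(* The argument only uses the following properties of the Hardy space, of the
   monomials E n, of their norms rho n and of f |-> T(f), hence is carried out for
   an arbitrary module V, away from the construction of the quotient L2. *)
Section operators.
Context (R : realType) (V : lmodType R[i]).
Variables (dot : V -> V -> R[i]) (N : V -> R).
Implicit Types a b : V -> V.

Definition lin a := forall c x y, a (c *: x + y) = c *: a x + a y.
Definition bounded_by a (M : R) := forall x, N (a x) <= M * N x.
Definition adjoint_wrt a b := forall x y, dot (a x) y = dot x (b y).

Record toeplitz_model (E : nat -> V) (rho : nat -> R) (rho_inf : R)
    (T : (R[i] -> R[i]) -> V -> V) : Prop := ToeplitzModel {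
  m_dotP : forall s c x y, dot s (c *: x + y) = c * dot s x + dot s y;
  m_dotC : forall x y, dot y x = (dot x y)^*%C;
  m_dotxx : forall x, dot x x = (N x ^+ 2)%:C;
  m_N_ge0 : forall x, 0 <= N x;
  m_N_eq0 : forall x, N x = 0 -> x = 0;
  m_ND : forall x y, N (x + y) <= N x + N y;
  m_NZ : forall c x, N (c *: x) = ComplexField.Normc.normc c * N x;
  m_CS : forall x y, ComplexField.Normc.normc (dot x y) <= N x * N y;
  m_complete : forall u : nat -> V, (forall e : R, 0 < e -> exists n0, forall m n,
      (n0 <= m)%N -> (n0 <= n)%N -> N (u m - u n) <= e) ->
    exists l, forall e : R, 0 < e -> exists n0, forall n, (n0 <= n)%N -> N (u n - l) <= e;
  m_Edot : forall k l, dot (E k) (E l) = if k == l then (rho k ^+ 2)%:C else 0;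
  m_rho_inf0 : 0 < rho_inf;
  m_rho_inf_le : forall n, rho_inf <= rho n;
  m_rho_dec : forall n, rho n.+1 <= rho n;
  m_Edense : forall x (e : R), 0 < e ->
    exists n (c : nat -> R[i]), N (x - \sum_(i < n) c i *: E i) < e;
  m_T_lin : forall f, cont f -> lin (T f);
  m_T_bd : forall f (M : R), cont f -> 0 <= M ->
    (forall z, disk z -> ComplexField.Normc.normc (f z) <= M) -> bounded_by (T f) M;
  m_T_adj : forall f, cont f -> adjoint_wrt (T (fun z => (f z)^*%C)) (T f);
  m_TD : forall (f g : R[i] -> R[i]) x, cont f -> cont g -> T (fun z => f z + g z) x = T f x + T g x;
  m_TZ : forall (c : R[i]) (f : R[i] -> R[i]) x, cont f -> T (fun z => c * f z) x = c *: T f x;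
  m_T_eq : forall (f g : R[i] -> R[i]) x, (forall z, disk z -> f z = g z) -> T f x = T g x;
  m_T1 : forall x, T (fun=> 1) x = x;
  m_TE : forall n, T id (E n) = E n.+1;
  m_T_near : forall f, cont f -> forall e : R, 0 < e -> exists2 K : R, 0 <= K &
    forall w x, ComplexField.Normc.normc w = 1 ->
      N (T f x - f w *: x) <= e * N x + K * N (T id x - w *: x);
  m_T_hol_lt : forall f k l, HolD f -> (k < l)%N -> dot (E k) (T f (E l)) = 0;
  m_T_hol_ge : forall f, HolD f -> exists c : nat -> R[i], forall r : R, 0 < r <= 1 ->
    forall k l, (l <= k)%N -> dot (E k) (T (fun z => f (r%:C * z)) (E l)) =
      (r ^+ (k - l))%:C * c (k - l)%N * (rho k ^+ 2)%:C }.

End operators.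

(** * Consequences of the model: linear algebra, bounded operators and adjoints *)

Section core.
Context (R : realType) (V : lmodType R[i]).
Local Notation C := R[i].
Local Notation cabs := (@ComplexField.Normc.normc R).
Variables (dot : V -> V -> C) (N : V -> R) (E : nat -> V) (rho : nat -> R).
Variables (rho_inf : R) (T : (C -> C) -> V -> V).
Implicit Types (x y s : V) (w c : C) (a b : V -> V) (f g : C -> C).
Hypothesis model : toeplitz_model dot N E rho rho_inf T.
Local Notation bd := (bounded_by N).
Local Notation adj := (adjoint_wrt dot).
Local Notation dotP := (m_dotP model).
Local Notation dotC := (m_dotC model).
Local Notation dotxx := (m_dotxx model).
Local Notation N_ge0 := (m_N_ge0 model).
Local Notation N_eq0 := (m_N_eq0 model).
Local Notation ND := (m_ND model).
Local Notation NZ := (m_NZ model).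
Local Notation CS := (m_CS model).
Local Notation complete := (m_complete model).
Local Notation Edot := (m_Edot model).
Local Notation rho_inf0 := (m_rho_inf0 model).
Local Notation rho_inf_le := (m_rho_inf_le model).
Local Notation rho_dec := (m_rho_dec model).
Local Notation Edense := (m_Edense model).
Local Notation T_lin := (m_T_lin model).
Local Notation T_bd := (m_T_bd model).
Local Notation T_adj := (m_T_adj model).
Local Notation TD := (m_TD model).
Local Notation TZ := (m_TZ model).
Local Notation T1 := (m_T1 model).
Local Notation TE := (m_TE model).
Local Notation T_near := (m_T_near model).
Local Notation T_hol_lt := (m_T_hol_lt model).
Local Notation T_hol_ge := (m_T_hol_ge model).

Lemma nrm_ge0 x : 0 <= N x. Proof. exact: N_ge0. Qed.
#[local] Hint Resolve nrm_ge0 : core.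

Lemma dotDr s x y : dot s (x + y) = dot s x + dot s y.
Proof. by have := dotP s 1 x y; rewrite scale1r mul1r. Qed.
Lemma dot0r s : dot s 0 = 0.
Proof. by have := dotDr s 0 0; rewrite addr0 => /esym/eqP; rewrite -subr_eq0 addrK => /eqP. Qed.
Lemma dotZr s c x : dot s (c *: x) = c * dot s x.
Proof. by have := dotP s c x 0; rewrite !addr0 dot0r addr0. Qed.
Lemma dotNr s x : dot s (- x) = - dot s x.
Proof. by rewrite -scaleN1r dotZr mulN1r. Qed.
Lemma dotBr s x y : dot s (x - y) = dot s x - dot s y.
Proof. by rewrite dotDr dotNr. Qed.
Lemma dotZl s c x : dot (c *: x) s = c^*%C * dot x s.
Proof. by rewrite dotC dotZr conjM -dotC. Qed.
Lemma dotBl s x y : dot (x - y) s = dot x s - dot y s.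
Proof. by rewrite dotC dotBr conjB -!dotC. Qed.
Lemma dotDl s x y : dot (x + y) s = dot x s + dot y s.
Proof. by rewrite dotC dotDr conjD -!dotC. Qed.
Lemma dot_sumr (I : Type) (r : seq I) (P : pred I) (F : I -> V) s :
  dot s (\sum_(i <- r | P i) F i) = \sum_(i <- r | P i) dot s (F i).
Proof. exact: (big_morph _ (dotDr s) (dot0r s)). Qed.
Lemma dot_suml (I : Type) (r : seq I) (P : pred I) (F : I -> V) s :
  dot (\sum_(i <- r | P i) F i) s = \sum_(i <- r | P i) dot (F i) s.
Proof.
apply: (big_morph (dot^~ s) (fun x y => dotDl s x y)).
by rewrite dotC dot0r conj0.
Qed.

Lemma N0 : N 0 = 0. Proof. by rewrite -(scale0r (0 : V)) NZ cabs0 mul0r. Qed.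
Lemma NN x : N (- x) = N x. Proof. by rewrite -scaleN1r NZ cabsN cabs1 mul1r. Qed.
Lemma NBC x y : N (x - y) = N (y - x). Proof. by rewrite -NN opprB. Qed.
Lemma Ndist x y s : N (x - y) <= N (x - s) + N (s - y).
Proof. by apply: le_trans (ND _ _); rewrite addrA subrK. Qed.
Lemma NB x y : N (x - y) <= N x + N y. Proof. by rewrite -(NN y) ND. Qed.
Lemma Nsum (I : Type) (r : seq I) (P : pred I) (F : I -> V) :
  N (\sum_(i <- r | P i) F i) <= \sum_(i <- r | P i) N (F i).
Proof.
elim/big_ind2 : _ => [|x1 a1 x2 a2 h1 h2|//]; first by rewrite N0.
by apply: le_trans (ND _ _) _; exact: lerD.
Qed.
Lemma N_le0 x : (forall e : R, 0 < e -> N x <= e) -> x = 0.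
Proof.
move=> h; apply/N_eq0/eqP; rewrite eq_le N_ge0 andbT.
by apply/ler_addgt0Pl => e e0; rewrite addr0; exact: h.
Qed.

Lemma wt_gt0 n : 0 < rho n. Proof. exact: lt_le_trans rho_inf0 (rho_inf_le n). Qed.

Lemma rho_neq0 n : (rho n)%:C != 0 :> C.
Proof. by rewrite -cabs_gt0 cabsR normr_gt0 gt_eqF// wt_gt0. Qed.

Lemma total x : (forall n, dot (E n) x = 0) -> x = 0.
Proof.
move=> h; apply: N_le0 => e e0.
have [n [c xc]] := Edense x e0.
have H : dot x x = dot (x - \sum_(i < n) c i *: E i) x.
  rewrite dotBl dot_suml [X in _ - X]big1 ?subr0// => i _.
  by rewrite dotZl h mulr0.
have : N x ^+ 2 <= e * N x.
  have := CS (x - \sum_(i < n) c i *: E i) x; rewrite -H dotxx cabsR ger0_norm ?sqr_ge0// => /le_trans; apply.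
  by rewrite ler_wpM2r// ltW.
have [->|x0] := eqVneq (N x) 0; first by move=> _; exact: ltW.
by rewrite expr2 ler_pM2r// lt_def x0 N_ge0.
Qed.


Lemma linD a x y : lin a -> a (x + y) = a x + a y.
Proof. by move=> la; rewrite -[x]scale1r la !scale1r. Qed.
Lemma lin0 a : lin a -> a 0 = 0.
Proof. by move=> la; have := linD 0 0 la; rewrite addr0 => /esym/eqP; rewrite -subr_eq0 addrK => /eqP. Qed.
Lemma linZ a c x : lin a -> a (c *: x) = c *: a x.
Proof. by move=> la; rewrite -[c *: x]addr0 la lin0// addr0. Qed.
Lemma linB a x y : lin a -> a (x - y) = a x - a y.
Proof. by move=> la; rewrite -scaleN1r linD// linZ// scaleN1r. Qed.
Lemma lin_sum a (I : Type) (r : seq I) (P : pred I) (F : I -> V) : lin a ->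
  a (\sum_(i <- r | P i) F i) = \sum_(i <- r | P i) a (F i).
Proof. by move=> la; apply: (big_morph a (fun x y => linD x y la) (lin0 la)). Qed.
Lemma lin_id : lin (@id V). Proof. by []. Qed.
Lemma lin_comp a b : lin a -> lin b -> lin (a \o b).
Proof. by move=> la lb c x y /=; rewrite lb la. Qed.
Lemma lin_sub a b : lin a -> lin b -> lin (fun x => a x - b x).
Proof. by move=> la lb c x y; rewrite la lb scalerBr opprD addrACA. Qed.

Lemma bd_wk a M M' : M <= M' -> bd a M -> bd a M'.
Proof. by move=> MM h x; apply: le_trans (h x) _; rewrite ler_wpM2r. Qed.

Lemma bd_pos a M : bd a M -> exists2 M', 0 < M' & bd a M'.
Proof.
move=> h; exists (`|M| + 1); first by rewrite ltr_wpDl.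
by apply: bd_wk h; apply: le_trans (ler_norm _) _; rewrite lerDl.
Qed.

Lemma bd_comp a b M K : 0 <= M -> bd a M -> bd b K -> bd (a \o b) (M * K).
Proof.
move=> M0 ha hb x /=; apply: le_trans (ha _) _.
by rewrite -mulrA ler_wpM2l.
Qed.

Lemma ext_dense a b M K : lin a -> bd a M -> lin b -> bd b K ->
  (forall n, a (E n) = b (E n)) -> forall x, a x = b x.
Proof.
move=> la /bd_pos[M' M0 ha] lb /bd_pos[K' K0 hb] ab x; apply/eqP; rewrite -subr_eq0; apply/eqP.
apply: N_le0 => e e0; have MK : 0 < M' + K' by rewrite addr_gt0.
have [n [c xc]] := Edense x (divr_gt0 e0 MK).
set s := \sum_(i < n) _ in xc.
have : a s = b s.
  by rewrite !lin_sum//; apply: eq_bigr => i _; rewrite !linZ// ab.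
move=> abs.
have -> : a x - b x = a (x - s) - b (x - s) by rewrite (linB x s la) (linB x s lb) abs opprB addrA subrK.
apply: le_trans (NB _ _) _; apply: le_trans (lerD (ha _) (hb _)) _.
by rewrite -mulrDl mulrC -ler_pdivlMr// ltW.
Qed.


Lemma adjC a b : adj a b -> adj b a.
Proof. by move=> ab x y; rewrite dotC -ab -dotC. Qed.

Lemma adj_bd a b M : 0 <= M -> adj a b -> bd a M -> bd b M.
Proof.
move=> M0 ab ha x; have [->|x0] := eqVneq (N (b x)) 0; first by rewrite mulr_ge0.
have p : 0 < N (b x) by rewrite lt_def x0 N_ge0.
rewrite -(ler_pM2l p) -expr2.
have := CS (a (b x)) x; rewrite ab dotxx cabsR ger0_norm ?sqr_ge0// => /le_trans; apply.
by rewrite mulrCA mulrA; apply: ler_wpM2r.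
Qed.

Lemma adj_uniq a b b' : adj a b -> adj a b' -> b = b'.
Proof.
move=> h h'; apply/funext => x; apply/eqP; rewrite -subr_eq0; apply/eqP/total => n.
by rewrite dotBr -h -h' subrr.
Qed.

Lemma adj_lin a b : adj a b -> lin b.
Proof.
move=> ab c x y; apply/eqP; rewrite -subr_eq0; apply/eqP/total => n.
by rewrite dotBr dotP -!ab dotP subrr.
Qed.

(** * Operators commuting with z and their Taylor coefficients *)

Local Notation z := (T id).
Local Notation zb := (T (fun z => z^*%C)).

Lemma cont_id : cont (@id C).
Proof. by apply/within_cabsP => p _ e e0; exists e => // w _ /ltW. Qed.

Lemma z_adj x y : dot y (z x) = dot (zb y) x.
Proof. by rewrite (T_adj cont_id). Qed.

Lemma dot_E0_z x : dot (E 0) (z x) = 0.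
Proof.
suff h : zb (E 0) = 0 by rewrite z_adj h dotC dot0r conj0.
by apply: total => n; rewrite dotC -z_adj TE Edot conj0.
Qed.

(** The adjoint of the shift E n -> E n.+1 is the backward shift weighted by ratios of squared
    norms. *)
Lemma dot_ES_z k x : dot (E k.+1) (z x) = (rho k.+1 ^+ 2 / rho k ^+ 2)%:C * dot (E k) x.
Proof.
suff h : zb (E k.+1) = (rho k.+1 ^+ 2 / rho k ^+ 2)%:C *: E k.
  by rewrite z_adj h dotZl conjc_real.
apply/eqP; rewrite -subr_eq0; apply/eqP/total => n.
rewrite dotBr dotZr dotC -z_adj TE !Edot eqSS eq_sym.
case: eqVneq => [->|_]; last by rewrite conj0 mulr0 subr0.
rewrite conjc_real -rcM divfK ?subrr// expf_neq0// gt_eqF// wt_gt0//.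
Qed.

Definition analytic a := [/\ lin a, exists M, bd a M & forall x, a (z x) = z (a x)].

Definition coef a n : C := dot (E n) (a (E 0)) / (rho n ^+ 2)%:C.

Lemma rho2_neq0 n : (rho n ^+ 2)%:C != 0 :> C.
Proof. by rewrite rcX expf_neq0// rho_neq0. Qed.

(** Commutation with z propagates the column of E 0 along the diagonals: a (E l.+1) = z (a (E l)).
    So a is determined by its Taylor coefficients. *)
Lemma an_matrix a k l : analytic a ->
  dot (E k) (a (E l)) = if (l <= k)%N then coef a (k - l) * (rho k ^+ 2)%:C else 0.
Proof.
move=> [la _ az]; elim: l k => [|l IH] k.
  by rewrite subn0 /coef divfK// rho2_neq0.
rewrite -TE az; case: k => [|k]; first by rewrite dot_E0_z.
rewrite dot_ES_z IH ltnS subSS; case: ifP => _; last by rewrite mulr0.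
rewrite mulrCA -rcM divfK// expf_neq0// gt_eqF// wt_gt0//.
Qed.

Lemma an_zero a : analytic a -> (forall n, coef a n = 0) -> forall x, a x = 0.
Proof.
move=> aa h; have [la [M hM] az] := aa.
apply: (ext_dense (b := fun=> 0) la hM (K := 0)) => [c x y|x|n].
- by rewrite scaler0 addr0.
- by rewrite N0 mul0r.
- by apply: total => k; rewrite an_matrix//; case: ifP => // _; rewrite h mul0r.
Qed.

(** * Approximate eigenvectors of z and symbols *)

Definition onb n : V := locked ((rho n)^-1%:C *: E n).

Lemma onbE n : onb n = (rho n)^-1%:C *: E n. Proof. by rewrite /onb -lock. Qed.

Lemma onb_dot k l : dot (onb k) (onb l) = (k == l)%:R.
Proof.
rewrite !onbE dotZl dotZr Edot conjc_real; case: eqVneq => [<-|_]; last by rewrite !mulr0.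
by rewrite -!rcM mulrA -invfM -expr2 mulVf// expf_neq0// gt_eqF// wt_gt0.
Qed.

(* Unit vectors which are approximate eigenvectors of z for the eigenvalue w,
   uniformly in w on the unit circle: as rho is decreasing, the defects telescope.
   For an operator commuting with z their quadratic form is a polynomial in w, a
   weighted Fejer mean of its Taylor series. *)
Definition fejer_sum n w := \sum_(k < n) (w^*%C) ^+ k *: onb k.
Definition fejer n w : V := locked ((Num.sqrt n%:R)^-1%:C *: fejer_sum n w).

Lemma fejerE n w : fejer n w = (Num.sqrt n%:R)^-1%:C *: fejer_sum n w. Proof. by rewrite /fejer -lock. Qed.

Lemma dot_fejer a n w : lin a -> dot (fejer n w) (a (fejer n w)) = (n%:R^-1)%:C *
  \sum_(k < n) \sum_(l < n) w ^+ k * (w^*%C) ^+ l * dot (onb k) (a (onb l)).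
Proof.
move=> la; rewrite !fejerE linZ// dotZl dotZr conjc_real mulrA -rcM -invfM -expr2 sqr_sqrtr//.
congr (_ * _); rewrite /fejer_sum dot_suml; apply: eq_bigr => k _.
rewrite lin_sum// dot_sumr; apply: eq_bigr => l _.
by rewrite linZ// dotZl dotZr conjX conjcK mulrA.
Qed.

Lemma unimod w k : cabs w = 1 -> w ^+ k * (w^*%C) ^+ k = 1.
Proof. by move=> w1; rewrite -exprMn mulrC mulcJ w1 expr1n expr1n. Qed.

Lemma N_fejer n w : (0 < n)%N -> cabs w = 1 -> N (fejer n w) = 1.
Proof.
move=> n0 w1; have : dot (fejer n w) (fejer n w) = 1.
  rewrite (dot_fejer n w lin_id).
  rewrite (eq_bigr (fun=> 1)); last first.
    move=> k _; rewrite (bigD1 k)//= onb_dot eqxx mulr1 unimod// big1 ?addr0// => l lk.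
    by rewrite onb_dot eq_sym (_ : (l == k :> nat) = false) ?mulr0//; exact: negPf lk.
  rewrite sumr_const card_ord -(rmorph_nat (real_complex R)) -rcM mulVf//.
  by rewrite pnatr_eq0 -lt0n.
rewrite dotxx => -[] /eqP; rewrite -[X in _ == X](expr1n _ 2) eqrXn2// => /eqP//.
Qed.

Lemma fejer0 w : fejer 0 w = 0. Proof. by rewrite fejerE /fejer_sum big_ord0 scaler0. Qed.

Lemma N_fejer_le n w : cabs w = 1 -> N (fejer n w) <= 1.
Proof. by case: n => [|n] w1; [rewrite fejer0 N0|rewrite N_fejer]. Qed.

Definition fejer_pol a n : {poly C} := \sum_(k < n) \sum_(l < n | (l <= k)%N)
  ((n%:R^-1 * (rho k / rho l))%:C * coef a (k - l)) *: 'X^(k - l).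

Lemma fejer_pol_eval a n w : analytic a -> cabs w = 1 -> (fejer_pol a n).[w] = dot (fejer n w) (a (fejer n w)).
Proof.
move=> aa w1; have [la _ _] := aa; rewrite dot_fejer// /fejer_pol horner_sum mulr_sumr.
apply: eq_bigr => k _; rewrite horner_sum big_mkcond mulr_sumr; apply: eq_bigr => l _.
rewrite !onbE linZ// dotZl dotZr conjc_real an_matrix//; case: ifP => lk; last by rewrite !mulr0.
have wk : w ^+ k = w ^+ (k - l) * w ^+ l by rewrite -exprD subnK.
rewrite hornerZ hornerXn wk -[w ^+ (k - l) * w ^+ l * _]mulrA unimod// mulr1.
rewrite !rcM.
have -> : ((rho l)^-1)%:C = ((rho l)%:C)^-1 :> C by exact: fmorphV.
have -> : ((rho k)^-1)%:C = ((rho k)%:C)^-1 :> C by exact: fmorphV.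
have := rho_neq0 k; have := rho_neq0 l.
move: (rho k)%:C (rho l)%:C (_^-1)%:C (w ^+ _) (coef a _) => A B c0 d0 e0 B0 A0.
by field; rewrite A0 B0.
Qed.

(** j telescoping sums, each at most rho 0. The bound does not depend on n, hence becomes negligible
    after the normalization of the Fejer vectors. *)
Lemma rho_sum n j : \sum_(l < n) (rho l - rho (l + j)) <= j%:R * rho 0.
Proof.
elim: j => [|j IH]; first by rewrite mul0r big1// => l _; rewrite addn0 subrr.
have -> : \sum_(l < n) (rho l - rho (l + j.+1)) = \sum_(l < n) (rho l - rho (l + j)) +
    \sum_(l < n) (rho (l + j) - rho (l.+1 + j)).
  by rewrite -big_split/=; apply: eq_bigr => l _; rewrite addnS addSn; ring.
rewrite -natr1 mulrDl mul1r; apply: lerD => //.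
have -> : \sum_(l < n) (rho (l + j) - rho (l.+1 + j)) = rho j - rho (n + j).
  elim: n {IH} => [|n IH]; first by rewrite big_ord0 add0n subrr.
  by rewrite big_ord_recr/= IH; ring.
have : rho j <= rho 0.
  by elim: j {IH} => // j IH; apply: le_trans (rho_dec _) IH.
by have := wt_gt0 (n + j); lra.
Qed.

Lemma fejer_pol_coefE a n j : (fejer_pol a n)`_j =
  (n%:R^-1 * \sum_(l < n) (if (l + j < n)%N then rho (l + j) / rho l else 0))%:C * coef a j.
Proof.
rewrite /fejer_pol coef_sum.
under eq_bigr => k _ do rewrite coef_sum big_mkcond.
rewrite exchange_big/= mulr_sumr raddf_sum/= mulr_suml; apply: eq_bigr => l _.
under eq_bigr => k _ do rewrite coefZ coefXn.
case: ifP => lj.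
  rewrite (bigD1 (Ordinal lj))//= leq_addr addKn eqxx mulr1 big1 ?addr0// => k kn.
  case: ifP => // lk; case: eqVneq => [jE|_]; last by rewrite mulr0.
  by move/eqP: kn; case; apply: val_inj; rewrite /= jE subnKC.
rewrite mulr0 mul0r big1// => k _; case: ifP => // lk.
case: eqVneq => [jE|_]; last by rewrite mulr0.
by move: lj; rewrite jE subnKC// ltn_ord.
Qed.

Lemma inv_nat_lt (e1 : R) : 0 < e1 -> exists n0 : nat, (0 < n0)%N /\ forall n, (n0 <= n)%N -> n%:R^-1 <= e1.
Proof.
move=> e10; have [M _ hM] := near_infty_natSinv_lt (PosNum e10).
exists M.+1; split => // -[|n]//; rewrite ltnS => Mn; exact/ltW/(hM n).
Qed.

(** The weight of coefficient j is an average of n numbers in [0, 1]: at most j of them are missing,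
    and the others fall short of 1 by a total of at most [j%:R * rho 0 / rho_inf], by [rho_sum]. So
    it tends to 1. *)
Lemma fejer_pol_coef a j (e1 : R) : 0 < e1 -> exists n0, forall n, (n0 <= n)%N ->
  cabs ((fejer_pol a n)`_j - coef a j) <= e1.
Proof.
move=> e10; pose L := (j%:R + j%:R * rho 0 / rho_inf) * cabs (coef a j) + 1.
have L0 : 0 < L.
  by rewrite /L ltr_wpDl// mulr_ge0 ?cabs_ge0// addr_ge0// divr_ge0 ?(ltW rho_inf0)// mulr_ge0// ltW// wt_gt0.
have [n0 [n00 hn0]] := inv_nat_lt (divr_gt0 e10 L0).
exists n0 => n nn; have np : (0 < n)%N by exact: leq_trans nn.
have npR : 0 < n%:R :> R by rewrite ltr0n.
rewrite fejer_pol_coefE; set S := \sum_(l < n) _.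
rewrite (_ : _ - _ = (n%:R^-1 * S - 1)%:C * coef a j); last by rewrite rcB mulrBl mul1r.
rewrite cabsM cabsR.
have S1 : S <= n%:R.
  have -> : n%:R = \sum_(l < n) 1 :> R by rewrite sumr_const card_ord.
  apply: ler_sum => l _; case: ifP => // _; rewrite ler_pdivrMr ?wt_gt0// mul1r.
  by elim: j {S L L0 hn0} => [|j IH]; rewrite ?addn0// addnS; exact: le_trans (rho_dec _) IH.
have S2 : n%:R - S <= j%:R + j%:R * rho 0 / rho_inf.
  have -> : n%:R - S = \sum_(l < n) (1 - (if (l + j < n)%N then rho (l + j) / rho l else 0)).
    by rewrite big_split/= sumr_const card_ord sumrN.
  apply: (@le_trans _ _ (\sum_(l < n) ((n <= l + j)%N%:R + (rho l - rho (l + j)) / rho_inf))).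
    apply: ler_sum => l _.
    have mono : rho (l + j) <= rho l.
      by elim: j {S S1 L L0 hn0} => [|j IH]; rewrite ?addn0// addnS; exact: le_trans (rho_dec _) IH.
    have [lj|lj] := ltnP (l + j) n.
      rewrite add0r -[1](@divff _ (rho l)) ?gt_eqF ?wt_gt0// -mulrBl.
      by rewrite ler_wpM2l ?subr_ge0 ?rho_dec// lef_pV2 ?posrE ?wt_gt0 ?rho_inf0 ?rho_inf_le.
    by rewrite subr0 lerDl divr_ge0 ?subr_ge0// ltW ?rho_inf0.
  rewrite big_split/=; apply: lerD.
    rewrite -natr_sum ler_nat.
    elim: (n) => [|m IH]; first by rewrite big_ord0.
    rewrite big_ord_recl add0n; case: leqP => mj; last first.
      rewrite [nat_of_bool _]/= add1n; apply: leq_ltn_trans mj.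
      rewrite -[X in (_ <= X)%N](card_ord m) -sum1_card.
      by apply: leq_sum => i _; case: leqP.
    rewrite [nat_of_bool _]/= add0n; apply: leq_trans IH; apply: leq_sum => i _.
    by rewrite /= /bump/= add1n addSn ltnS.
  rewrite -mulr_suml ler_pM2r ?invr_gt0 ?rho_inf0//; exact: rho_sum.
have -> : n%:R^-1 * S - 1 = - ((n%:R - S) / n%:R).
  by field; rewrite gt_eqF.
rewrite normrN ger0_norm ?divr_ge0 ?subr_ge0//.
have h1 : (n%:R - S) * cabs (coef a j) <= L.
  by apply: le_trans (ler_wpM2r (cabs_ge0 _) S2) _; rewrite /L lerDl.
rewrite mulrAC; apply: (@le_trans _ _ (L / n%:R)); first by rewrite ler_pM2r ?invr_gt0.
have := hn0 n nn; rewrite ler_pdivlMr// mulrC //.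
Qed.

Lemma z_onb k : z (onb k) = (rho k.+1 / rho k)%:C *: onb k.+1.
Proof.
rewrite !onbE (linZ _ _ (T_lin cont_id)) TE scalerA -rcM; congr (_%:C *: _).
by field; rewrite !gt_eqF// wt_gt0.
Qed.

Lemma N_onb k : N (onb k) = 1.
Proof.
have := dotxx (onb k); rewrite onb_dot eqxx => -[] /esym/eqP.
by rewrite -[X in _ == X](expr1n _ 2) eqrXn2// => /eqP.
Qed.

Lemma z_near n w : cabs w = 1 ->
  N (z (fejer n w) - w *: fejer n w) <= (Num.sqrt n%:R)^-1 * (2 + rho 0 / rho_inf).
Proof.
move=> w1; rewrite !fejerE (linZ _ _ (T_lin cont_id)) scalerA mulrC -scalerA -scalerBr NZ cabsR.
rewrite ger0_norm ?invr_ge0 ?sqrtr_ge0//; apply: ler_wpM2l; first by rewrite invr_ge0 sqrtr_ge0.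
have ww : w * w^*%C = 1 by rewrite mulrC mulcJ w1 expr1n.
(* As w conj(w) = 1, the unweighted shift minus w telescopes to [f n - f 0], of norm at most 2; the
   weights contribute the rest. *)
pose f k := (w * (w^*%C) ^+ k) *: onb k.
have -> : z (fejer_sum n w) - w *: fejer_sum n w =
   \sum_(0 <= k < n) (f k.+1 - f k) + \sum_(k < n) ((w^*%C) ^+ k * (rho k.+1 / rho k - 1)%:C) *: onb k.+1.
  rewrite /fejer_sum (lin_sum _ _ _ (T_lin cont_id)) scaler_sumr -sumrB big_mkord -big_split/=.
  apply: eq_bigr => k _; rewrite (linZ _ _ (T_lin cont_id)) z_onb /f !scalerA.
  have -> : w * (w^*%C) ^+ k.+1 = (w^*%C) ^+ k by rewrite exprS mulrA ww mul1r.
  have -> : (w^*%C) ^+ k * (rho k.+1 / rho k)%:C = (w^*%C) ^+ k + (w^*%C) ^+ k * (rho k.+1 / rho k - 1)%:C.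
    by rewrite rcB mulrBr mulr1 subrKC.
  by rewrite scalerDl addrAC.
apply: le_trans (ND _ _) _; apply: lerD.
  rewrite telescope_sumr//; apply: le_trans (NB _ _) _.
  by rewrite /f !NZ !N_onb !cabsM !cabsX !cabsJ w1 !expr1n !mulr1.
apply: le_trans (Nsum _ _ _) _.
apply: (@le_trans _ _ ((\sum_(k < n) (rho k - rho (k + 1))) / rho_inf)).
  rewrite mulr_suml; apply: ler_sum => k _; rewrite NZ N_onb mulr1 cabsM cabsX cabsJ w1 expr1n mul1r cabsR.
  rewrite -normrN opprB addn1 -[X in `|X - _|](@divff _ (rho k)) ?gt_eqF ?wt_gt0// -mulrBl.
  rewrite ger0_norm ?divr_ge0 ?subr_ge0 ?(ltW (wt_gt0 k)) ?rho_dec//.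
  by rewrite ler_wpM2l ?subr_ge0 ?rho_dec// lef_pV2 ?posrE ?wt_gt0 ?rho_inf0 ?rho_inf_le.
by rewrite ler_pM2r ?invr_gt0 ?rho_inf0// -[leRHS]mul1r; exact: rho_sum.
Qed.

(* The symbol of an operator, without compact operators: a v - g(w) v tends to 0
   along the approximate eigenvectors v. *)
Definition has_symbol a g := forall e1 : R, 0 < e1 -> exists n0, forall n, (n0 <= n)%N ->
  forall w, cabs w = 1 -> N (a (fejer n w) - g w *: fejer n w) <= e1.

Lemma sqrt_inv_small (e1 : R) : 0 < e1 -> exists n0 : nat, forall n, (n0 <= n)%N ->
  (Num.sqrt n%:R)^-1 <= e1.
Proof.
move=> e10; have [n0 [n00 hn0]] := inv_nat_lt (exprn_gt0 2 e10).
exists n0 => n nn; have np : 0 < n%:R :> R by rewrite ltr0n; exact: leq_trans nn.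
rewrite -(ler_pXn2r (_ : 0 < 2)%N)// ?nnegrE ?invr_ge0 ?sqrtr_ge0 ?(ltW e10)//.
by rewrite exprVn sqr_sqrtr ?(ltW np)//; exact: hn0.
Qed.

Lemma T_symb f : cont f -> has_symbol (T f) f.
Proof.
move=> cf e1 e10; have e20 : 0 < e1 / 2 by rewrite divr_gt0.
have [K K0 hK] := T_near cf e20.
have L0 : 0 < 2 + rho 0 / rho_inf by rewrite addr_gt0// divr_gt0 ?wt_gt0 ?rho_inf0.
have M0 : 0 < e1 / 2 / ((K + 1) * (2 + rho 0 / rho_inf)) by rewrite divr_gt0// mulr_gt0// ltr_wpDl.
have [n0 hn0] := sqrt_inv_small M0; exists n0 => n nn w w1.
apply: le_trans (hK _ _ w1) _; rewrite [e1 in leRHS]splitr; apply: lerD.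
  by rewrite ler_piMr ?N_fejer_le// ltW.
apply: (@le_trans _ _ ((K + 1) * (e1 / 2 / ((K + 1) * (2 + rho 0 / rho_inf)) * (2 + rho 0 / rho_inf)))).
  apply: ler_pM => //; first by rewrite lerDl.
  by apply: le_trans (z_near _ w1) _; rewrite ler_pM2r//; exact: hn0.
rewrite le_eqVlt; apply/orP; left; apply/eqP.
have K10 : 0 < K + 1 by rewrite ltr_wpDl.
by move: (2 + _ / _) L0 (K + 1) K10 => X X0 Y Y0; field; rewrite !gt_eqF.
Qed.

Lemma symb_eq a g g' : (forall w, cabs w = 1 -> g w = g' w) -> has_symbol a g -> has_symbol a g'.
Proof.
by move=> gg h e1 /h[n0 hn0]; exists n0 => n nn w w1; rewrite -gg//; exact: hn0.
Qed.

Lemma symbD a b g h : has_symbol a g -> has_symbol b h -> has_symbol (fun x => a x + b x) (fun w => g w + h w).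
Proof.
move=> ha hb e1 e10; have e20 : 0 < e1 / 2 by rewrite divr_gt0.
have [n1 h1] := ha _ e20; have [n2 h2] := hb _ e20; exists (maxn n1 n2) => n.
rewrite geq_max => /andP[/h1 H1 /h2 H2] w w1; rewrite scalerDl opprD addrACA [e1]splitr.
by apply: le_trans (ND _ _) _; apply: lerD; [exact: H1|exact: H2].
Qed.

Lemma symbZ a g c : has_symbol a g -> has_symbol (fun x => c *: a x) (fun w => c * g w).
Proof.
move=> ha e1 e10; have c0 : 0 < cabs c + 1 by rewrite ltr_wpDl// cabs_ge0.
have [n0 h] := ha _ (divr_gt0 e10 c0); exists n0 => n /h H w /H {}H.
rewrite -scalerA -scalerBr NZ; apply: (@le_trans _ _ ((cabs c + 1) * (e1 / (cabs c + 1)))).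
  by apply: ler_pM; rewrite ?cabs_ge0// lerDl.
by rewrite mulrC divfK// gt_eqF.
Qed.

Lemma symb_comp a b g h M (H : R) : lin a -> bd a M -> (forall w, cabs w = 1 -> cabs (h w) <= H) ->
  has_symbol a g -> has_symbol b h -> has_symbol (a \o b) (fun w => g w * h w).
Proof.
move=> la /bd_pos[M' M0 hM] hH ha hb e1 e10.
have H0 : 0 < `|H| + 1 by rewrite ltr_wpDl.
have [n1 h1] := ha _ (divr_gt0 e10 (mulr_gt0 (ltr0n R 2) H0)).
have [n2 h2] := hb _ (divr_gt0 e10 (mulr_gt0 (ltr0n R 2) M0)).
exists (maxn n1 n2) => n; rewrite geq_max => /andP[nn1 nn2] w w1 /=.
have -> : a (b (fejer n w)) - (g w * h w) *: fejer n w =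
   a (b (fejer n w) - h w *: fejer n w) + h w *: (a (fejer n w) - g w *: fejer n w).
  by rewrite (linB _ _ la) (linZ _ _ la) scalerBr scalerA [h w * _]mulrC addrA subrK.
apply: le_trans (ND _ _) _; rewrite [e1]splitr; apply: lerD.
  apply: le_trans (hM _) _; apply: (@le_trans _ _ (M' * (e1 / (2 * M')))).
    by rewrite ler_pM2l//; exact: h2.
  by rewrite le_eqVlt; apply/orP; left; apply/eqP; field; rewrite gt_eqF.
rewrite NZ; apply: (@le_trans _ _ ((`|H| + 1) * (e1 / (2 * (`|H| + 1))))).
  apply: ler_pM; rewrite ?cabs_ge0//; last exact: h1.
  by apply: le_trans (hH w w1) _; apply: le_trans (ler_norm _) _; rewrite lerDl.
by rewrite le_eqVlt; apply/orP; left; apply/eqP; field; rewrite gt_eqF.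
Qed.

Lemma symb_bound a g M : bd a M -> has_symbol a g -> forall w, cabs w = 1 -> cabs (g w) <= M.
Proof.
move=> hM ha w w1; apply/ler_addgt0Pr => e1 /ha[n0 h].
(* The index is a successor because [fejer 0 w] is the zero vector. *)
have := h n0.+1 (leqnSn _) w w1; have Nv1 := N_fejer (ltn0Sn n0) w1.
move=> h'; have : N (g w *: fejer n0.+1 w) <= N (a (fejer n0.+1 w)) + e1.
  have := Ndist (g w *: fejer n0.+1 w) 0 (a (fejer n0.+1 w)); rewrite !subr0 NBC.
  by move: h'; lra.
by rewrite NZ Nv1 mulr1 => /le_trans; apply; rewrite lerD2r; have := hM (fejer n0.+1 w); rewrite Nv1 mulr1.
Qed.

Lemma symb_uniq a g h : has_symbol a g -> has_symbol a h -> forall w, cabs w = 1 -> g w = h w.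
Proof.
move=> ha hb w w1; apply/eqP; rewrite -subr_eq0 -cabs_eq0 eq_le cabs_ge0 andbT.
have := symbD ha (symbZ (-1) hb) => hab.
have z0 : bd (fun x => a x + -1 *: a x) 0 by move=> x; rewrite scaleN1r subrr N0 mul0r.
by have := symb_bound z0 hab w1; rewrite mulN1r.
Qed.

(** Divided by [rho k ^+ 2], the entry (k, l) of T(f) depends on k - l only, and by [dot_ES_z] this
    is what commutation with z means entrywise. *)
Lemma hol_an f : HolD f -> analytic (T f).
Proof.
move=> hf; have [cf _] := hf; have [M M0 hM] := disk_bounded cf.
have bM := T_bd cf M0 hM.
split; [exact (T_lin cf)|exact (ex_intro _ M bM)|].
have [K K0 hK] := disk_bounded cont_id; have bK := T_bd cont_id K0 hK.
have lc := lin_comp (T_lin cf) (T_lin cont_id); have lc' := lin_comp (T_lin cont_id) (T_lin cf).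
apply: (ext_dense lc (bd_comp M0 bM bK) lc' (bd_comp K0 bK bM)) => l /=.
rewrite TE; apply/eqP; rewrite -subr_eq0; apply/eqP/total => k; rewrite dotBr.
have [c hc] := T_hol_ge hf.
have {}hc k' l' : (l' <= k')%N -> dot (E k') (T f (E l')) = c (k' - l')%N * (rho k' ^+ 2)%:C.
  have i1 : 0 < (1 : R) <= 1 by rewrite ltr01 lexx.
  move=> lk; have := hc 1 i1 _ _ lk; rewrite expr1n mul1r => <-; congr (dot _ (T _ _)).
  by apply/funext => w; rewrite mul1r.
case: k => [|k]; first by rewrite dot_E0_z T_hol_lt// subrr.
rewrite dot_ES_z; have [lk|kl] := leqP l k; last by rewrite !T_hol_lt// mulr0 subrr.
rewrite !hc// subSS; apply/eqP; rewrite subr_eq0; apply/eqP.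
by rewrite mulrCA -rcM divfK// expf_neq0// gt_eqF// wt_gt0.
Qed.

Lemma fejer_pol_symb a g : analytic a -> has_symbol a g -> forall e1 : R, 0 < e1 -> exists n0, forall n,
  (n0 <= n)%N -> forall w, cabs w = 1 -> cabs ((fejer_pol a n).[w] - g w) <= e1.
Proof.
move=> aa ha e1 /ha[n0 h]; exists (maxn n0 1) => n; rewrite geq_max => /andP[nn n1] w w1.
have Nv1 := N_fejer n1 w1.
have -> : (fejer_pol a n).[w] - g w = dot (fejer n w) (a (fejer n w) - g w *: fejer n w).
  by rewrite dotBr dotZr dotxx Nv1 expr1n mulr1 fejer_pol_eval.
by apply: le_trans (CS _ _) _; rewrite Nv1 mul1r; exact: h.
Qed.

Lemma fejer_pol_bound a n M : analytic a -> bd a M -> forall w, disk w -> 0 <= M -> cabs (fejer_pol a n).[w] <= M.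
Proof.
move=> aa hM w; rewrite diskE => w1 M0; apply: poly_max_circle w1 => u u1.
rewrite fejer_pol_eval//; apply: le_trans (CS _ _) _.
apply: (@le_trans _ _ (1 * M)); last by rewrite mul1r.
apply: ler_pM => //; first exact: N_fejer_le.
by apply: le_trans (hM _) _; rewrite ler_piMr// N_fejer_le.
Qed.

(** The Fejer polynomials tend to 0 uniformly on the circle, hence so do their coefficients, which
    on the other hand tend to the Taylor coefficients of a. *)
Lemma an_symb0 a : analytic a -> has_symbol a (fun=> 0) -> forall x, a x = 0.
Proof.
move=> aa ha; apply: an_zero => // j; apply/eqP; rewrite -cabs_eq0 eq_le cabs_ge0 andbT.
apply/ler_addgt0Pl => e1 e10; rewrite addr0; have e20 : 0 < e1 / 2 by rewrite divr_gt0.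
have [n1 h1] := fejer_pol_symb aa ha e20; have [n2 h2] := fejer_pol_coef a j e20.
have H1 := h1 _ (leq_maxl n1 n2); have H2 := h2 _ (leq_maxr n1 n2).
have := @coef_le_circle R (fejer_pol a (maxn n1 n2)) (e1 / 2) j.
have := cabs_dist (coef a j) 0 (fejer_pol a (maxn n1 n2))`_j; rewrite !subr0 cabsBC => h3 h4.
rewrite [e1]splitr; apply: le_trans h3 _; apply: lerD => //; apply: h4 => w /H1.
by rewrite subr0.
Qed.

Lemma anB a b : analytic a -> analytic b -> analytic (fun x => a x - b x).
Proof.
move=> [la [M hM] az] [lb [K hK] bz]; split; first exact: lin_sub.
  exists (M + K) => x; apply: le_trans (NB _ _) _; rewrite mulrDl; exact: lerD.
by move=> x; rewrite az bz (linB _ _ (T_lin cont_id)).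
Qed.

Lemma an_comp a b : analytic a -> analytic b -> analytic (a \o b).
Proof.
move=> [la [M hM] az] [lb [K hK] bz]; have [M' M0 hM'] := bd_pos hM.
split; [exact: lin_comp|by exists (M' * K); apply: bd_comp => //; exact: ltW|].
by move=> x /=; rewrite bz az.
Qed.

Lemma an_symb_eq a b g : analytic a -> analytic b -> has_symbol a g -> has_symbol b g -> forall x, a x = b x.
Proof.
move=> aa ab ha hb x; apply/eqP; rewrite -subr_eq0; apply/eqP.
apply: (an_symb0 (anB aa ab)).
have := symbD ha (symbZ (-1) hb) => h e1 /h[n0 h1]; exists n0 => n /h1 H w /H.
by rewrite mulN1r subrr scaleN1r.
Qed.

(* The polynomials fejer_pol converge uniformly on the circle by fejer_pol_symb, hence on
   the disk by the maximum principle. *)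
Lemma an_lim a g : analytic a -> has_symbol a g -> exists F, [/\ HolD F, forall w, cabs w = 1 -> F w = g w,
  ulim (@disk R) (fun n => horner (fejer_pol a n)) F & forall x, a x = T F x].
Proof.
move=> aa ha.
have cc : ucauchy (@circle R) (fun n => horner (fejer_pol a n)).
  apply: (@ulim_ucauchy _ _ _ g) => e1 /(fejer_pol_symb aa ha)[n0 h]; exists n0 => n nn w /circleE.
  exact: h.
have [F hF] := ucauchy_ulim (ucauchy_poly cc).
have HF := ulim_poly_HolD hF; have [cF _] := HF.
have Fg w : cabs w = 1 -> F w = g w.
  move=> w1; apply/eqP; rewrite -subr_eq0 -cabs_eq0 eq_le cabs_ge0 andbT.
  apply/ler_addgt0Pl => e1 e10; rewrite addr0; have e20 : 0 < e1 / 2 by rewrite divr_gt0.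
  have [n1 h1] := fejer_pol_symb aa ha e20; have [n2 h2] := hF _ e20.
  have Dw : disk w by rewrite diskE w1.
  rewrite [e1]splitr; apply: le_trans (cabs_dist _ _ (fejer_pol a (maxn n1 n2)).[w]) _.
  by apply: lerD; [rewrite cabsBC; apply: h2 => //; exact: leq_maxr|apply: h1 => //; exact: leq_maxl].
exists F; split => //; apply: (an_symb_eq aa (hol_an HF) ha).
by apply: symb_eq (T_symb cF).
Qed.

Lemma an_bound a (F : C -> C) M : analytic a -> bd a M -> 0 <= M ->
  ulim (@disk R) (fun n => horner (fejer_pol a n)) F -> forall w, disk w -> cabs (F w) <= M.
Proof.
move=> aa hM M0 hF w Dw; apply/ler_addgt0Pr => e1 /hF[n0 h].
have := h n0 (leqnn _) w Dw; have := fejer_pol_bound n0 aa hM Dw M0.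
have := cabs_dist (F w) 0 (fejer_pol a n0).[w]; rewrite !subr0 cabsBC; lra.
Qed.


(** * The disk algebra: injectivity, norm bound and multiplicativity of f -> T(f) *)

Lemma HolD_cder f w : HolD f -> cabs w < 1 -> exists d, cder f w d.
Proof. by move=> [_ hf] w1; apply/derivable_cder/hf; rewrite cnormE ltcR. Qed.

Lemma HolDM f g : HolD f -> HolD g -> HolD (fun w => f w * g w).
Proof.
move=> hf hg; have [cf _] := hf; have [cg _] := hg; split; first exact: (@within_mul R f g cf cg).
move=> w; rewrite cnormE ltcR => w1; apply/derivable_cder.
have [d hd] := HolD_cder hf w1; have [d' hd'] := HolD_cder hg w1.
by exists (d * g w + f w * d'); exact: cderM.
Qed.

Lemma HolDD f g : HolD f -> HolD g -> HolD (fun w => f w + g w).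
Proof.
move=> hf hg; have [cf _] := hf; have [cg _] := hg; split.
  by move=> w; apply: cvgD; [exact: cf|exact: cg].
move=> w; rewrite cnormE ltcR => w1; apply/derivable_cder.
have [d hd] := HolD_cder hf w1; have [d' hd'] := HolD_cder hg w1.
by exists (d + d'); exact: cderD.
Qed.

Lemma HolDZ f c : HolD f -> HolD (fun w => c * f w).
Proof. by move=> hf; exact: HolDM (HolD_cst c) hf. Qed.

(** The symbol of T(h) sees h on the unit circle only. But the Taylor coefficients vanish, so T(h(r
    .)) = 0 for every r in (0, 1], and with r = |w| its symbol at w / r is h(w). Continuity settles
    w = 0. *)
Lemma hol_eq0 h : HolD h -> (forall x, T h x = 0) -> forall w, disk w -> h w = 0.
Proof.
move=> hh Th; have [c hc] := T_hol_ge hh.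
have c0 n : c n = 0.
  have i1 : 0 < (1 : R) <= 1 by rewrite ltr01 lexx.
  have := hc 1 i1 n 0%N (leq0n n); rewrite subn0 expr1n mul1r.
  have -> : (fun w => h (1%:C * w)) = h by apply/funext => w; rewrite mul1r.
  rewrite Th dot0r => /esym/eqP; rewrite mulf_eq0 (negPf (rho2_neq0 n)) orbF => /eqP//.
have nz w : disk w -> w != 0 -> h w = 0.
  move=> Dw w0; pose r := cabs w; have r0 : 0 < r by rewrite cabs_gt0.
  have r01 : 0 < r <= 1 by rewrite r0 -diskE.
  have hd := dil_HolD r01 hh; have [cd _] := hd.
  have Td x : T (fun u => h (r%:C * u)) x = 0.
    apply: (an_zero (hol_an hd)) => n; rewrite /coef hc// c0 mulr0 mul0r mul0r//.
  have s0 : has_symbol (T (fun u => h (r%:C * u))) (fun=> 0).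
    by move=> e1 e10; exists 0%N => n _ u _; rewrite Td scale0r subrr N0 ltW.
  have rc0 : r%:C != 0 :> C by rewrite -cabs_gt0 cabsR normr_gt0 gt_eqF.
  have := symb_uniq (T_symb cd) s0 (w := w / r%:C).
  rewrite /= [_ * (w / _)]mulrC divfK//; apply.
  by rewrite cabsM cabsV cabsR ger0_norm ?(ltW r0)// divff// gt_eqF.
move=> w Dw; have [->|w0] := eqVneq w 0; last exact: nz.
have D0 : disk (0 : C) by rewrite diskE cabs0.
apply/eqP; rewrite -cabs_eq0 eq_le cabs_ge0 andbT; apply/ler_addgt0Pl => e1 e10; rewrite addr0.
have [ch _] := hh; have [d d0 hd] := iffLR (within_cabsP _ _) ch 0 D0 _ e10.
pose m := Num.min (d / 2) 1; have m0 : 0 < m by rewrite lt_min divr_gt0/=.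
have md : m < d by rewrite gt_min ltr_pdivrMr// ltr_pMr// ltr1n.
have m1 : m <= 1 by rewrite ge_min lexx orbT.
have cm : cabs (m%:C : C) = m by rewrite cabsR ger0_norm// ltW.
have Dm : disk (m%:C : C) by rewrite diskE cm.
have := hd _ Dm; rewrite subr0 cm => /(_ md); rewrite nz//; first by rewrite sub0r cabsN.
by rewrite -cabs_gt0 cm.
Qed.

Lemma hol_eq f g : HolD f -> HolD g -> (forall x, T f x = T g x) -> forall w, disk w -> f w = g w.
Proof.
move=> hf hg fg w Dw; have [cf _] := hf; have [cg _] := hg.
have hd := HolDD hf (HolDZ (-1) hg); have [cZ _] := HolDZ (-1) hg.
have := hol_eq0 hd _ Dw => /(_ _)/eqP; rewrite mulN1r subr_eq0 => h; apply/eqP/h => x.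
by rewrite (TD x cf cZ) (TZ (-1) x cg) fg scaleN1r subrr.
Qed.

Lemma hol_ulim f : HolD f -> ulim (@disk R) (fun n => horner (fejer_pol (T f) n)) f.
Proof.
move=> hf; have [cf _] := hf; have [F [HF _ pF TF]] := an_lim (hol_an hf) (T_symb cf).
by move=> e1 /pF[n0 h]; exists n0 => n nn w Dw; rewrite (hol_eq hf HF TF)//; exact: h.
Qed.

Lemma hol_bound f M : HolD f -> bd (T f) M -> 0 <= M -> forall w, disk w -> cabs (f w) <= M.
Proof. by move=> hf hM M0; apply: (an_bound (hol_an hf) hM M0); exact: hol_ulim. Qed.

(** Both sides commute with z and have symbol f g, and [an_symb_eq] identifies such operators. *)
Lemma T_mul f g x : HolD f -> HolD g -> T (fun w => f w * g w) x = T f (T g x).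
Proof.
move=> hf hg; have hfg := HolDM hf hg; have [cfg _] := hfg; have [cf _] := hf; have [cg _] := hg.
have [M M0 hM] := disk_bounded cf; have [K K0 hK] := disk_bounded cg.
apply: (an_symb_eq (hol_an hfg) (an_comp (hol_an hf) (hol_an hg)) (T_symb cfg)).
apply: (symb_comp (T_lin cf) (T_bd cf M0 hM) (H := K)) (T_symb cf) (T_symb cg) => w w1.
by apply: hK; rewrite diskE w1.
Qed.

(* These operators form a C*-algebra containing all T(f), hence C(D_q). *)
Definition symbolic a := [/\ lin a, exists M, bd a M &
  exists b g, [/\ adj a b, has_symbol a g & has_symbol b (fun w => (g w)^*%C)]].

Lemma good_T f : cont f -> symbolic (T f).
Proof.
move=> cf; have [M M0 hM] := disk_bounded cf; have cj := @within_conj R f cf.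
split; [exact (T_lin cf)|by exists M; exact: (T_bd cf M0 hM)|].
exists (T (fun w => (f w)^*%C)), f; split; [|exact: T_symb|exact: T_symb].
exact: adjC (T_adj cf).
Qed.

Lemma goodD a b : symbolic a -> symbolic b -> symbolic (fun x => a x + b x).
Proof.
move=> [la [M hM] [a' [g [aa ga ga']]]] [lb [K hK] [b' [h [bb gb gb']]]]; split.
- by move=> c x y; rewrite la lb scalerDr addrACA.
- by exists (M + K) => x; apply: le_trans (ND _ _) _; rewrite mulrDl; exact: lerD.
exists (fun x => a' x + b' x), (fun w => g w + h w); split; last 2 first.
- exact: symbD.
- by apply: symb_eq (symbD ga' gb') => w _; rewrite conjD.
- by move=> x y; rewrite dotDl dotDr aa bb.
Qed.

Lemma goodZ a c : symbolic a -> symbolic (fun x => c *: a x).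
Proof.
move=> [la [M hM] [a' [g [aa ga ga']]]]; split.
- by move=> d x y; rewrite la scalerDr !scalerA mulrC.
- by exists (cabs c * M) => x; rewrite NZ -mulrA ler_wpM2l ?cabs_ge0.
exists (fun x => c^*%C *: a' x), (fun w => c * g w); split.
- by move=> x y; rewrite dotZl dotZr aa.
- exact: symbZ.
- by apply: symb_eq (symbZ c^*%C ga') => w _; rewrite conjM.
Qed.

Lemma good_adj a b : symbolic a -> adj a b -> symbolic b.
Proof.
move=> [la [M hM] [a' [g [aa ga ga']]]] ab; have [M' M0 hM'] := bd_pos hM.
rewrite -(adj_uniq aa ab); split; [exact: adj_lin aa|by exists M'; exact: adj_bd (ltW M0) aa hM'|].
exists a, (fun w => (g w)^*%C); split; [exact: adjC|exact: ga'|].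
by apply: symb_eq ga => w _; rewrite conjcK.
Qed.

Lemma adj_comp a a' b b' : adj a a' -> adj b b' -> adj (a \o b) (b' \o a').
Proof. by move=> ha hb x y /=; rewrite ha hb. Qed.

Lemma good_comp a b : symbolic a -> symbolic b -> symbolic (a \o b).
Proof.
move=> [la [M hM] [a' [g [aa ga ga']]]] [lb [K hK] [b' [h [bb gb gb']]]].
have [M' M0 hM'] := bd_pos hM; have [K' K0 hK'] := bd_pos hK.
split; [exact: lin_comp|by exists (M' * K'); apply: bd_comp => //; exact: ltW|].
exists (b' \o a'), (fun w => g w * h w); split; first exact: adj_comp.
  by apply: (symb_comp la hM' (H := K')) => // w w1; exact: symb_bound gb w w1.
have hb' := adj_bd (ltW K0) bb hK'.
apply: symb_eq (symb_comp (adj_lin bb) hb' (H := M') _ gb' ga') => w w1.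
  by rewrite conjM mulrC.
by rewrite cabsJ; exact: symb_bound hM' ga w w1.
Qed.

Lemma symb_lim a (B : nat -> V -> V) (G : nat -> C -> C) g : (forall n, has_symbol (B n) (G n)) ->
  (forall e1 : R, 0 < e1 -> exists n0, forall n, (n0 <= n)%N -> bd (fun x => a x - B n x) e1) ->
  ulim (@circle R) G g -> has_symbol a g.
Proof.
move=> hB hb hG e1 e10; have e30 : 0 < e1 / 3 by rewrite divr_gt0.
have [n1 h1] := hb _ e30; have [n2 h2] := hG _ e30.
have {}h1 := h1 _ (leq_maxl n1 n2); have {}h2 := h2 _ (leq_maxr n1 n2).
move: (maxn n1 n2) h1 h2 => m h1 h2; have [n0 h0] := hB m _ e30; exists n0 => n nn w w1.
have Hv := N_fejer_le n w1; have vge := N_ge0 (fejer n w).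
have H0 := h0 n nn w w1.
have H1 : N (a (fejer n w) - B m (fejer n w)) <= e1 / 3.
  by apply: le_trans (h1 _) _; rewrite ler_piMr// ltW.
have H2 : N (G m w *: fejer n w - g w *: fejer n w) <= e1 / 3.
  rewrite -scalerBl NZ; apply: (@le_trans _ _ (e1 / 3 * 1)); last by rewrite mulr1.
  by apply: ler_pM; rewrite ?cabs_ge0//; apply: h2; apply/circleE.
have := Ndist (a (fejer n w)) (g w *: fejer n w) (B m (fejer n w)).
have := Ndist (B m (fejer n w)) (g w *: fejer n w) (G m w *: fejer n w).
move: H0 H1 H2; lra.
Qed.

(** The adjoint and the symbol of a norm limit have to be constructed. The adjoints of the
    approximants are Cauchy by [adj_bd], their symbols by [symb_bound], and completeness supplies
    the limits. *)
Lemma good_closed a M : lin a -> bd a M ->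
  (forall e1 : R, 0 < e1 -> exists2 b, symbolic b & bd (fun x => a x - b x) e1) -> symbolic a.
Proof.
move=> la hM happ; have [M' M0 hM'] := bd_pos hM.
have H n : exists t : (V -> V) * (V -> V) * (C -> C), [/\ bd (fun x => a x - t.1.1 x) n.+1%:R^-1,
    adj t.1.1 t.1.2, has_symbol t.1.1 t.2, has_symbol t.1.2 (fun w => (t.2 w)^*%C) & lin t.1.1].
  have n0 : 0 < n.+1%:R^-1 :> R by rewrite invr_gt0.
  have [b [lb _ [b' [g [h1 h2 h3]]]] hb] := happ _ n0.
  by exists (b, b', g).
have [t {}H] := choice H.
pose B n := (t n).1.1; pose A n := (t n).1.2; pose G n := (t n).2.
have hB n : bd (fun x => a x - B n x) n.+1%:R^-1 by have [] := H n.
have hA n : adj (B n) (A n) by have [] := H n.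
have hG n : has_symbol (B n) (G n) by have [] := H n.
have hG' n : has_symbol (A n) (fun w => (G n w)^*%C) by have [] := H n.
have inv0 n : 0 <= n.+1%:R^-1 :> R by rewrite invr_ge0.
have hBB m n : bd (fun x => B m x - B n x) (m.+1%:R^-1 + n.+1%:R^-1).
  move=> x; apply: le_trans (Ndist _ _ (a x)) _; rewrite mulrDl NBC.
  by apply: lerD; exact: hB.
have hAA m n : bd (fun x => A m x - A n x) (m.+1%:R^-1 + n.+1%:R^-1).
  apply: adj_bd (hBB m n); first by rewrite addr_ge0.
  by move=> x y; rewrite dotBl dotBr !hA.
have small (e1 : R) : 0 < e1 -> exists n0 : nat, forall m n, (n0 <= m)%N -> (n0 <= n)%N ->
    m.+1%:R^-1 + n.+1%:R^-1 <= e1.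
  move=> e10; have e20 : 0 < e1 / 2 by rewrite divr_gt0.
  have [n0 [_ h]] := inv_nat_lt e20; exists n0 => m n mm nn; rewrite [e1]splitr.
  by apply: lerD; apply: h; exact: leqW.
have A'ex x : exists l, forall e1 : R, 0 < e1 -> exists n0, forall n, (n0 <= n)%N -> N (A n x - l) <= e1.
  apply: complete => e1 e10; have K0 : 0 < N x + 1 by rewrite ltr_wpDl.
  have [n0 h] := small _ (divr_gt0 e10 K0); exists n0 => m n mm nn.
  apply: le_trans (hAA m n x) _; apply: (@le_trans _ _ (e1 / (N x + 1) * (N x + 1))).
    by apply: ler_pM; rewrite ?addr_ge0 ?inv0 ?lerDl//; exact: h.
  by rewrite divfK// gt_eqF.
have [a' ha'] := choice A'ex.
have rate n x : N (a' x - A n x) <= (n.+1%:R^-1 + n.+1%:R^-1) * N x.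
  apply/ler_addgt0Pr => e1 e10; have [n0 h] := ha' x _ e10.
  apply: le_trans (Ndist _ _ (A (maxn n0 n) x)) _; rewrite addrC NBC [N (a' x - _)]NBC.
  apply: lerD; last by apply: h; exact: leq_maxl.
  rewrite NBC; apply: le_trans (hAA _ _ x) _; apply: ler_wpM2r => //; rewrite lerD2r.
  by rewrite lef_pV2 ?posrE ?ltr0n// ler_nat ltnS leq_maxr.
have aa' : adj a a'.
  move=> x y; apply/eqP; rewrite -subr_eq0 -cabs_eq0 eq_le cabs_ge0 andbT.
  apply/ler_addgt0Pl => e1 e10; rewrite addr0.
  have K0 : 0 < N x * N y + 1 by rewrite ltr_wpDl// mulr_ge0.
  have [n0 h] := small _ (divr_gt0 e10 (mulr_gt0 (ltr0n R 2) K0)).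
  have hn := h n0 n0 (leqnn _) (leqnn _).
  have -> : dot (a x) y - dot x (a' y) = dot (a x - B n0 x) y - dot x (a' y - A n0 y).
    by rewrite dotBl dotBr hA opprB addrA subrK.
  apply: le_trans (cabsB _ _) _.
  have P1 : cabs (dot (a x - B n0 x) y) <= n0.+1%:R^-1 * N x * N y.
    by apply: le_trans (CS _ _) _; rewrite ler_wpM2r//; exact: hB.
  have P2 : cabs (dot x (a' y - A n0 y)) <= N x * ((n0.+1%:R^-1 + n0.+1%:R^-1) * N y).
    by apply: le_trans (CS _ _) _; rewrite ler_wpM2l.
  apply: le_trans (lerD P1 P2) _.
  have xy0 : 0 <= N x * N y by rewrite mulr_ge0.
  have i0 := inv0 n0; move: (n0.+1%:R^-1) i0 hn => i0 i00 hn.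
  apply: (@le_trans _ _ (2 * ((i0 + i0) * (N x * N y + 1)))).
    rewrite [leLHS](_ : _ = 3 * (i0 * (N x * N y))); last by ring.
    rewrite [leRHS](_ : _ = 4 * (i0 * (N x * N y)) + 4 * i0); last by ring.
    have := mulr_ge0 i00 xy0; lra.
  by move: hn; rewrite ler_pdivlMr ?mulr_gt0// mulrCA.
have cG : ucauchy (@circle R) G.
  move=> e1 /small[n0 h]; exists n0 => m n mm nn w /circleE w1.
  apply: le_trans (h m n mm nn); have := symbD (hG m) (symbZ (-1) (hG n)) => hs.
  have bb : bd (fun x => B m x + -1 *: B n x) (m.+1%:R^-1 + n.+1%:R^-1).
    by move=> x; rewrite scaleN1r; exact: hBB.
  by have := symb_bound bb hs w1; rewrite mulN1r.
have [g hg] := ucauchy_ulim cG.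
split => //; first by exists M.
exists a', g; split => //.
  apply: symb_lim hG _ hg => e1 e10; have [n0 [_ h]] := inv_nat_lt e10; exists n0 => n nn.
  by apply: bd_wk (hB n); apply: h; exact: leqW.
apply: symb_lim hG' _ _ => [e1 e10|e1 /hg[n0 h]].
  have [n0 h] := small _ e10; exists n0 => n nn x; apply: le_trans (rate n x) _.
  by rewrite ler_wpM2r//; exact: h.
by exists n0 => n nn w Dw; rewrite -conjB cabsJ; exact: h.
Qed.

(** A functional phi becomes the rank-one operator [phi x *: E 0], to which [ext_dense] applies. *)
Lemma ext_fun (phi psi : V -> C) (M M' : R) :
  (forall c x y, phi (c *: x + y) = c * phi x + phi y) ->
  (forall x, cabs (phi x) <= M * N x) ->
  (forall c x y, psi (c *: x + y) = c * psi x + psi y) ->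
  (forall x, cabs (psi x) <= M' * N x) ->
  (forall n, phi (E n) = psi (E n)) -> forall x, phi x = psi x.
Proof.
move=> lphi bphi lpsi bpsi E0 x.
have lE (h : V -> C) : (forall c x y, h (c *: x + y) = c * h x + h y) -> lin (fun x => h x *: E 0).
  by move=> hh c y s; rewrite hh scalerDl scalerA.
have bE (h : V -> C) K : (forall x, cabs (h x) <= K * N x) -> bd (fun x => h x *: E 0) (K * N (E 0)).
  by move=> hh y; rewrite NZ mulrAC ler_wpM2r.
have e0 n : (fun x => phi x *: E 0) (E n) = (fun x => psi x *: E 0) (E n) by rewrite /= E0.
have := ext_dense (lE _ lphi) (bE _ _ bphi) (lE _ lpsi) (bE _ _ bpsi) e0 x.
move/(congr1 (dot (E 0))); rewrite !dotZr Edot eqxx => /eqP.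
by rewrite -subr_eq0 -mulrBl mulf_eq0 (negPf (rho2_neq0 0)) orbF subr_eq0 => /eqP.
Qed.

(** The form at x + y makes (x, A y) the opposite of (y, A x); at x + i y it makes them equal, the
    scalars being complex. *)
Lemma polarization A : lin A -> (forall x, dot x (A x) = 0) -> forall x, A x = 0.
Proof.
move=> lA h x.
have H y : dot y (A x) = 0.
  have h1 := h (x + y); have h2 := h (x + 'i *: y).
  rewrite (linD _ _ lA) dotDl !dotDr !h add0r addr0 in h1.
  rewrite (linD _ _ lA) dotDl !dotDr (linZ _ _ lA) !dotZl !dotZr !h !mulr0 add0r addr0 in h2.
  have e1 : dot x (A y) = - dot y (A x) by apply/eqP; rewrite -addr_eq0 h1.
  have i0 : 'i != 0 :> C by rewrite eq_complex/= oner_eq0 andbF.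
  have e2 : ('i : C)^*%C = - 'i by rewrite /conjc/=; apply/eqP; rewrite eq_complex/= oppr0 !eqxx.
  rewrite e1 e2 mulrN mulNr -opprD in h2.
  have {}h2 : 'i * dot y (A x) *+ 2 = 0 by apply/eqP; rewrite -oppr_eq0 mulr2n h2.
  move/eqP: h2; rewrite mulrn_eq0/= mulf_eq0 (negPf i0)/= => /eqP//.
by apply: total => n; rewrite H.
Qed.

(** * The scaling operator j *)

Section dilation.
Variables (q : R) (j : V -> V) (K : R).
Hypothesis q01 : 0 < q < 1.
Hypothesis jl : lin j.
Hypothesis jb : bd j K.
Hypothesis jE : forall n, j (E n) = (q ^+ n)%:C *: E n.

Let K0 : exists2 K' : R, 0 <= K' & bd j K'.
Proof. by have [K' K'0 h] := bd_pos jb; exists K' => //; exact: ltW. Qed.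

Lemma j_dot k x : dot (E k) (j x) = (q ^+ k)%:C * dot (E k) x.
Proof.
have [K' K'0 jb'] := K0.
apply: (@ext_fun (fun x => dot (E k) (j x)) (fun x => (q ^+ k)%:C * dot (E k) x)
  (N (E k) * K') (cabs ((q ^+ k)%:C : C) * N (E k))) => [c y s|y|c y s|y|n] /=.
- by rewrite jl dotP.
- by apply: le_trans (CS _ _) _; rewrite -mulrA ler_wpM2l.
- by rewrite dotP mulrDr mulrCA.
- by rewrite cabsM -mulrA ler_wpM2l ?cabs_ge0//; exact: CS.
- by rewrite jE dotZr Edot; case: eqVneq => [->|_]; rewrite ?mulr0.
Qed.

Lemma qn_neq0 n : (q ^+ n)%:C != 0 :> C.
Proof.
by rewrite -cabs_gt0 cabsR normr_gt0 expf_neq0// gt_eqF//; case/andP: q01.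
Qed.

Lemma j_inj x y : j x = j y -> x = y.
Proof.
move=> h; apply/eqP; rewrite -subr_eq0; apply/eqP/total => n; rewrite dotBr.
have := congr1 (dot (E n)) h; rewrite !j_dot => /(mulfI (qn_neq0 n)) ->.
by rewrite subrr.
Qed.

Lemma j_adj : adj j j.
Proof.
have [K' K'0 jb'] := K0; move=> x y; rewrite dotC [RHS]dotC; congr _^*%C.
apply: (@ext_fun (dot y \o j) (dot (j y)) (N y * K') (N (j y))) => [c u s|u|c u s|u|n] /=.
- by rewrite jl dotP.
- by apply: le_trans (CS _ _) _; rewrite -mulrA ler_wpM2l.
- by rewrite dotP.
- exact: CS.
- by rewrite dotC [RHS]dotC j_dot jE dotZl conjc_real.
Qed.

Lemma j_T_hol f x : HolD f -> j (T f x) = T (fun w => f (q%:C * w)) (j x).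
Proof.
have [K' K'0 jb'] := K0; move=> hf; have [cf _] := hf.
have qi : 0 < q <= 1 by case/andP: q01 => -> /ltW.
have hd := dil_HolD qi hf; have [cd _] := hd.
have [M M0 hM] := disk_bounded cf; have bM := T_bd cf M0 hM.
have [L L0 hL] := disk_bounded cd; have bL := T_bd cd L0 hL.
apply: (ext_dense (lin_comp jl (T_lin cf)) (bd_comp K'0 jb' bM)
  (lin_comp (T_lin cd) jl) (bd_comp L0 bL jb')) => l /=.
apply/eqP; rewrite -subr_eq0; apply/eqP/total => k.
rewrite dotBr j_dot jE (linZ _ _ (T_lin cd)) dotZr.
have [lk|kl] := leqP l k; last by rewrite !T_hol_lt// !mulr0 subrr.
have [c hc] := T_hol_ge hf.
have i1 : 0 < (1 : R) <= 1 by rewrite ltr01 lexx.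
have e1 : dot (E k) (T f (E l)) = c (k - l)%N * (rho k ^+ 2)%:C.
  have := hc 1 i1 _ _ lk; rewrite expr1n mul1r => <-; congr (dot _ (T _ _)).
  by apply/funext => w; rewrite mul1r.
(* Diagonal scaling by j multiplies entry (k, l) by q^k on the left and q^l on the right; the
   missing q^(k-l) is the effect of dilating f. *)
by rewrite e1 hc// !mulrA -rcM -exprD subnKC// subrr.
Qed.

Lemma j_T_antihol f x : HolD (fun w => (f w)^*%C) ->
  T f (j x) = j (T (fun w => f (q%:C * w)) x).
Proof.
move=> hg; have [cg _] := hg.
have qi : 0 < q <= 1 by case/andP: q01 => -> /ltW.
have [cd _] := dil_HolD qi hg.
have A1 : adj (T (fun w => (f w)^*%C)) (T f).
  have := adjC (T_adj cg); congr (adj _ (T _)).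
  by apply/funext => w; rewrite conjcK.
have A2 : adj (T (fun w => (f (q%:C * w))^*%C)) (T (fun w => f (q%:C * w))).
  have := adjC (T_adj cd); congr (adj _ (T _)).
  by apply/funext => w; rewrite conjcK.
have e : j \o T (fun w => (f w)^*%C) = T (fun w => (f (q%:C * w))^*%C) \o j.
  by apply/funext => y /=; exact: j_T_hol hg.
have B1 := adj_comp j_adj A1; have B2 := adj_comp A2 j_adj.
by rewrite e in B1; have := adj_uniq B1 B2 => /(congr1 (@^~ x)).
Qed.

Lemma zb_j x : zb (j x) = q%:C *: j (zb x).
Proof.
have hid : HolD (fun w : C => (w^*%C)^*%C).
  rewrite (_ : (fun w => _) = id); last by apply/funext => w; rewrite conjcK.
  split; first exact: cont_id.
  move=> w _; apply/derivable_cder; exists 1.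
  have := cder_lin 1 0 w; congr (cder _ _ _).
  by apply/funext => u; rewrite mul1r addr0.
have cj := @within_conj R id cont_id.
rewrite (j_T_antihol x hid) -(linZ _ _ jl) -(TZ _ _ cj); congr (j (T _ _)).
by apply/funext => w; rewrite conjM conjc_real.
Qed.

(** This is the form (j^-1 phi, B phi) with phi = j x. Polarization kills B j, and each E n is a
    nonzero multiple of [j (E n)]. *)
Lemma form_zero B M : lin B -> bd B M -> (forall x, dot x (B (j x)) = 0) -> forall x, B x = 0.
Proof.
move=> lB bB h; have H := polarization (lin_comp lB jl) h.
have [l0 b0] : lin (fun _ : V => 0 : V) /\ bd (fun _ : V => 0 : V) 0.
  by split => [c x y|x]; rewrite ?scaler0 ?addr0// mul0r N0.
apply: (ext_dense lB bB l0 b0) => n.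
have := H (E n); rewrite /= jE (linZ _ _ lB) => /eqP.
by rewrite scaler_eq0 (negPf (qn_neq0 n))/= => /eqP.
Qed.

End dilation.
End core.

(** * The Hardy space as a complete space with dense monomials *)

Section hardy_space.
Context (R : realType) (q : R).
Hypothesis hq : 0 < q < 1.
Local Notation C := R[i].
Local Notation cabs := (@ComplexField.Normc.normc R).
Local Notation mu := (disk_measure q).
Local Notation L2mu := (L2 mu).
Local Notation mono := (monomial q).
Local Notation H := (hardy q).
Implicit Types (x y : L2mu) (phi psi k : H) (f g : C -> C).

Definition hnorm phi : R := L2norm (val phi).
Definition hardy_mono n : H := Hardy (mono_cspan q n).

Lemma valD phi psi : val (phi + psi) = val phi + val psi. Proof. by rewrite raddfD. Qed.
Lemma valB phi psi : val (phi - psi) = val phi - val psi. Proof. by rewrite raddfB. Qed.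
Lemma valZ (c : C) phi : val (c *: phi) = c *: val phi. Proof. by rewrite linearZ. Qed.
Lemma val_sum n (c : nat -> C) (e : nat -> H) :
  val (\sum_(i < n) c i *: e i) = \sum_(i < n) c i *: val (e i).
Proof. 
elim: n => [|n IH]; first by rewrite !big_ord0; exact: raddf0.
rewrite big_ord_recr [RHS]big_ord_recr; apply: etrans (valD _ _) _.
by rewrite valZ; congr (_ + _); exact: IH. Qed.

Lemma hardy_ext phi psi : (forall k, hdot k phi = hdot k psi) -> phi = psi.
Proof.
move=> h; set d := phi - psi.
have hd : L2dot (val d) (val d) = 0.
  apply: etrans (congr1 (L2dot (val d)) (valB phi psi)) _; apply: etrans (L2dotBr _ _ _) _.
  by apply/eqP; rewrite subr_eq0; apply/eqP; exact: (h d).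
have := etrans (esym (L2dotxx (val d))) hd => -[] /eqP; rewrite sqrf_eq0 => /eqP/L2norm0_eq0 d0.
by apply: subr0_eq; apply: val_inj; apply: (etrans d0); exact: (esym (raddf0 _)).
Qed.

Lemma hdot_toeplitz k f phi : hdot k (toeplitz f phi) = L2dot (val k) (mulop f (val phi)).
Proof. exact: projP. Qed.

Lemma hdot_proj k x : hdot k (Defs.proj x) = L2dot (val k) x.
Proof. exact: projP. Qed.

Lemma proj_norm x : hnorm (Defs.proj x) <= L2norm x.
Proof.
set p := Defs.proj x; have [->|p0] := eqVneq (hnorm p) 0; first exact: L2norm_ge0.
have pp : 0 < hnorm p by rewrite lt_def p0 L2norm_ge0.
rewrite -(ler_pM2l pp) -expr2.
have := cauchy_schwarz (val p) x; rewrite -hdot_proj -/p /hdot L2dotxx cabsR ger0_norm ?sqr_ge0//.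
Qed.

Lemma proj_val phi : Defs.proj (val phi) = phi.
Proof. by apply: hardy_ext => k; rewrite hdot_proj. Qed.

Lemma proj_cspan x : x \in cspan mono -> val (Defs.proj x) = x.
Proof. by move=> xH; rewrite -[x]/(val (Hardy xH)) proj_val. Qed.

Lemma hardy_complete (u : nat -> H) : (forall e : R, 0 < e -> exists n0, forall m n,
    (n0 <= m)%N -> (n0 <= n)%N -> hnorm (u m - u n) <= e) ->
  exists l, forall e : R, 0 < e -> exists n0, forall n, (n0 <= n)%N -> hnorm (u n - l) <= e.
Proof.
move=> h; have [|l hl] := @L2complete _ _ _ mu (fun n => val (u n)).
  by move=> e /h[n0 hn]; exists n0 => m n mm nn; have := hn m n mm nn; rewrite /hnorm valB.
have lH : l \in cspan mono.
  apply: cspan_lim => e /hl[N /(_ N (leqnn _)) hN]; exists (val (u N)); first exact: valP.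
  by rewrite L2distC.
exists (Hardy lH) => e /hl[n0 hn]; exists n0 => n /hn; by rewrite /hnorm valB.
Qed.

Lemma hardy_dense phi (e : R) : 0 < e ->
  exists n (c : nat -> C), hnorm (phi - \sum_(i < n) c i *: hardy_mono i) < e.
Proof.
move=> e0; have /cspanP/(_ e e0)[y [n [c ->]] h] := valP phi.
by exists n, c; rewrite /hnorm valB val_sum.
Qed.

Lemma toeplitz_lin f : {within @disk R, continuous f} -> lin (@toeplitz R q f).
Proof.
move=> cf c phi psi; apply: hardy_ext => k.
apply: etrans (hdot_toeplitz k f _) _; rewrite valD valZ.
apply: etrans (congr1 (L2dot (val k)) (mulop_linear hq c (val phi) (val psi) cf)) _.
apply: etrans (L2dot_linear _ _ _ _) _; apply/esym.
apply: etrans (congr1 (L2dot (val k)) (etrans (valD _ _) (congr1 (+%R^~ _) (valZ _ _)))) _.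
apply: etrans (L2dot_linear _ _ _ _) _.
by congr (_ * _ + _); exact: hdot_toeplitz.
Qed.

End hardy_space.

(** * Algebraic properties of Toeplitz operators *)

Section hardy_toeplitz.
Context (R : realType) (q : R).
Hypothesis hq : 0 < q < 1.
Local Notation C := R[i].
Local Notation cabs := (@ComplexField.Normc.normc R).
Local Notation mu := (disk_measure q).
Local Notation L2mu := (L2 mu).
Local Notation mono := (monomial q).
Local Notation H := (hardy q).
Local Notation T := (@toeplitz R q).
Implicit Types (x y : L2mu) (phi psi k : H) (f g : C -> C).

Lemma toeplitz_bnd f (M : R) : cont f -> 0 <= M ->
  (forall z, disk z -> cabs (f z) <= M) -> bounded_by (@hnorm R q) (T f) M.
Proof.
move=> cf M0 hM phi; apply: le_trans (proj_norm hq _) _.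
exact: (mulop_norm hq (val phi) cf M0 hM).
Qed.

Lemma toeplitz_adj f : cont f -> adjoint_wrt (@hdot R q) (T (fun z => (f z)^*%C)) (T f).
Proof.
move=> cf phi psi; apply/esym; apply: etrans (hdot_toeplitz hq phi f psi) _.
rewrite (mulop_adj hq _ _ cf) [LHS]L2dotC; apply: etrans (esym (L2dotC _ _)).
by congr _^*%C; apply/esym; exact: (hdot_toeplitz hq).
Qed.

Lemma hdotDr k phi psi : hdot k (phi + psi) = hdot k phi + hdot k psi.
Proof. by rewrite /hdot valD; exact: L2dotDr. Qed.
Lemma hdotZr k c phi : hdot k (c *: phi) = c * hdot k phi.
Proof. by rewrite /hdot valZ; exact: L2dotZr. Qed.

Lemma toeplitzD f g phi : cont f -> cont g ->
  T (fun z => f z + g z) phi = T f phi + T g phi.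
Proof.
move=> cf cg; apply: (hardy_ext (q := q)) => k.
apply: etrans (hdot_toeplitz hq k _ phi) _; rewrite (mulopD hq (val phi) cf cg).
apply: etrans (L2dotDr _ _ _) _; apply/esym; apply: etrans (hdotDr _ _ _) _.
by congr (_ + _); exact: (hdot_toeplitz hq).
Qed.

Lemma toeplitzZ c f phi : cont f -> T (fun z => c * f z) phi = c *: T f phi.
Proof.
move=> cf; apply: (hardy_ext (q := q)) => k.
apply: etrans (hdot_toeplitz hq k _ phi) _; rewrite (mulopZ hq c (val phi) cf).
apply: etrans (L2dotZr _ _ _) _; apply/esym; apply: etrans (hdotZr _ _ _) _.
by congr (_ * _); exact: (hdot_toeplitz hq).
Qed.

Lemma toeplitz_eq f g phi : (forall z, disk z -> f z = g z) -> T f phi = T g phi.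
Proof. by move=> fg; rewrite /toeplitz (mulop_eq _ fg). Qed.

Lemma toeplitz1 phi : T (fun=> 1) phi = phi.
Proof. by rewrite /toeplitz (mulop1 hq) (proj_val hq). Qed.

Lemma cont_X n : cont (fun z : C => z ^+ n).
Proof.
rewrite (_ : (fun w => w ^+ n) = horner 'X^n); first exact: poly_continuous.
by apply/funext => w; rewrite hornerXn.
Qed.

Lemma mulop_X m n : mulop (fun z => z ^+ m) (mono n) = mono (m + n).
Proof.
rewrite mulop_mono//; last exact: cont_X.
apply: L2classP; first exact: (sqint_pmono hq n (@cont_X m)).
have := ae_and (repr_L2class (sqint_exp hq (m + n))) (ae_disk hq).
by apply: filterS => z [/(_ I) h Dz] _; rewrite patchE// -exprD -h.
Qed.

Lemma toeplitzX m n : T (fun z => z ^+ m) (hardy_mono q n) = hardy_mono q (m + n).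
Proof.
apply: val_inj; rewrite /toeplitz; have := mulop_X m n.
by move=> h; rewrite [val (hardy_mono q n)]/(mono n) h (proj_cspan hq)// mono_cspan.
Qed.

(** The Hardy space is stable under multiplication by z, so that T(id) is multiplication without
    projection; [toeplitz_near] needs this. *)
Lemma mulop_id_cspan x : x \in cspan mono -> mulop id x \in cspan mono.
Proof.
move=> /cspanP hx; apply: cspan_lim => e /hx[y [n [c ->]] xy].
have ci : cont (@id C) by exact: cont_id.
have lm : forall m, mulop id (\sum_(i < m) c i *: mono i) = \sum_(i < m) c i *: mono i.+1.
  elim=> [|m IH].
    rewrite !big_ord0; have := mulop_linear hq (-1) (0 : L2mu) 0 ci.
    by rewrite scaler0 addr0 scaleN1r addNr.
  rewrite !big_ord_recr/= -IH.
  transitivity (mulop id (c m *: mono m + \sum_(i < m) c i *: mono i)).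
    by apply: (congr1 (mulop id)); exact: addrC.
  rewrite (mulop_linear hq _ _ _ ci) [LHS]addrC; congr (_ + _).
  by congr (_ *: _); exact: (mulop_X 1 m).
exists (mulop id (\sum_(i < n) c i *: mono i)).
  by rewrite lm; apply: rpred_sum => i _; apply: rpredZ; exact: mono_cspan.
have -> : mulop id x - mulop id (\sum_(i < n) c i *: mono i) =
    mulop id (x - \sum_(i < n) c i *: mono i).
  by rewrite addrC -scaleN1r -(mulop_linear hq) // scaleN1r addrC.
apply: le_trans (ltW xy); rewrite -[leRHS]mul1r; apply: mulop_norm => // z.
by rewrite diskE.
Qed.

End hardy_toeplitz.

(** * Toeplitz operators near a boundary point; the Hardy space is a model *)

Section hardy_model.
Context (R : realType) (q : R).
Hypothesis hq : 0 < q < 1.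
Local Notation C := R[i].
Local Notation cabs := (@ComplexField.Normc.normc R).
Local Notation mu := (disk_measure q).
Local Notation L2mu := (L2 mu).
Local Notation mono := (monomial q).
Local Notation H := (hardy q).
Local Notation T := (@toeplitz R q).
Implicit Types (x y : L2mu) (phi psi k : H) (f g h : C -> C).

Lemma ler_of_eq (a b : R) : a = b -> a <= b. Proof. by move=> ->. Qed.

Lemma mC_abs (u : C -> C) : mC u -> mC (fun z => (cabs (u z))%:C).
Proof. by move=> mu_; split; [exact: mC_cabs|exact: measurable_cst]. Qed.

Lemma cabs_abs (z : C) : cabs (cabs z)%:C = cabs z.
Proof. by rewrite cabsR ger0_norm// cabs_ge0. Qed.

Lemma sqint_abs (u : C -> C) : sqint mu u -> sqint mu (fun z => (cabs (u z))%:C).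
Proof.
move=> su; have [mu_ _] := iffLR (sqintP _ _) su.
by apply: (sqint_le hq (mC_abs mu_) ler01 _ su) => z _; rewrite cabs_abs mul1r.
Qed.

(** The pointwise bound compares |f x| with e |x| + K |h x|; the triangle inequality in L2 is
    applied to the classes of the moduli. *)
Lemma mulop_split f h x (e K : R) : cont f -> cont h -> 0 <= e -> 0 <= K ->
  (forall z, disk z -> cabs (f z) <= e + K * cabs (h z)) ->
  L2norm (mulop f x) <= e * L2norm x + K * L2norm (mulop h x).
Proof.
move=> cf ch e0 K0 fh.
pose a := L2class mu (fun z => (cabs (repr x z))%:C).
pose b := L2class mu (fun z => (cabs (patch (fun=> 0) (@disk R) h z * repr x z))%:C).
have sx := repr_sqint x; have sh := sqint_mul hq x ch.
have sa := sqint_abs sx; have sb := sqint_abs sh.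
have na : L2norm a <= L2norm x.
  rewrite -[leRHS]mul1r -[x in leRHS]L2class_repr.
  by apply: (L2norm_le hq sa sx ler01) => z _; rewrite cabs_abs mul1r.
have nb : L2norm b <= L2norm (mulop h x).
  rewrite -[leRHS]mul1r.
  by apply: (L2norm_le hq sb sh ler01) => z _; rewrite cabs_abs mul1r.
apply: (@le_trans _ _ (L2norm (e%:C *: a + K%:C *: b))).
  rewrite /a /b -!L2classZ// -L2classD; [|exact: sqintZ|exact: sqintZ].
  rewrite -[leRHS]mul1r; apply: (L2norm_le hq) => //; first exact: sqint_mul.
    by apply: sqintD; exact: sqintZ.
  move=> z Dz; rewrite !patchE// mul1r -!rcM -rcD cabsR.
  apply: le_trans (ler_norm _); rewrite !cabsM mulrA -mulrDl.
  by rewrite ler_wpM2r ?cabs_ge0// fh.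
apply: le_trans (L2norm_triangle _ _) _; rewrite !L2normZr !cabsR !ger0_norm//.
by apply: lerD; rewrite ler_wpM2l.
Qed.

Lemma near_bound f (e : R) : cont f -> 0 < e -> exists2 K : R, 0 <= K &
  forall z w, disk z -> disk w -> cabs (f z - f w) <= e + K * cabs (z - w).
Proof.
move=> cf e0; have [M M0 hM] := disk_bounded cf; have [d d0 hd] := disk_unif cf e0.
(* Points closer than d differ by at most e under f; for the others 2 M is at most K times the
   distance. *)
exists (2 * M / d) => [|z w Dz Dw]; first by rewrite divr_ge0 ?mulr_ge0// ltW.
have zw0 := cabs_ge0 (z - w).
have [zw|zw] := ltP (cabs (z - w)) d.
  by apply: le_trans (hd _ _ Dz Dw zw) _; rewrite lerDl mulr_ge0// divr_ge0 ?mulr_ge0// ltW.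
apply: (@le_trans _ _ (2 * M)).
  by apply: le_trans (cabsB _ _) _; rewrite mulr_natl mulr2n lerD ?hM.
rewrite -[leLHS]add0r; apply: lerD; first exact: ltW.
by rewrite -mulrA ler_peMr ?mulr_ge0// mulrC ler_pdivlMr// mul1r.
Qed.

(** T(f) - f(w) is the projection of multiplication by f - f(w), which [near_bound] dominates by e +
    K |z - w|. On the Hardy space multiplication by z - w is T(id) - w itself. *)
Lemma toeplitz_near f : cont f -> forall e : R, 0 < e -> exists2 K : R, 0 <= K &
  forall w phi, cabs w = 1 ->
    hnorm (T f phi - f w *: phi) <= e * hnorm phi + K * hnorm (T id phi - w *: phi).
Proof.
move=> cf e e0; have [K K0 hK] := near_bound cf e0; exists K => // w phi w1.
have Dw : disk w by rewrite diskE w1.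
have ci : cont (@id C) by exact: cont_id.
have csub (g : C -> C) (c : C) : cont g -> cont (fun z => g z + c).
  by move=> cg z; apply: cvgD; [exact: cg|exact: cvg_cst].
have sub (g : C -> C) (c : C) : cont g ->
    mulop (fun z => g z + c) (val phi) = mulop g (val phi) + c *: val phi.
  move=> cg; rewrite (mulopD hq (val phi) cg (@within_cst R c)); congr (_ + _).
  have := mulopZ hq c (val phi) (@within_cst R 1); rewrite (mulop1 hq) => <-.
  by apply: (congr1 (fun g => mulop g (val phi))); apply/funext => z; rewrite mulr1.
have E (g : C -> C) (c : C) : cont g -> T (fun z => g z + c) phi = T g phi + c *: phi.
  move=> cg; rewrite (toeplitzD hq phi cg (@within_cst R c)); congr (_ + _).
  have := toeplitzZ hq c phi (@within_cst R 1); rewrite (toeplitz1 hq) => <-.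
  by congr (T _ phi); apply/funext => z; rewrite mulr1.
have e1 : T f phi - f w *: phi = T (fun z => f z + - f w) phi.
  by apply/esym; apply: etrans (E _ _ cf) _; congr (_ + _); exact: scaleNr.
have e2 : val (T id phi - w *: phi) = mulop (fun z => id z + - w) (val phi).
  rewrite (sub _ _ ci) scaleNr valB valZ; congr (_ - _).
  by apply/(proj_cspan hq)/(mulop_id_cspan hq)/valP.
apply: (@le_trans _ _ (L2norm (mulop (fun z => f z + - f w) (val phi)))).
  by apply: le_trans (ler_of_eq (congr1 (@hnorm R q) e1)) _; exact: (proj_norm hq).
apply: (@le_trans _ _ (e * hnorm phi + K * L2norm (mulop (fun z => id z + - w) (val phi)))); last first.
  by apply: lerD => //; apply: ler_wpM2l => //; apply: ler_of_eq; exact: (congr1 (fun x => L2norm x) (esym e2)).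
apply: (mulop_split (val phi) (csub _ (- f w) cf) (csub _ (- w) ci) (ltW e0) K0).
by move=> z Dz; exact: hK.
Qed.

Lemma hardy_model : exists rho_inf, toeplitz_model (@hdot R q) (@hnorm R q) (hardy_mono q) (rho q) rho_inf T.
Proof.
have [c c0 hc] := rho_lb hq; exists c.
split.
- by move=> s a x y; rewrite hdotDr hdotZr.
- by move=> x y; exact: L2dotC.
- by move=> x; exact: L2dotxx.
- by move=> x; exact: L2norm_ge0.
- by move=> x /L2norm0_eq0 h; apply: val_inj; rewrite h raddf0.
- by move=> x y; rewrite /hnorm valD; exact: L2norm_triangle.
- by move=> a x; rewrite /hnorm valZ; exact: L2normZr.
- by move=> x y; exact: cauchy_schwarz.
- exact: hardy_complete.
- by move=> k l; exact: (mono_dot hq).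
- exact: c0.
- exact: hc.
- exact: (rho_dec hq).
- exact: hardy_dense.
- by move=> f cf; exact: (toeplitz_lin hq cf).
- by move=> f M cf M0 hM; exact: (toeplitz_bnd hq cf M0 hM).
- by move=> f cf; exact: (toeplitz_adj hq cf).
- by move=> f g x cf cg; exact: (toeplitzD hq x cf cg).
- by move=> a f x cf; exact: (toeplitzZ hq a x cf).
- by move=> f g x; exact: toeplitz_eq.
- exact: (toeplitz1 hq).
- by move=> n; exact: (toeplitzX hq 1 n).
- exact: toeplitz_near.
- move=> f k l hf kl; apply: etrans (hdot_toeplitz hq _ _ _) _; exact: (hol_dot_lt hq hf kl).
- move=> f hf; have [a ha] := hol_dot_ge hq hf; exists a => r r01 k l lk.
  apply: etrans (hdot_toeplitz hq _ _ _) _; apply: etrans (ha r r01 k l lk) _.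
  by congr (_ * _); exact: L2dotxx.
Qed.

End hardy_model.

(** * The scaling operator on L2 and on the Hardy space *)

Section dilation_operator.
Context (R : realType) (q : R).
Hypothesis hq : 0 < q < 1.
Local Notation C := R[i].
Local Notation cabs := (@ComplexField.Normc.normc R).
Local Notation mu := (disk_measure q).
Local Notation L2mu := (L2 mu).
Local Notation mono := (monomial q).
Local Notation H := (hardy q).
Implicit Types (x y : L2mu) (phi psi : H) (u v : C -> C).

Lemma sqint_dilate u : sqint mu u -> sqint mu (fun z => u (q%:C * z)).
Proof.
move=> /sqintP[mu_ uy]; have [K K0 hK] := sqI_dilate hq.
apply/sqintP; split; first exact: mC_dilate.
by apply: le_lt_trans (hK _ mu_) _; rewrite lte_mul_pinfty// lee_fin.
Qed.

Lemma L2class0 : L2class mu (fun=> 0) = 0.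
Proof.
have s0 : sqint mu (fun=> 0 : C).
  by apply: (sqint_bdd hq (mC_cst _ 0) (lexx 0)) => z _; rewrite cabs0.
have := L2classZ 0 s0; rewrite scale0r => <-.
by apply: (congr1 (L2class mu)); apply/funext => z; rewrite mul0r.
Qed.

Lemma sqI_eq0 u : sqint mu u -> sqI mu u = 0%E -> u = (fun=> 0) %[ae mu].
Proof.
move=> su u0; have := L2norm_class su; rewrite u0 => -[] /eqP.
rewrite sqrf_eq0 => /eqP/L2norm0_eq0 c0.
have s0 : sqint mu (fun=> 0 : C).
  by apply: (sqint_bdd hq (mC_cst _ 0) (lexx 0)) => z _; rewrite cabs0.
have h1 := repr_L2class su; have h2 := repr_L2class s0; rewrite c0 -L2class0 in h1.
by apply: filterS (ae_and h1 h2) => z [/(_ I) <- /(_ I) ->].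
Qed.

(** Composition with z -> q z respects classes: by [sqI_dilate] the dilated difference has square
    integral 0. *)
Lemma ae_dilate u v : sqint mu u -> sqint mu v -> u = v %[ae mu] ->
  (fun z => u (q%:C * z)) = (fun z => v (q%:C * z)) %[ae mu].
Proof.
move=> su sv uv; have sd := sqintB su sv; have [md _] := iffLR (sqintP _ _) sd.
have d0 : sqI mu (fun z => u z - v z) = 0%E.
  have : sqI mu (fun z => u z - v z) = sqI mu (fun=> 0).
    apply: sqI_ae; [exact: md|exact: (mC_cst _ 0)|].
    by apply: filterS uv => z /(_ I) -> _; rewrite subrr.
  move=> ->; rewrite /sqI integral0_eq// => z _; by rewrite cabs0 expr0n.
have [K K0 hK] := sqI_dilate hq.
have : sqI mu (fun z => u (q%:C * z) - v (q%:C * z)) = 0%E.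
  apply/eqP; rewrite eq_le; apply/andP; split; last exact: sqI_ge0.
  by apply: le_trans (hK _ md) _; rewrite d0 mule0.
move=> /(sqI_eq0 (sqint_dilate sd)).
by apply: filterS => z /(_ I) /eqP; rewrite subr_eq0 => /eqP.
Qed.

Definition L2dilate x : L2mu := L2class mu (fun z => repr x (q%:C * z)).

Lemma repr_dil x : (repr (L2dilate x) : C -> C) = (fun z => repr x (q%:C * z)) %[ae mu].
Proof. by apply: repr_L2class; apply: sqint_dilate; exact: repr_sqint. Qed.

Lemma dil_linear (a : C) x y : L2dilate (a *: x + y) = a *: L2dilate x + L2dilate y.
Proof.
have sa := sqintZ a (repr_sqint x).
have h1 := ae_dilate (repr_sqint _) (sqintD sa (repr_sqint y)) (_ : _ = _ %[ae mu]).
apply: L2_eq; have e1 := reprD (a *: x) y; have e2 := reprZ a x.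
have {}h1 : (fun z => (repr (a *: x + y) : C -> C) (q%:C * z)) =
    (fun z => a * repr x (q%:C * z) + repr y (q%:C * z)) %[ae mu].
  by apply: h1; apply: filterS (ae_and e1 e2) => z [h2 h3] _; exact (etrans (h2 I) (congr1 (+%R^~ _) (h3 I))).
have := ae_and (ae_and (repr_dil (a *: x + y)) h1) (ae_and (reprD (a *: L2dilate x) (L2dilate y))
  (ae_and (reprZ a (L2dilate x)) (ae_and (repr_dil x) (repr_dil y)))).
apply: filterS => z [[k1 k2] [k3 [k4 [k5 k6]]]] _.
apply: etrans (etrans (k1 I) (k2 I)) _; apply/esym; apply: etrans (k3 I) _.
exact (congr2 +%R (etrans (k4 I) (congr1 ( *%R a) (k5 I))) (k6 I)).
Qed.

Lemma dil_norm : exists2 K : R, 0 <= K & forall x, L2norm (L2dilate x) <= K * L2norm x.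
Proof.
have [K K0 hK] := sqI_dilate hq; exists (Num.sqrt K) => [|x]; first exact: sqrtr_ge0.
rewrite -(ler_pXn2r (_ : 0 < 2)%N)// ?nnegrE ?mulr_ge0 ?sqrtr_ge0 ?L2norm_ge0//.
rewrite exprMn sqr_sqrtr// -lee_fin [(K * _)%:E]EFinM !L2norm_sqI.
apply: le_trans (hK _ (reprmC x)).
rewrite -L2norm_sqI L2norm_class//; exact: sqint_dilate (repr_sqint x).
Qed.

Lemma dil_mono n : L2dilate (mono n) = (q ^+ n)%:C *: mono n.
Proof.
have sn := sqint_exp hq n.
have h := ae_dilate (repr_sqint (mono n)) sn (repr_L2class sn).
apply: L2_eq; have := ae_and (repr_dil (mono n)) (ae_and h (ae_and (reprZ (q ^+ n)%:C (mono n)) (repr_L2class sn))).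
apply: filterS => z [/(_ I) -> [/(_ I) -> [/(_ I) -> /(_ I) ->]]] _.
by rewrite exprMn -rcX.
Qed.

Lemma dil0 : L2dilate 0 = 0.
Proof. by have := dil_linear (-1) 0 0; rewrite scaler0 addr0 scaleN1r addNr. Qed.

Lemma dil_sum n (c : nat -> C) :
  L2dilate (\sum_(i < n) c i *: mono i) = \sum_(i < n) (c i * (q ^+ i)%:C) *: mono i.
Proof.
elim: n => [|n IH]; first by rewrite !big_ord0 dil0.
rewrite !big_ord_recr/= -IH.
transitivity (L2dilate (c n *: mono n + \sum_(i < n) c i *: mono i)).
  by apply: (congr1 L2dilate); exact: addrC.
rewrite dil_linear [LHS]addrC; congr (_ + _); rewrite dil_mono; exact: scalerA.
Qed.

Lemma dil_cspan x : x \in cspan mono -> L2dilate x \in cspan mono.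
Proof.
move=> /cspanP hx; have [K K0 hK] := dil_norm; apply: cspan_lim => e e0.
have K1 : 0 < K + 1 by rewrite ltr_wpDl.
have [y [n [c ->]] xy] := hx _ (divr_gt0 e0 K1).
exists (L2dilate (\sum_(i < n) c i *: mono i)).
  by rewrite dil_sum; apply: rpred_sum => i _; apply: rpredZ; exact: mono_cspan.
have -> : L2dilate x - L2dilate (\sum_(i < n) c i *: mono i) = L2dilate (x - \sum_(i < n) c i *: mono i).
  by rewrite addrC -scaleN1r -dil_linear scaleN1r addrC.
apply: le_trans (hK _) _; apply: (@le_trans _ _ ((K + 1) * (e / (K + 1)))).
  by apply: ler_pM => //; [exact: L2norm_ge0|rewrite lerDl|exact: ltW].
by rewrite mulrC divfK// gt_eqF.
Qed.

Lemma val_jop phi : val (jop phi) = L2dilate (val phi).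
Proof.
pose S := [set psi : H | val (repr (val psi)) =
  (fun z => val (repr (val phi)) (q%:C * z)) %[ae mu]].
have S1 : S (Hardy (dil_cspan (valP phi))) by exact: repr_dil.
have h : S (jop phi) := xgetPex (0 : H) (ex_intro S _ S1).
apply: L2_eq; have := ae_and h (repr_dil (val phi)).
by apply: filterS => z [h1 h2] _; exact (etrans (h1 I) (esym (h2 I))).
Qed.

Lemma jop_lin : lin (@jop R q).
Proof.
move=> c x y; apply: val_inj; have e (u v : H) : val (c *: u + v) = c *: val u + val v.
  by rewrite valD valZ.
rewrite val_jop !e dil_linear; apply/esym; apply: etrans (e _ _) _.
by rewrite !val_jop.
Qed.

Lemma jop_bnd : exists2 K : R, 0 <= K & bounded_by (@hnorm R q) (@jop R q) K.
Proof.
have [K K0 hK] := dil_norm; exists K => // phi; rewrite /hnorm val_jop; exact: hK.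
Qed.

Lemma jop_mon n : jop (hardy_mono q n) = (q ^+ n)%:C *: hardy_mono q n.
Proof. by apply: val_inj; rewrite val_jop valZ; exact: dil_mono. Qed.

End dilation_operator.

(** * The algebra C(D_q) and its weakly holomorphic elements *)

Section quantum_disk_algebra.
Context (R : realType) (q : R).
Hypothesis hq : 0 < q < 1.
Local Notation C := R[i].
Local Notation cabs := (@ComplexField.Normc.normc R).
Local Notation Re := complex.Re.
Local Notation H := (hardy q).
Local Notation T := (@toeplitz R q).
Local Notation dot := (@hdot R q).
Local Notation N := (@hnorm R q).
Local Notation bd := (bounded_by N).
Local Notation adj := (adjoint_wrt dot).
Local Notation z := (@zop R q).
Local Notation zb := (@zbar R q).
Local Notation j := (@jop R q).
Variable rho_inf : R.
Hypothesis hm : toeplitz_model dot N (hardy_mono q) (rho q) rho_inf T.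
Implicit Types (phi psi x y : H) (a b : H -> H) (f g : C -> C).

Lemma normH phi : `|phi| = (N phi)%:C. Proof. by []. Qed.

Lemma bounded_opP a : bounded_op a <-> lin a /\ exists M, bd a M.
Proof.
split=> -[la [M hM]]; split=> //; exists M => phi; have := hM phi;
  by rewrite !normH -rmorphM lecR.
Qed.

Lemma hN0 : N 0 = 0. Proof. exact: (N0 hm). Qed.

Lemma hN_ge0 phi : 0 <= N phi. Proof. exact: (m_N_ge0 hm). Qed.

Lemma hNZ c phi : N (c *: phi) = cabs c * N phi. Proof. exact: (m_NZ hm). Qed.

Lemma opnorm_le a (M : R) : 0 <= M -> bd a M -> opnorm a <= M.
Proof.
move=> M0 hM; apply: ge_sup => [|_ [phi h <-]].
  by exists (Re `|a 0|), 0 => //=; rewrite normH hN0.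
move: h; rewrite /= !normH lecR => h; apply: le_trans (hM phi) _.
by rewrite ler_piMr.
Qed.

Lemma opnorm_has_sup a M : bd a M -> has_sup [set Re `|a phi| | phi in [set phi : H | `|phi| <= 1]].
Proof.
move=> hM; have [M' M0 hM'] := bd_pos hm hM; split.
  by exists (Re `|a 0|), 0 => //=; rewrite normH hN0.
exists M' => _ [phi h <-]; move: h; rewrite /= !normH lecR => h; apply: le_trans (hM' phi) _.
by rewrite ler_piMr// ltW.
Qed.

Lemma opnorm_ge0 a M : bd a M -> 0 <= opnorm a.
Proof.
move=> hM; apply: (@le_trans _ _ (N (a 0))); first exact: hN_ge0.
apply: (ub_le_sup (opnorm_has_sup hM).2); exists 0 => //=.
by rewrite normH hN0.
Qed.

Lemma opnorm_bd a M : lin a -> bd a M -> bd a (opnorm a).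
Proof.
move=> la hM phi; have [p0|p0] := eqVneq (N phi) 0.
  by rewrite (m_N_eq0 hm p0) (lin0 la) hN0 mulr0.
have pp : 0 < N phi by rewrite lt_def p0 hN_ge0.
rewrite -ler_pdivrMr//; apply: (ub_le_sup (opnorm_has_sup hM).2).
exists ((N phi)^-1%:C *: phi).
  by rewrite /= normH hNZ cabsR ger0_norm ?invr_ge0 ?(ltW pp)// mulVf.
by rewrite -[LHS]/(N _) (linZ _ _ la) hNZ cabsR ger0_norm ?invr_ge0 ?(ltW pp)// mulrC.
Qed.

Lemma bd_approx a b (e M K : R) : lin a -> bd a M -> lin b -> bd b K -> opnorm (a \- b) < e ->
  bd (fun x => a x - b x) e.
Proof.
move=> la ha lb hb ab; apply: (bd_wk hm (ltW ab)).
apply: (@opnorm_bd (a \- b) (M + K)); first exact: lin_sub.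
by move=> x; apply: le_trans (NB hm _ _) _; rewrite mulrDl; exact: lerD.
Qed.

Local Notation gd := (symbolic dot N (hardy_mono q) (rho q)).

Lemma good_cstar : cstar_algebra gd.
Proof.
split.
- by move=> a [la [M hM] _]; apply/bounded_opP; split=> //; exists M.
- by move=> a b ga gb; exact (goodD hm ga gb).
- by move=> c a ga; exact (goodZ hm c ga).
- by move=> a b ga gb; exact (good_comp hm ga gb).
- move=> a ga; have [_ _ [b [g [ab _ _]]]] := ga; 
  by exists b; [exact (good_adj hm ga ab)|exact ab].
move=> a /bounded_opP[la [M hM]] h; apply: (good_closed hm la hM) => e /h[b gb ab].
have [lb [K hK] _] := gb; exists b; first exact gb.
exact (bd_approx la hM lb hK ab).
Qed.

Lemma CDq_good a : CDq a -> gd a.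
Proof. by move=> ha; apply: (ha _ good_cstar) => f cf; exact (good_T hm cf). Qed.

Lemma CDq_T f : cont f -> CDq (T f).
Proof. by move=> cf S HS HT; exact: HT. Qed.

Lemma CDq_lin a : CDq a -> lin a. Proof. by move=> /CDq_good[]. Qed.

Lemma CDq_bd a : CDq a -> bd a (opnorm a).
Proof. by move=> /CDq_good[la [M hM] _]; exact: opnorm_bd hM. Qed.

Lemma CDqD a b : CDq a -> CDq b -> CDq (a \+ b).
Proof. by move=> ha hb S HS HT; apply: (cstarD HS); [exact: ha|exact: hb]. Qed.

Lemma CDqZ (c : C) a : CDq a -> CDq (c \*: a).
Proof. by move=> ha S HS HT; apply: (cstarZ HS); exact: ha. Qed.

Lemma CDqM a b : CDq a -> CDq b -> CDq (a \o b).
Proof. by move=> ha hb S HS HT; apply: (cstar_comp HS); [exact: ha|exact: hb]. Qed.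

Lemma CDq_adj a b : CDq a -> adj a b -> CDq b.
Proof.
move=> ha ab S HS HT; have [b' Sb' ab'] := cstar_adjoint HS (ha S HS HT).
by rewrite (adj_uniq hm ab ab').
Qed.

Lemma cont_conj : cont (fun w : C => w^*%C). Proof. exact: (@within_conj R id (@cont_id R)). Qed.

Lemma T1E : T (fun=> 1) = id. Proof. by apply/funext => x; exact: (m_T1 hm). Qed.

Lemma CDq_id : CDq (@id H).
Proof. by rewrite -T1E; apply: CDq_T; exact: (@within_cst R 1). Qed.

Lemma CDq_adjoint_ex a : CDq a -> exists b, adj a b.
Proof. by move=> /CDq_good[_ _ [b [g [ab _ _]]]]; exists b. Qed.

Lemma z_lin : lin z. Proof. exact: (m_T_lin hm (@cont_id R)). Qed.
Lemma zb_lin : lin zb. Proof. exact: (m_T_lin hm cont_conj). Qed.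
Lemma z_bd : bd z 1.
Proof. by apply: (m_T_bd hm (@cont_id R) ler01) => w; rewrite diskE. Qed.
Lemma zb_bd : bd zb 1.
Proof. by apply: (m_T_bd hm cont_conj ler01) => w; rewrite diskE cabsJ. Qed.
Lemma zb_z_adj : adj zb z. Proof. exact: (m_T_adj hm (@cont_id R)). Qed.

Lemma j_injective x y : j x = j y -> x = y.
Proof. have [K K0 hK] := jop_bnd hq; exact: (j_inj hm hq (jop_lin hq) hK (jop_mon hq)). Qed.

Lemma jinvK x : jinv (j x) = x.
Proof.
have := xgetPex (0 : H) (ex_intro (fun phi => j phi = j x) x erefl).
rewrite -/(jinv (j x)); exact: j_injective.
Qed.

(** With c = [zop] these are the weakly holomorphic elements, with c = [zbar] the weakly
    antiholomorphic ones; adjunction exchanges the two. *)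
Definition commutant (c : H -> H) : set (H -> H) :=
  [set a | CDq a /\ forall x, a (c x) = c (a x)].

Lemma commutant_form a c M (k : C) : CDq a -> lin c -> bd c M -> k != 0 ->
  (forall phi, jdom phi -> k * hdot (jinv phi) (c (a phi) - a (c phi)) = 0) <->
  (forall x, a (c x) = c (a x)).
Proof.
move=> ha lc hc k0; have la := CDq_lin ha; have ba := CDq_bd ha.
split=> [h x|h phi _]; last by rewrite h subrr (dot0r hm) mulr0.
have [M' M0 hM'] := bd_pos hm hc; have [K' K0 hK'] := bd_pos hm ba.
have [L _ hL] := jop_bnd hq.
apply/eqP; rewrite eq_sym -subr_eq0; apply/eqP; move: x.
apply: (@form_zero _ _ _ _ _ _ _ _ hm q j hq (jop_lin hq) (jop_mon hq)
  (fun x => c (a x) - a (c x)) (M' * K' + K' * M')).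
- exact: (lin_sub (lin_comp lc la) (lin_comp la lc)).
- move=> x; apply: le_trans (NB hm _ _) _; rewrite mulrDl; apply: lerD.
    exact: (bd_comp (ltW M0) hM' hK').
  exact: (bd_comp (ltW K0) hK' hM').
move=> x; have := h (j x) (ex_intro2 _ _ x I erefl).
by rewrite jinvK => /eqP; rewrite mulf_eq0 (negPf k0)/= => /eqP.
Qed.

Lemma q1_neq0 : (1 - q)^-1%:C != 0 :> C.
Proof.
have [_ q1] := andP hq; rewrite -cabs_gt0 cabsR normr_gt0 invr_neq0//.
by rewrite subr_eq0 gt_eqF.
Qed.

Lemma weakly_holE : @weakly_hol R q = commutant z.
Proof.
have k0 : (q - 1)^-1%:C != 0 :> C.
  have [_ q1] := andP hq; rewrite -cabs_gt0 cabsR normr_gt0 invr_neq0//.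
  by rewrite subr_eq0 lt_eqF.
apply/seteqP; split => a [ha h]; split => //.
  exact: iffLR (commutant_form ha z_lin z_bd k0) h.
exact: iffRL (commutant_form ha z_lin z_bd k0) h.
Qed.

Lemma weakly_antiholE : @weakly_antihol R q = commutant zb.
Proof.
apply/seteqP; split => a [ha h]; split => //.
  exact: iffLR (commutant_form ha zb_lin zb_bd q1_neq0) h.
exact: iffRL (commutant_form ha zb_lin zb_bd q1_neq0) h.
Qed.

Lemma commutant_adj a b c d : adj a b -> adj c d -> commutant c a -> commutant d b.
Proof.
move=> ab cd [ha h]; split; first exact: CDq_adj ab.
have e : a \o c = c \o a by apply/funext => x; exact: h.
have := adj_uniq hm (adj_comp ab cd); rewrite e => /(_ _ (adj_comp cd ab)).
by move=> e' x; have := congr1 (@^~ x) e'.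
Qed.

Lemma commutant_subalgebra c M : lin c -> bd c M -> banach_subalgebra (commutant c).
Proof.
move=> lc hc; split.
- by move=> a [].
- by split; [exact: CDq_id|].
- move=> a b [ha ca] [hb cb]; split; first exact: CDqD.
  by move=> x /=; rewrite ca cb (linD _ _ lc).
- move=> k a [ha ca]; split; first exact: CDqZ.
  by move=> x /=; rewrite ca (linZ _ _ lc).
- move=> a b [ha ca] [hb cb]; split; first exact: CDqM.
  by move=> x /=; rewrite cb ca.
move=> a ha happ; split=> // x; apply/eqP; rewrite -subr_eq0; apply/eqP.
have [M' M0 hM'] := bd_pos hm hc.
apply: (N_le0 hm) => e e0; pose K := N (c x) + M' * N x + 1.
have K0 : 0 < K by rewrite ltr_wpDl// addr_ge0 ?hN_ge0// mulr_ge0 ?hN_ge0// ltW.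
have [b [hb cb] ab] := happ _ (divr_gt0 e0 K0).
have B := bd_approx (CDq_lin ha) (CDq_bd ha) (CDq_lin hb) (CDq_bd hb) ab.
have -> : a (c x) - c (a x) = (a (c x) - b (c x)) - c (a x - b x).
  by rewrite (linB _ _ lc) -cb opprB addrA subrK.
apply: le_trans (NB hm _ _) _.
apply: (@le_trans _ _ (e / K * (N (c x) + M' * N x))).
  rewrite mulrDr; apply: lerD; first exact: B.
  apply: le_trans (hM' _) _; rewrite mulrCA; apply: ler_wpM2l; first exact: ltW.
  exact: B.
apply: (@le_trans _ _ (e / K * K)); last by rewrite divfK// gt_eqF.
by apply: ler_wpM2l; [rewrite divr_ge0// ltW|rewrite lerDl].
Qed.

Lemma hol_T f : HolD f -> commutant z (T f).
Proof.
move=> hf; have [cf _] := hf; split; first exact: CDq_T.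
by have [_ _ h] := hol_an hm hf.
Qed.

Lemma analytic_commutant a : commutant z a -> analytic N T a.
Proof.
move=> [ha h]; split; [exact: CDq_lin|by exists (opnorm a); exact: CDq_bd|exact: h].
Qed.

Lemma T_hol a : commutant z a -> exists2 f, HolD f & a = T f.
Proof.
move=> ha; have [_ _ [b [g [_ sg _]]]] := CDq_good ha.1.
have [F [HF _ _ TF]] := an_lim hm (analytic_commutant ha) sg; exists F => //.
by apply/funext => x; exact: TF.
Qed.

End quantum_disk_algebra.

Local Opaque toeplitz.

(** * Supremum norms, inverses and conjugates in the disk algebra *)

Section supremum_norms.
Context (R : realType).
Local Notation C := R[i].
Local Notation cabs := (@ComplexField.Normc.normc R).
Local Notation Re := complex.Re.
Implicit Types (f g : C -> C) (A : set C).

Lemma supnorm_le A f (M : R) : A !=set0 -> (forall w, A w -> cabs (f w) <= M) -> supnorm A f <= M.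
Proof.
move=> [a Aa] h; apply: ge_sup; first by exists (Re `|f a|), a.
by move=> _ [w Aw <-]; exact: h.
Qed.

Lemma supnorm_ge A f (M : R) w : (forall w, A w -> cabs (f w) <= M) -> A w -> cabs (f w) <= supnorm A f.
Proof.
move=> h Aw; apply: ub_le_sup; last by exists w.
by exists M => _ [u Au <-]; exact: h.
Qed.

Lemma supnorm_eq A f g : (forall w, A w -> cabs (f w) = cabs (g w)) -> supnorm A f = supnorm A g.
Proof.
move=> fg; congr sup; apply/seteqP; split => _ [w Aw <-]; exists w => //.
  by rewrite cnormE -fg.
by rewrite cnormE fg.
Qed.

Lemma disk_neq0 : @disk R !=set0.
Proof. by exists 0; rewrite diskE cabs0. Qed.

Lemma circle_neq0 : @circle R !=set0.
Proof. by exists 1; apply/circleE; rewrite cabs1. Qed.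

Lemma HolD_inv f (m : R) : 0 < m -> HolD f -> (forall w, disk w -> m <= cabs (f w)) ->
  HolD (fun w => (f w)^-1).
Proof.
move=> m0 hf hm; have [/within_cabsP cf _] := hf.
have f0 w : disk w -> f w != 0 by move=> /hm h; rewrite -cabs_gt0; exact: lt_le_trans h.
split.
  apply/within_cabsP => p Dp e e0; have [d d0 hd] := cf p Dp _ (mulr_gt0 e0 (mulr_gt0 m0 m0)).
  exists d => // w Dw wp; have fw := f0 w Dw; have fp := f0 p Dp.
  have -> : (f w)^-1 - (f p)^-1 = (f p - f w) * ((f w)^-1 * (f p)^-1) by field; rewrite fw fp.
  rewrite !cabsM !cabsV cabsBC -invfM ler_pdivrMr; last by rewrite mulr_gt0// cabs_gt0.
  apply: le_trans (hd _ Dw wp) _; apply: ler_wpM2l; first exact: ltW.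
  by apply: ler_pM; rewrite ?(ltW m0)//; exact: hm.
move=> w; rewrite cnormE ltcR => w1; apply/derivable_cder.
have [d hd] := HolD_cder hf w1.
have fw : f w != 0 by apply: f0; rewrite diskE ltW.
by exists (- (f w) ^- 2 * d); exact: cder_comp hd (cder_inv fw).
Qed.

Lemma HolD_poly (p : {poly C}) : HolD (horner p).
Proof.
by apply: (@ulim_poly_HolD R (fun=> p)) => e e0; exists 0%N => n _ w _; rewrite subrr cabs0 ltW.
Qed.

Lemma AntiHolD_conj f : AntiHolD f -> HolD (fun w => (f w)^*%C).
Proof. by move=> [cf hf]; split; [exact (@within_conj R f cf)|exact hf]. Qed.

Lemma HolD_conj f : HolD (fun w => (f w)^*%C) -> AntiHolD f.
Proof.
move=> [cf hf]; split; last exact hf.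
have ff : (fun w => ((f w)^*%C)^*%C) = f by apply/funext => w; rewrite conjcK.
by have := @within_conj R _ cf; rewrite ff.
Qed.

End supremum_norms.

(** * Norm of T(f), maximum principle and isomorphism *)

Section main.
Context (R : realType) (q : R).
Hypothesis hq : 0 < q < 1.
Local Notation C := R[i].
Local Notation cabs := (@ComplexField.Normc.normc R).
Local Notation Re := complex.Re.
Local Notation H := (hardy q).
Local Notation T := (@toeplitz R q).
Local Notation dot := (@hdot R q).
Local Notation N := (@hnorm R q).
Local Notation bd := (bounded_by N).
Local Notation adj := (adjoint_wrt dot).
Local Notation z := (@zop R q).
Local Notation zb := (@zbar R q).
Local Notation j := (@jop R q).
Variable rho_inf : R.
Hypothesis hm : toeplitz_model dot N (hardy_mono q) (rho q) rho_inf T.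
Implicit Types (phi psi x y : H) (a b : H -> H) (f g : C -> C).

Lemma hol_poly_approx f (e : R) : HolD f -> 0 < e ->
  exists p : {poly C}, forall w, disk w -> cabs (p.[w] - f w) <= e.
Proof.
by move=> hf /(hol_ulim hm hf)[n0 h]; eexists => w; exact: (h n0 (leqnn _) w).
Qed.

Lemma hol_circle_bound f M : HolD f -> (forall w, cabs w = 1 -> cabs (f w) <= M) ->
  forall w, disk w -> cabs (f w) <= M.
Proof.
move=> hf hM w Dw; apply/ler_addgt0Pr => e e0; have e20 : 0 < e / 2 by rewrite divr_gt0.
have [p h] := hol_poly_approx hf e20.
have hp u : cabs u = 1 -> cabs p.[u] <= M + e / 2.
  move=> u1; have := cabs_dist p.[u] 0 (f u); rewrite !subr0 => /le_trans; apply.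
  by rewrite addrC lerD ?hM// h// diskE u1.
have := cabs_dist (f w) 0 p.[w]; rewrite !subr0 cabsBC => /le_trans; apply.
rewrite diskE in Dw; rewrite [e]splitr addrA addrC lerD ?(poly_max_circle hp Dw)//.
by apply: h; rewrite diskE.
Qed.

Lemma opnorm_T f : HolD f -> opnorm (T f) = supnorm (@disk R) f.
Proof.
move=> hf; have [cf _] := hf; have [M M0 hM] := disk_bounded cf.
have bT := CDq_bd hm (CDq_T cf).
apply/eqP; rewrite eq_le; apply/andP; split.
  have s0 : 0 <= supnorm (@disk R) f.
    by have [w Dw] := disk_neq0 R; apply: le_trans (supnorm_ge hM Dw); exact: cabs_ge0.
  apply: (opnorm_le hm s0); apply: (m_T_bd hm cf s0) => w Dw; exact: supnorm_ge hM Dw.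
apply: (supnorm_le (disk_neq0 R)) => w Dw.
exact: (hol_bound hm hf bT (opnorm_ge0 hm bT) Dw).
Qed.

Lemma supnorm_circle f : HolD f -> supnorm (@disk R) f = supnorm (@circle R) f.
Proof.
move=> hf; have [cf _] := hf; have [M M0 hM] := disk_bounded cf.
have hc w : circle w -> disk w by move=> /circleE; rewrite diskE => ->.
apply/eqP; rewrite eq_le; apply/andP; split.
  apply: (supnorm_le (disk_neq0 R)); apply: hol_circle_bound => // w /circleE w1.
  by apply: supnorm_ge w1 => u /hc; exact: hM.
by apply: (supnorm_le (circle_neq0 R)) => w /hc Dw; exact: supnorm_ge hM Dw.
Qed.

Section symbol.
Variable sigma : (H -> H) -> C -> C.
Hypothesis hs : symbol_map sigma.
Variable z0 : C.
Hypothesis z01 : circle z0.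

(** [symbol_map] does not list unitality; it follows by multiplying with an element whose symbol is
    the constant 1, which surjectivity provides. *)
Lemma sigma_id : sigma id z0 = 1.
Proof.
have [a ha sa] := symbol_surj hs (g := fun=> 1) (fun w => cvg_cst _).
have := symbolM hs (CDq_id hm) ha z01.
by rewrite (_ : id \o a = a)// sa// mulr1 => <-.
Qed.

Lemma sigma_lin f g c : HolD f -> HolD g ->
  sigma (T (fun w => f w + c * g w)) z0 = sigma (T f) z0 + c * sigma (T g) z0.
Proof.
move=> hf hg; have [cf _] := hf; have [cg _] := hg; have [cc _] := HolDZ c hg.
have -> : T (fun w => f w + c * g w) = T f \+ (c \*: T g).
  by apply/funext => x /=; rewrite (m_TD hm x cf cc) (m_TZ hm c x cg).
rewrite (symbolD hs (CDq_T cf) (CDqZ c (CDq_T cg)) z01).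
by rewrite (symbolZ hs c (CDq_T cg) z01).
Qed.

Lemma sigma_mul f g : HolD f -> HolD g ->
  sigma (T (fun w => f w * g w)) z0 = sigma (T f) z0 * sigma (T g) z0.
Proof.
move=> hf hg; have [cf _] := hf; have [cg _] := hg.
have -> : T (fun w => f w * g w) = T f \o T g.
  by apply/funext => x; exact: (T_mul hm x hf hg).
exact: (symbolM hs (CDq_T cf) (CDq_T cg) z01).
Qed.

Lemma sigma_one : sigma (T (fun=> 1)) z0 = 1.
Proof. by rewrite (T1E hm) sigma_id. Qed.

(* Otherwise f - c, with c the value of the symbol, would be invertible in the
   disk algebra although the symbol of T(f - c) vanishes at z0. *)
Lemma sigma_le f (M : R) : HolD f -> (forall w, disk w -> cabs (f w) <= M) ->
  cabs (sigma (T f) z0) <= M.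
Proof.
have [c cE] : exists c, sigma (T f) z0 = c by exists (sigma (T f) z0).
move=> hf hM; rewrite cE leNgt; apply/negP => Mc.
have h1 := HolD_cst (1 : C); have hg := HolDD hf (HolDZ (- c) h1).
pose m := cabs c - M; have m0 : 0 < m by rewrite subr_gt0.
have gm w : disk w -> m <= cabs (f w + - c * 1).
  move=> Dw; rewrite mulr1 /m lerBlDr; have := cabs_dist c 0 (f w); rewrite !subr0 cabsBC.
  by move=> /le_trans; apply; rewrite lerD2l hM.
have hi := HolD_inv m0 hg gm.
have : sigma (T (fun w => (f w + - c * 1)^-1 * (f w + - c * 1))) z0 = 1.
  apply: etrans sigma_one; apply: (congr1 (fun a => sigma a z0)); apply/funext => x.
  apply: (m_T_eq hm) => w Dw.
  by rewrite mulVf// -cabs_gt0; exact: lt_le_trans (gm w Dw).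
have e0 : sigma (T (fun w => f w + - c * 1)) z0 = 0.
  apply: etrans (sigma_lin (- c) hf h1) _.
  by apply: etrans (congr2 (fun u v => u + - c * v) cE sigma_one) _; rewrite mulr1 subrr.
have alg (u v : C) : v = 0 -> u * v <> 1.
  by move=> ->; rewrite mulr0 => /eqP; rewrite eq_sym oner_eq0.
move=> h; exact (alg _ _ e0 (etrans (esym (sigma_mul hi hg)) h)).
Qed.

Lemma sigma_poly (p : {poly C}) : sigma (T (horner p)) z0 = p.[z0].
Proof.
have h1 := HolD_cst (1 : C).
elim/poly_ind: p => [|p c IH].
  have e : horner (0 : {poly C}) = (fun w : C => 1 + -1 * 1 : C) by apply/funext => w; rewrite horner0 mulr1 subrr.
  apply: etrans (congr1 (fun f => sigma (T f) z0) e) _; apply: etrans (sigma_lin (-1) h1 h1) _.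
  by apply: etrans (congr2 (fun u v => u + -1 * v) sigma_one sigma_one) _; rewrite horner0 mulr1 subrr.
have hid : HolD (@id C).
  by have := HolD_poly ('X : {poly C}); congr HolD; apply/funext => w; rewrite hornerX.
have hp := HolD_poly p.
have e : horner (p * 'X + c%:P) = (fun w => p.[w] * id w + c * 1).
  by apply/funext => w; rewrite hornerMXaddC mulr1.
apply: etrans (congr1 (fun f => sigma (T f) z0) e) _.
apply: etrans (sigma_lin c (HolDM hp hid) h1) _.
have e1 := etrans (sigma_mul hp hid) (congr2 *%R IH (symbol_z hs z01)).
by apply: etrans (congr2 (fun u v => u + c * v) e1 sigma_one) _; rewrite hornerMXaddC mulr1.
Qed.

Lemma sigma_T f : HolD f -> sigma (T f) z0 = f z0.
Proof.
move=> hf; apply/eqP; rewrite -subr_eq0 -cabs_eq0 eq_le cabs_ge0 andbT.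
apply/ler_addgt0Pl => e e0; rewrite addr0; have e20 : 0 < e / 2 by rewrite divr_gt0.
have [p h] := hol_poly_approx hf e20.
have hp := HolD_poly p.
have h' w : disk w -> cabs (f w + -1 * p.[w]) <= e / 2.
  by move=> Dw; rewrite mulN1r cabsBC; exact: h.
have sE := etrans (sigma_lin (-1) hf hp) (congr1 (fun v => _ + -1 * v) (sigma_poly p)).
have k : cabs (sigma (T f) z0 + -1 * p.[z0]) <= e / 2.
  by apply: le_trans (sigma_le (HolDD hf (HolDZ (-1) hp)) h'); apply: ler_of_eq; exact: (congr1 cabs (esym sE)).
rewrite mulN1r in k.
have k0 : disk z0 by move/circleE: z01; rewrite diskE => ->.
rewrite [e]splitr; apply: le_trans (cabs_dist _ _ p.[z0]) _.
by apply: lerD => //; exact: h.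
Qed.

End symbol.

Lemma max_principle sigma f : symbol_map sigma -> HolD f ->
  opnorm (T f) = supnorm (@circle R) (sigma (T f)).
Proof.
move=> hs hf; rewrite opnorm_T// supnorm_circle//; apply: supnorm_eq => w w1.
by rewrite (sigma_T hs w1 hf).
Qed.

Lemma hol_iso : isometric_alg_iso (@HolD R) (commutant z) T.
Proof.
split.
- by move=> f hf; exact: (hol_T hm hf).
- by move=> a /(T_hol hm)[f hf ->]; exists f.
- move=> f g hf hg; split=> [fg w|fg].
    by rewrite inE => Dw; apply: (hol_eq hm hf hg _ Dw) => x; rewrite fg.
  by apply/funext => x; apply: (m_T_eq hm) => w Dw; apply: fg; rewrite inE.
- exact: (T1E hm).
- by move=> f g [cf _] [cg _]; apply/funext => x; exact: (m_TD hm x cf cg).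
- by move=> c f [cf _]; apply/funext => x; exact: (m_TZ hm c x cf).
- by move=> f g hf hg; apply/funext => x; exact: (T_mul hm x hf hg).
- exact: opnorm_T.
Qed.

(** * The antiholomorphic statements, by adjunction *)

Lemma opnorm_adj a b : CDq a -> adj a b -> opnorm a = opnorm b.
Proof.
move=> ha ab; have hb := CDq_adj hm ha ab.
have Ba := CDq_bd hm ha; have Bb := CDq_bd hm hb.
have Oa := opnorm_ge0 hm Ba; have Ob := opnorm_ge0 hm Bb.
apply/eqP; rewrite eq_le; apply/andP; split; apply: (opnorm_le hm) => //.
  exact: (adj_bd hm Ob (adjC hm ab) Bb).
exact: (adj_bd hm Oa ab Ba).
Qed.

Lemma anti_adj f : AntiHolD f -> adj (T f) (T (fun w => (f w)^*%C)).
Proof.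
move=> [cf _]; have e : (fun w => ((f w)^*%C)^*%C) = f by apply/funext => w; rewrite conjcK.
have h := m_T_adj hm (@within_conj R f cf).
exact (eq_ind _ (fun g => adj (T g) (T (fun w => (f w)^*%C))) h _ e).
Qed.

Lemma antihol_T f : AntiHolD f -> commutant zb (T f).
Proof.
move=> hf; apply: (commutant_adj hm (adjC hm (anti_adj hf)) (adjC hm (zb_z_adj hm))).
exact: (hol_T hm (AntiHolD_conj hf)).
Qed.

Lemma T_antihol a : commutant zb a -> exists2 f, AntiHolD f & a = T f.
Proof.
move=> ha; have [b ab] := CDq_adjoint_ex hm ha.1.
have [g hg bg] := T_hol hm (commutant_adj hm ab (zb_z_adj hm) ha).
have [cg _] := hg; have hg' : AntiHolD (fun w => (g w)^*%C).
  by apply: HolD_conj; move: hg; congr HolD; apply/funext => w; rewrite conjcK.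
exists (fun w => (g w)^*%C); first exact hg'.
have ab' : adj a (T g) by rewrite -bg; exact ab.
exact (adj_uniq hm (adjC hm ab') (adjC hm (m_T_adj hm cg))).
Qed.

Lemma antihol_max_principle sigma f : symbol_map sigma -> AntiHolD f ->
  opnorm (T f) = supnorm (@circle R) (sigma (T f)).
Proof.
move=> hs hf; have hg := AntiHolD_conj hf; have [cf _] := hf; have [cg _] := hg.
rewrite (opnorm_adj (CDq_T cf) (anti_adj hf)) (max_principle hs hg).
apply: supnorm_eq => w w1.
have e := symbol_adjoint hs (CDq_T cf) (CDq_T cg) (anti_adj hf) w1.
exact (etrans (congr1 (fun u : C => cabs u) e) (cabsJ _)).
Qed.

Lemma antihol_iso : isometric_alg_iso (@AntiHolD R) (commutant zb) T.
Proof.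
split.
- by move=> f hf; exact: antihol_T.
- by move=> a /T_antihol[f hf ->]; exists f.
- move=> f g hf hg; split=> [fg w|fg].
    rewrite inE => Dw; have := anti_adj hf; rewrite fg => h.
    have e := adj_uniq hm h (anti_adj hg).
    have := hol_eq hm (AntiHolD_conj hf) (AntiHolD_conj hg) (fun x => congr1 (@^~ x) e) Dw.
    by move/(congr1 (@conjc R)); rewrite !conjcK.
  by apply/funext => x; apply: (m_T_eq hm) => w Dw; apply: fg; rewrite inE.
- exact: (T1E hm).
- by move=> f g [cf _] [cg _]; apply/funext => x; exact: (m_TD hm x cf cg).
- by move=> c f [cf _]; apply/funext => x; exact: (m_TZ hm c x cf).
(* Adjunction reverses products, so the conjugates are multiplied in the opposite order; pointwise
   multiplication is commutative. *)
- move=> f g hf hg; have h1 := AntiHolD_conj hf; have h2 := AntiHolD_conj hg.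
  have [c12 _] := HolDM h2 h1.
  have A1 := adjC hm (m_T_adj hm c12).
  have e : T (fun w => (g w)^*%C * (f w)^*%C) = T (fun w => (g w)^*%C) \o T (fun w => (f w)^*%C).
    by apply/funext => x; exact: (T_mul hm x h2 h1).
  have A2 := adj_comp (adjC hm (anti_adj hg)) (adjC hm (anti_adj hf)).
  rewrite e in A1; have := adj_uniq hm A1 A2 => <-; congr T; apply/funext => w /=.
  by rewrite conjM !conjcK mulrC.
move=> f hf; have [cf _] := hf; rewrite (opnorm_adj (CDq_T cf) (anti_adj hf)).
rewrite (opnorm_T (AntiHolD_conj hf)); apply: supnorm_eq => w _; exact: cabsJ.
Qed.

(** * Strong against weak antiholomorphy *)

Let zbj x : zb (j x) = q%:C *: j (zb x).
Proof.
have [K _ hK] := jop_bnd hq; exact: (zb_j hm hq (jop_lin hq) hK (jop_mon hq)).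
Qed.

(** Moving j across [zbar] cancels it against the inverse in [delta]: along j the derivative is a
    multiple of [zbar]. *)
Let delta_j x : delta (j x) = (1 - q)^-1%:C *: (q%:C *: zb x).
Proof. by rewrite /delta zbj -(linZ _ _ (jop_lin hq)) (jinvK hq hm). Qed.

(** For a = T(f) one has J(a) = T(f(q .)), bounded and again commuting with [zbar]; by [delta_j]
    this commutation is the vanishing of [del a]. *)
Lemma strongly_antihol_sub a : commutant zb a -> strongly_antihol a.
Proof.
move=> ha; have [f hf af] := T_antihol ha.
have hg := AntiHolD_conj hf; have qi : 0 < q <= 1 by case/andP: hq => -> /ltW.
pose fq w := f (q%:C * w).
have hfq : AntiHolD fq by apply: HolD_conj; exact: dil_HolD qi hg.
have [K _ hK] := jop_bnd hq.
have E x : a (j x) = j (T fq x).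
  by rewrite af; exact: (j_T_antihol hm hq (jop_lin hq) hK (jop_mon hq) x hg).
have JE : J a = T fq by apply/funext => x; rewrite /J /= E (jinvK hq hm).
have [cq comm] := antihol_T hfq; have lq := CDq_lin hm cq.
split; first by case: ha.
  split; first by move=> x; rewrite E; exists (T fq x).
  by rewrite JE; apply/bounded_opP; split=> //; exists (opnorm (T fq)); exact: (CDq_bd hm).
move=> _ [x _ <-]; rewrite /del E JE !delta_j (linZ _ _ lq) (linZ _ _ lq) comm.
by rewrite subrr.
Qed.

(** By [delta_j], [del a = 0] says that J(a) commutes with [zbar]. Conjugating back by j, a commutes
    with [zbar] on the range of j, where the quadratic form is tested. *)
Lemma strongly_antihol_commutant a : strongly_antihol a -> commutant zb a.
Proof.
move=> [ha [hj /bounded_opP[lJ _]] hd]; split=> //.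
apply: iffLR (commutant_form hq hm ha (zb_lin hm) (zb_bd hm) (q1_neq0 hq)) _ => _ [x _ <-].
rewrite [zb (a _) - _](_ : _ = 0) ?(dot0r hm) ?mulr0//.
have E y : a (j y) = j (J a y).
  by rewrite /J /=; have [u _ <-] := hj y; rewrite (jinvK hq hm).
have := hd (j x) (ex_intro2 _ _ x I erefl).
rewrite /del E !delta_j (linZ _ _ lJ) (linZ _ _ lJ) -!scalerBr => /eqP.
have q0 : q%:C != 0 :> C.
  by rewrite -cabs_gt0 cabsR normr_gt0 gt_eqF//; case/andP: hq.
rewrite scaler_eq0 (negPf (q1_neq0 hq))/= scaler_eq0 (negPf q0)/= subr_eq0 => /eqP e.
by rewrite !zbj (linZ _ _ (CDq_lin hm ha)) E e subrr.
Qed.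

End main.

Theorem theorem16 (R : realType) (q : R) (hq : 0 < q < 1) :
  (forall f : R[i] -> R[i], HolD f -> weakly_hol (toeplitz (q := q) f)) /\
  (forall a : hardy q -> hardy q, weakly_hol a ->
    exists2 f : R[i] -> R[i], HolD f & a = toeplitz f) /\
  (forall sigma, symbol_map (q := q) sigma ->
    forall a : hardy q -> hardy q, weakly_hol a ->
      opnorm a = supnorm (@circle R) (sigma a)) /\
  (banach_subalgebra (@weakly_hol R q) /\
    exists Phi, isometric_alg_iso (@HolD R) (@weakly_hol R q) Phi) /\
  ((forall f : R[i] -> R[i],
      AntiHolD f -> weakly_antihol (toeplitz (q := q) f)) /\
   (forall a : hardy q -> hardy q, weakly_antihol a ->
      exists2 f : R[i] -> R[i], AntiHolD f & a = toeplitz f) /\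
   (forall sigma, symbol_map (q := q) sigma ->
      forall a : hardy q -> hardy q, weakly_antihol a ->
        opnorm a = supnorm (@circle R) (sigma a)) /\
   (banach_subalgebra (@weakly_antihol R q) /\
      exists Phi, isometric_alg_iso (@AntiHolD R) (@weakly_antihol R q) Phi)) /\
  (forall a : hardy q -> hardy q, CDq a ->
    (strongly_antihol a <-> weakly_antihol a)).
Proof.
have [rho_inf hm] := hardy_model hq.
rewrite !(weakly_holE hq hm) !(weakly_antiholE hq hm); split; [|split; [|split; [|split; [|split]]]].
- by move=> f hf; exact: (hol_T hm hf).
- by move=> a /(T_hol hm).
- by move=> sigma hs a /(T_hol hm)[f hf ->]; exact: (max_principle hm hs hf).
- split; first exact: (commutant_subalgebra hm (z_lin hm) (z_bd hm)).
  by exists (@toeplitz R q); exact: (hol_iso hm).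
- split; first by move=> f hf; exact: (antihol_T hm hf).
  split; first by move=> a /(T_antihol hm).
  split; first by move=> sigma hs a /(T_antihol hm)[f hf ->]; exact: (antihol_max_principle hm hs hf).
  split; first exact: (commutant_subalgebra hm (zb_lin hm) (zb_bd hm)).
  by exists (@toeplitz R q); exact: (antihol_iso hm).
- move=> a _; split; first exact: (strongly_antihol_commutant hq hm).
  exact: (strongly_antihol_sub hq hm).
Qed.
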